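(* Let $\delta_1$ denote the supremum of all numbers $\delta>0$ with the following property: every function $f\in\mathcal{A}$ satisfying $L(f)\le e^{\delta} l(f)$ is univalent on $\mathbb{D}$. Then $$\frac{7\pi}{25}<\delta_1<\frac{5\pi}{7}.$$
   Context: $\mathbb{D}=\{z\in\mathbb{C}:|z|<1\}$. $\mathcal{A}$ denotes the class of analytic functions $f$ on $\mathbb{D}$ normalized by $f(0)=0$, $f'(0)=1$. The value of $zf'(z)/f(z)$ at $z=0$ is understood as $1$. For $f\in\mathcal{A}$, $L(f)=\sup_{z\in\mathbb{D}}|zf'(z)/f(z)|$ and $l(f)=\inf_{z\in\mathbb{D}}|zf'(z)/f(z)|$ (so $0\le l(f)\le 1\le L(f)\le+\infty$). *)

(* Defs.v *)
From Stdlib Require Import Reals.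
From Coquelicot Require Import Coquelicot.
Open Scope R_scope.

Definition in_disk (z : C) : Prop := Cmod z < 1.

Definition has_cderiv (f : C -> C) (z d : C) : Prop :=
  is_derive (K := C_AbsRing) (V := C_NormedModule) f z d.

Definition analytic_on_disk (f : C -> C) : Prop :=
  forall z, in_disk z -> exists d, has_cderiv f z d.

Definition classA (f : C -> C) : Prop :=
  analytic_on_disk f /\ f 0%C = 0%C /\ has_cderiv f 0%C 1%C.

(* The set of values |z f'(z) / f(z)| for z in D (in the extended reals).
   At z = 0 the value is 1 by convention; at a zero z <> 0 of f the
   quantity z f'/f has a pole, and its modulus is taken to be +infinity. *)
Definition quot_values (f : C -> C) (x : Rbar) : Prop :=
  exists z d, in_disk z /\ has_cderiv f z d /\
   ( (z = 0%C /\ x = Finite 1)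
   \/ (z <> 0%C /\ f z = 0%C /\ x = p_infty)
   \/ (z <> 0%C /\ f z <> 0%C /\ x = Finite (Cmod (z * d / f z)%C)) ).

Definition Lf (f : C -> C) : Rbar := Rbar_lub (quot_values f).
Definition lf (f : C -> C) : Rbar := Rbar_glb (quot_values f).

Definition univalent_on_disk (f : C -> C) : Prop :=
  forall z w, in_disk z -> in_disk w -> f z = f w -> z = w.

Definition good_delta (delta : R) : Prop :=
  forall f : C -> C, classA f ->
    Rbar_le (Lf f) (Rbar_mult (Finite (exp delta)) (lf f)) ->
    univalent_on_disk f.

Definition delta1 : Rbar := Lub_Rbar (fun delta => 0 < delta /\ good_delta delta).

(* Main.v *)
(** With [z = e^w], a function [f] of class A becomes [F w = log f (e^w)] on the half-plane [Re w < 0],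
    and [F' = z f'(z) / f(z) = e^q] where [q] takes values in a vertical strip of width [delta].
    Univalence of [f] amounts to injectivity of [F].

    Lower bound: Schwarz-Pick gives [|q'(w)| <= (delta / PI) / |Re w|].  If [F a = F b], integrate [F']
    from a deeper point [m] to [a] and to [b]; when [delta / PI <= 29/100] the distortion of [F'] along
    these segments is too small for the two displacements to coincide.

    Upper bound: for [p(z) = ((1 - conj eta z) / (1 - eta z))^(i kappa)], [eta = e^(i alpha)], the function [f]
    with [z f' / f = p] commutes with complex conjugation, so it fails to be univalent as soon as
    [Im f] changes sign in the lower half-disk.  In the strip coordinate
    [w = i alpha + log ((1 - conj eta z) / (1 - eta z))] one has
    [d log f = i sin alpha e^(kappa (i w + alpha)) / (cosh w - cos alpha) dw], and the change of [arg f] along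
    a horizontal and then a vertical segment can be estimated; [kappa = 7/10] and [alpha = 1/10] suffice.

    Holomorphy is only assumed as complex differentiability at every point, so Goursat's theorem
    on rectangles is the starting point; applied to [g (e^w)] it yields the mean value formulas on circles. *)

Require Import Defs.
From Stdlib Require Import Reals Lra Lia Classical ClassicalChoice Ranalysis5 Machin.
From Coquelicot Require Import Coquelicot.
Open Scope R_scope.

Arguments Cmod x%_C_scope.

(** * Complex differentiability *)

(** Both bounds leave little room: [29 / 100] only has to exceed [7 / 25 = 28 / 100], and [7 / 10]
    to stay below [5 / 7]. Lower bound: the estimate for [q'] blows up at [Re w = 0], so [F'] is not
    controlled along the segment joining two points near that line. From a base point deeper by an
    amount comparable to [|a - b|], the distortion is at most a negative power, of exponent below 1,
    of the remaining depth; this is integrable up to the end, uniformly in the distance to the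
    boundary. Upper bound: the estimates for both sides of the path carry the factor
    [A = sin alpha * exp (kappa * alpha)], so only a comparison of coefficients matters (0.098
    against 0.093). The vertical side lies at [Re w = S] with [kappa * S = PI / 2], where
    [e^(i kappa w)] is purely imaginary and the change of argument becomes a weighted integral of
    [Re (1 / (cosh w - cos alpha))]. A small [alpha] lets [cos alpha] be replaced by 1, where an
    antiderivative is nearly explicit. The horizontal side runs close to [Im w = PI], where the
    weight [e^(- kappa Im w)] is least. *)

Definition cderiv (f : C -> C) (z d : C) : Prop :=
  forall eps, 0 < eps -> exists del, 0 < del /\ forall h : C, Cmod h < del ->
    Cmod (f (z + h) - f z - d * h)%C <= eps * Cmod h.

Definition vderiv (g : R -> C) (t : R) (d : C) : Prop :=
  forall eps, 0 < eps -> exists del, 0 < del /\ forall h : R, Rabs h < del ->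
    Cmod (g (t + h)%R - g t - d * RtoC h)%C <= eps * Rabs h.

Lemma has_cderiv_cderiv f z d : has_cderiv f z d <-> cderiv f z d.
Proof.
  unfold has_cderiv, is_derive, filterdiff; split.
  - intros [_ H] eps He.
    assert (Hz : is_filter_lim (locally (T := AbsRing_UniformSpace C_AbsRing) z) z) by (intros P HP; exact HP).
    destruct (H z Hz (mkposreal eps He)) as [del Hd].
    exists del; split; [apply cond_pos|]. intros h Hh.
    specialize (Hd (z + h)%C).
    assert (Hb : ball (M := AbsRing_UniformSpace C_AbsRing) z del (z + h)%C).
    { change (Cmod ((z + h) - z)%C < del). replace ((z + h) - z)%C with h by ring. exact Hh. }
    specialize (Hd Hb).
    change (Cmod ((f (z + h) - f z) - (((z + h) - z) * d))%C <= eps * Cmod ((z + h) - z)%C) in Hd.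
    replace ((z + h) - z)%C with h in Hd by ring.
    replace (f (z + h) - f z - d * h)%C with (f (z + h) - f z - h * d)%C by ring. exact Hd.
  - intros H; split.
    + apply is_linear_scal_l.
    + intros x Hx.
      assert (Ex : z = x).
      { apply (is_filter_lim_locally_unique (K := C_AbsRing) (V := AbsRing_NormedModule C_AbsRing)). exact Hx. }
      subst x. intros [eps He]. destruct (H eps He) as [del [Hd Hl]].
      exists (mkposreal del Hd).
      assert (K : forall y : C, Cmod (y - z)%C < del ->
        Cmod ((f y - f z) - ((y - z) * d))%C <= eps * Cmod (y - z)%C).
      { intros y Hy. specialize (Hl (y - z)%C Hy).
        replace (z + (y - z))%C with y in Hl by ring.
        replace (f y - f z - (y - z) * d)%C with (f y - f z - d * (y - z))%C by ring. exact Hl. }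
      exact K.
Qed.

Lemma Cmod_triangle_minus (a b : C) : Cmod (a - b)%C <= Cmod a + Cmod b.
Proof. eapply Rle_trans; [apply Cmod_triangle|]. rewrite Cmod_opp. lra. Qed.

Lemma Cmod_triangle_inv (a b : C) : Cmod a - Cmod b <= Cmod (a - b)%C.
Proof.
  assert (H := Cmod_triangle (a - b)%C b).
  replace (a - b + b)%C with a in H by ring. lra.
Qed.

Lemma Cmod_nz (z : C) : z <> RtoC 0 -> 0 < Cmod z.
Proof. apply Cmod_gt_0. Qed.

Lemma cderiv_unique f z d1 d2 : cderiv f z d1 -> cderiv f z d2 -> d1 = d2.
Proof.
  intros H1 H2.
  apply has_cderiv_cderiv in H1. apply has_cderiv_cderiv in H2.
  transitivity (C_derive f z); [symmetry|]; apply is_C_derive_unique; assumption.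
Qed.

Lemma cderiv_ext_loc f g z d r : 0 < r ->
  (forall w : C, Cmod (w - z)%C < r -> f w = g w) -> cderiv f z d -> cderiv g z d.
Proof.
  intros Hr E H eps He. destruct (H eps He) as [del [Hd K]].
  exists (Rmin del r); split; [apply Rmin_pos; assumption|].
  intros h Hh. assert (A := Rmin_l del r). assert (B := Rmin_r del r).
  rewrite <- (E (z + h)%C), <- (E z). apply K; lra.
  - replace (z - z)%C with (RtoC 0) by ring. rewrite Cmod_0; exact Hr.
  - replace (z + h - z)%C with h by ring. lra.
Qed.

Lemma cderiv_ext f g z d : (forall w, f w = g w) -> cderiv f z d -> cderiv g z d.
Proof. intros E. apply (cderiv_ext_loc f g z d 1); auto with real. Qed.

Lemma cderiv_const c z : cderiv (fun _ => c) z 0%C.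
Proof.
  intros eps He. exists 1; split; [lra|]. intros h _.
  replace (c - c - 0 * h)%C with (RtoC 0) by ring. rewrite Cmod_0.
  assert (H := Cmod_ge_0 h). nra.
Qed.

Lemma cderiv_id z : cderiv (fun w => w) z 1%C.
Proof.
  intros eps He. exists 1; split; [lra|]. intros h _.
  replace (z + h - z - 1 * h)%C with (RtoC 0) by ring. rewrite Cmod_0.
  assert (H := Cmod_ge_0 h). nra.
Qed.

(* The differentiability conditions over C and over R share this estimate: [k] is the increment of the inner function. *)
Lemma chain_estimate (A : C -> C) (d v : C) (eps : R) : 0 < eps ->
  (forall e, 0 < e -> exists del, 0 < del /\ forall k : C, Cmod k < del ->
    Cmod (A k - d * k)%C <= e * Cmod k) ->
  exists e1 r, 0 < e1 /\ 0 < r /\ forall (k : C) (h : C), Cmod h < r ->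
    Cmod (k - v * h)%C <= e1 * Cmod h -> Cmod (A k - d * v * h)%C <= eps * Cmod h.
Proof.
  intros He HA.
  assert (Pd := Cmod_ge_0 d). assert (Pv := Cmod_ge_0 v).
  set (e1 := Rmin 1 (eps / 2 / (Cmod d + 1))).
  assert (He1 : 0 < e1).
  { apply Rmin_pos; [lra|]. apply Rdiv_lt_0_compat; lra. }
  assert (E1a : e1 <= 1) by apply Rmin_l.
  assert (E1b : e1 * (Cmod d + 1) <= eps / 2).
  { replace (eps / 2) with (eps / 2 / (Cmod d + 1) * (Cmod d + 1)) by (field; lra).
    apply Rmult_le_compat_r; [lra|apply Rmin_r]. }
  destruct (HA (eps / 2 / (Cmod v + 1))) as [del [Hd K]].
  { apply Rdiv_lt_0_compat; lra. }
  exists e1, (del / (Cmod v + 1)). split; [assumption|]. split; [apply Rdiv_lt_0_compat; lra|].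
  intros k h Hh Hk. assert (Ph := Cmod_ge_0 h).
  assert (Bk : Cmod k <= (Cmod v + 1) * Cmod h).
  { assert (T := Cmod_triangle (k - v * h)%C (v * h)%C).
    replace (k - v * h + v * h)%C with k in T by ring. rewrite Cmod_mult in T. nra. }
  assert (Bk2 : Cmod k < del).
  { eapply Rle_lt_trans; [exact Bk|]. apply (Rmult_lt_compat_l (Cmod v + 1)) in Hh; [|lra].
    replace ((Cmod v + 1) * (del / (Cmod v + 1))) with del in Hh by (field; lra). exact Hh. }
  specialize (K k Bk2).
  replace (A k - d * v * h)%C with ((A k - d * k) + d * (k - v * h))%C by ring.
  eapply Rle_trans; [apply Cmod_triangle|]. rewrite Cmod_mult.
  assert (Q1 : eps / 2 / (Cmod v + 1) * Cmod k <= eps / 2 * Cmod h).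
  { replace (eps / 2 * Cmod h) with (eps / 2 / (Cmod v + 1) * ((Cmod v + 1) * Cmod h)) by (field; lra).
    apply Rmult_le_compat_l; [|exact Bk]. apply Rlt_le, Rdiv_lt_0_compat; lra. }
  assert (Q2 : Cmod d * Cmod (k - v * h) <= Cmod d * (e1 * Cmod h)) by (apply Rmult_le_compat_l; lra).
  nra.
Qed.

Lemma cderiv_comp f g z d v : cderiv f (g z) d -> cderiv g z v ->
  cderiv (fun w => f (g w)) z (d * v)%C.
Proof.
  intros Hf Hg eps He.
  destruct (chain_estimate (fun k => f (g z + k) - f (g z))%C d v eps He Hf) as [e1 [r [H1 [Hr K]]]].
  destruct (Hg e1 H1) as [del [Hd L]].
  exists (Rmin del r); split; [apply Rmin_pos; assumption|].
  intros h Hh. assert (A := Rmin_l del r). assert (B := Rmin_r del r).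
  assert (Hr' : Cmod h < r) by lra. assert (Hd' : Cmod h < del) by lra.
  specialize (K (g (z + h) - g z)%C h Hr' (L h Hd')). cbv beta in K.
  replace (g z + (g (z + h) - g z))%C with (g (z + h))%C in K by ring. exact K.
Qed.

Lemma vderiv_comp f g t d v : cderiv f (g t) d -> vderiv g t v ->
  vderiv (fun s => f (g s)) t (d * v)%C.
Proof.
  intros Hf Hg eps He.
  destruct (chain_estimate (fun k => f (g t + k) - f (g t))%C d v eps He Hf) as [e1 [r [H1 [Hr K]]]].
  destruct (Hg e1 H1) as [del [Hd L]].
  exists (Rmin del r); split; [apply Rmin_pos; assumption|].
  intros h Hh. assert (A := Rmin_l del r). assert (B := Rmin_r del r).
  assert (Hr' : Cmod h < r) by (rewrite Cmod_R; lra). assert (Hd' : Rabs h < del) by lra.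
  specialize (L h Hd'). rewrite <- Cmod_R in L |- *.
  specialize (K (g (t + h)%R - g t)%C h Hr' L). cbv beta in K.
  replace (g t + (g (t + h)%R - g t))%C with (g (t + h)%R)%C in K by ring. exact K.
Qed.

Lemma cderiv_plus f g z a b : cderiv f z a -> cderiv g z b ->
  cderiv (fun w => f w + g w)%C z (a + b)%C.
Proof.
  intros Hf Hg eps He.
  destruct (Hf (eps / 2)) as [d1 [P1 K1]]; [lra|].
  destruct (Hg (eps / 2)) as [d2 [P2 K2]]; [lra|].
  exists (Rmin d1 d2); split; [apply Rmin_pos; assumption|].
  intros h Hh. assert (A := Rmin_l d1 d2). assert (B := Rmin_r d1 d2).
  specialize (K1 h ltac:(lra)). specialize (K2 h ltac:(lra)).
  replace (f (z + h) + g (z + h) - (f z + g z) - (a + b) * h)%C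
    with ((f (z + h) - f z - a * h) + (g (z + h) - g z - b * h))%C by ring.
  eapply Rle_trans; [apply Cmod_triangle|]. lra.
Qed.

Lemma cderiv_scal c f z a : cderiv f z a -> cderiv (fun w => c * f w)%C z (c * a)%C.
Proof.
  intros Hf. apply (cderiv_comp (fun u => c * u)%C f z c a); [|exact Hf].
  intros eps He. exists 1; split; [lra|]. intros h _.
  replace (c * (f z + h) - c * f z - c * h)%C with (RtoC 0) by ring. rewrite Cmod_0.
  assert (H := Cmod_ge_0 h). nra.
Qed.

Lemma cderiv_sqr z : cderiv (fun w => w * w)%C z (2 * z)%C.
Proof.
  intros eps He. exists eps; split; [lra|]. intros h Hh.
  replace ((z + h) * (z + h) - z * z - 2 * z * h)%C with (h * h)%C by ring.
  rewrite Cmod_mult. assert (H := Cmod_ge_0 h). nra.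
Qed.

Lemma cderiv_eq f z d d' : cderiv f z d -> d = d' -> cderiv f z d'.
Proof. intros H <-; exact H. Qed.

Lemma vderiv_eq g t d d' : vderiv g t d -> d = d' -> vderiv g t d'.
Proof. intros H <-; exact H. Qed.

Lemma cderiv_minus f g z a b : cderiv f z a -> cderiv g z b ->
  cderiv (fun w => f w - g w)%C z (a - b)%C.
Proof.
  intros Hf Hg.
  eapply cderiv_eq; [eapply (cderiv_ext (fun w => f w + (-(1)) * g w)%C)|].
  - intros w. ring.
  - apply cderiv_plus; [exact Hf|apply cderiv_scal, Hg].
  - ring.
Qed.

(* Polarization: [4 f g = (f + g)^2 - (f - g)^2]. *)
Lemma cderiv_mult f g z a b : cderiv f z a -> cderiv g z b ->
  cderiv (fun w => f w * g w)%C z (a * g z + f z * b)%C.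
Proof.
  intros Hf Hg.
  assert (H1 := cderiv_comp _ _ _ _ _ (cderiv_sqr _) (cderiv_plus _ _ _ _ _ Hf Hg)).
  assert (H2 := cderiv_comp _ _ _ _ _ (cderiv_sqr _) (cderiv_minus _ _ _ _ _ Hf Hg)).
  eapply cderiv_eq; [eapply cderiv_ext; [|exact (cderiv_scal (/ 4)%C _ _ _ (cderiv_minus _ _ _ _ _ H1 H2))]|].
  - intros w. cbv beta. field.
  - cbv beta. field.
Qed.

Lemma cderiv_inv_id (z : C) : z <> RtoC 0 -> cderiv (fun w => / w)%C z (- / (z * z))%C.
Proof.
  intros Hz eps He. assert (P := Cmod_nz z Hz).
  exists (Rmin (Cmod z / 2) (eps * Cmod z ^ 3 / 2)). split.
  { apply Rmin_pos; [lra|]. assert (0 < Cmod z ^ 3) by (apply pow_lt; lra). nra. }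
  intros h Hh.
  assert (A := Rmin_l (Cmod z / 2) (eps * Cmod z ^ 3 / 2)).
  assert (B := Rmin_r (Cmod z / 2) (eps * Cmod z ^ 3 / 2)).
  assert (Q : Cmod z / 2 <= Cmod (z + h)).
  { assert (T := Cmod_triangle_inv z (- h)%C). replace (z - - h)%C with (z + h)%C in T by ring.
    rewrite Cmod_opp in T. lra. }
  assert (Nz : (z + h)%C <> RtoC 0).
  { intros E. rewrite E, Cmod_0 in Q. lra. }
  replace (/ (z + h) - / z - - / (z * z) * h)%C with (h * h / ((z + h) * (z * z)))%C
    by (field; auto).
  assert (Nzz : ((z + h) * (z * z))%C <> RtoC 0) by (repeat apply Cmult_neq_0; assumption).
  rewrite Cmod_div by assumption. rewrite !Cmod_mult.
  assert (H := Cmod_ge_0 h).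
  apply Rle_div_l; [apply Rmult_lt_0_compat; nra|].
  assert (Cmod h <= eps * (Cmod (z + h) * (Cmod z * Cmod z))).
  { apply Rle_trans with (eps * Cmod z ^ 3 / 2); [lra|].
    replace (eps * Cmod z ^ 3 / 2) with (eps * ((Cmod z / 2) * (Cmod z * Cmod z))) by (simpl; field).
    apply Rmult_le_compat_l; [lra|]. apply Rmult_le_compat_r; nra. }
  nra.
Qed.

Lemma cderiv_inv f z a : f z <> RtoC 0 -> cderiv f z a ->
  cderiv (fun w => / f w)%C z (- a / (f z * f z))%C.
Proof.
  intros Hz Hf. eapply cderiv_eq; [exact (cderiv_comp (fun u => / u)%C f z _ _ (cderiv_inv_id _ Hz) Hf)|].
  field. assumption.
Qed.

Lemma cderiv_div f g z a b : g z <> RtoC 0 -> cderiv f z a -> cderiv g z b ->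
  cderiv (fun w => f w / g w)%C z ((a * g z - f z * b) / (g z * g z))%C.
Proof.
  intros Hz Hf Hg. eapply cderiv_eq; [exact (cderiv_mult _ _ _ _ _ Hf (cderiv_inv _ _ _ Hz Hg))|].
  cbv beta. field. assumption.
Qed.

Lemma cderiv_cont f z d : cderiv f z d ->
  forall eps, 0 < eps -> exists del, 0 < del /\ forall h : C, Cmod h < del -> Cmod (f (z + h) - f z)%C < eps.
Proof.
  intros H eps He. destruct (H 1 Rlt_0_1) as [del [Hd K]].
  assert (Pd := Cmod_ge_0 d).
  exists (Rmin del (eps / (Cmod d + 2))). split.
  { apply Rmin_pos; [assumption|apply Rdiv_lt_0_compat; lra]. }
  intros h Hh. assert (A := Rmin_l del (eps / (Cmod d + 2))). assert (B := Rmin_r del (eps / (Cmod d + 2))).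
  specialize (K h ltac:(lra)).
  assert (T := Cmod_triangle (f (z + h) - f z - d * h)%C (d * h)%C).
  replace (f (z + h) - f z - d * h + d * h)%C with (f (z + h) - f z)%C in T by ring.
  rewrite Cmod_mult in T. assert (Ph := Cmod_ge_0 h).
  assert (Cmod h * (Cmod d + 2) < eps).
  { apply Rlt_div_r; lra. }
  nra.
Qed.

(** * Curves in the plane and their real components *)

Lemma Cmod_le_ReIm (z : C) : Cmod z <= Rabs (Re z) + Rabs (Im z).
Proof.
  replace z with (RtoC (Re z) + Ci * RtoC (Im z))%C at 1.
  - eapply Rle_trans; [apply Cmod_triangle|]. rewrite Cmod_mult, Cmod_Ci, !Cmod_R. lra.
  - destruct z as [x y]. unfold Ci, RtoC, Cplus, Cmult, Re, Im; simpl. f_equal; ring.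
Qed.

Lemma im_le_Cmod (z : C) : Rabs (Im z) <= Cmod z.
Proof. eapply Rle_trans; [apply Rmax_r|]. apply Rmax_Cmod. Qed.

Lemma Re_plus (a b : C) : Re (a + b)%C = Re a + Re b. Proof. reflexivity. Qed.
Lemma Im_plus (a b : C) : Im (a + b)%C = Im a + Im b. Proof. reflexivity. Qed.
Lemma Re_minus (a b : C) : Re (a - b)%C = Re a - Re b. Proof. reflexivity. Qed.
Lemma Im_minus (a b : C) : Im (a - b)%C = Im a - Im b. Proof. reflexivity. Qed.
Lemma Re_mult (a b : C) : Re (a * b)%C = Re a * Re b - Im a * Im b. Proof. reflexivity. Qed.
Lemma Im_mult (a b : C) : Im (a * b)%C = Re a * Im b + Im a * Re b. Proof. reflexivity. Qed.

Lemma C_eq (a b : C) : Re a = Re b -> Im a = Im b -> a = b.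
Proof. destruct a, b; simpl; intros; subst; reflexivity. Qed.

Lemma is_derive_eps (f : R -> R) (t l : R) :
  (forall eps, 0 < eps -> exists del, 0 < del /\ forall h, Rabs h < del ->
     Rabs (f (t + h) - f t - l * h) <= eps * Rabs h) -> is_derive f t l.
Proof.
  intros H. apply is_derive_Reals. intros eps He.
  destruct (H (eps / 2)) as [del [Hd K]]; [lra|].
  exists (mkposreal del Hd). intros h Hh Hlt. specialize (K h Hlt).
  assert (P := Rabs_pos_lt h Hh).
  replace ((f (t + h) - f t) / h - l) with ((f (t + h) - f t - l * h) / h) by (field; assumption).
  rewrite Rabs_div by assumption. apply Rlt_div_l; [assumption|]. nra.
Qed.

Lemma eps_is_derive (f : R -> R) (t l : R) : is_derive f t l ->
  forall eps, 0 < eps -> exists del, 0 < del /\ forall h, Rabs h < del ->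
     Rabs (f (t + h) - f t - l * h) <= eps * Rabs h.
Proof.
  intros H eps He. apply is_derive_Reals in H. destruct (H eps He) as [del K].
  exists del; split; [apply cond_pos|]. intros h Hlt.
  destruct (Req_dec h 0) as [->|Hh].
  - rewrite Rplus_0_r. replace (f t - f t - l * 0) with 0 by ring. rewrite Rabs_R0. lra.
  - specialize (K h Hh Hlt). assert (P := Rabs_pos_lt h Hh).
    replace (f (t + h) - f t - l * h) with (((f (t + h) - f t) / h - l) * h) by (field; assumption).
    rewrite Rabs_mult. nra.
Qed.

(** The factor [c] covers all uses: [1] and [- Ci] extract the two components, and the conjugate of
    an increment projects onto its direction. *)
Lemma vderiv_Re c g t d : vderiv g t d -> is_derive (fun s => Re (c * g s)%C) t (Re (c * d)%C).
Proof.
  intros H. apply is_derive_eps. intros eps He. assert (Pc := Cmod_ge_0 c).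
  destruct (H (eps / (Cmod c + 1))) as [del [Hd K]]; [apply Rdiv_lt_0_compat; lra|].
  exists del; split; [assumption|]. intros h Hh. specialize (K h Hh).
  replace (Re (c * g (t + h)%R)%C - Re (c * g t)%C - Re (c * d)%C * h)
    with (Re (c * (g (t + h)%R - g t - d * RtoC h))%C).
  2:{ unfold RtoC; rewrite !Re_mult, !Re_minus, !Im_minus, Re_mult, Im_mult. simpl. ring. }
  eapply Rle_trans; [apply re_le_Cmod|]. rewrite Cmod_mult.
  assert (Ph := Rabs_pos h).
  replace (eps * Rabs h) with ((Cmod c + 1) * (eps / (Cmod c + 1) * Rabs h)) by (field; lra).
  assert (0 <= eps / (Cmod c + 1) * Rabs h).
  { apply Rmult_le_pos; [apply Rlt_le, Rdiv_lt_0_compat; lra|assumption]. }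
  assert (M := Cmod_ge_0 (g (t + h)%R - g t - d * h)). nra.
Qed.

Lemma vderiv_re g t d : vderiv g t d -> is_derive (fun s => Re (g s)) t (Re d).
Proof.
  intros H. apply (vderiv_Re (RtoC 1)) in H. rewrite Cmult_1_l in H.
  eapply is_derive_ext; [|exact H]. intros s. cbv beta. rewrite Cmult_1_l. reflexivity.
Qed.

Lemma vderiv_im g t d : vderiv g t d -> is_derive (fun s => Im (g s)) t (Im d).
Proof.
  intros H. apply (vderiv_Re (- Ci)%C) in H.
  replace (Re (- Ci * d)%C) with (Im d) in H by (rewrite Re_mult; simpl; ring).
  eapply is_derive_ext; [|exact H]. intros s. cbv beta. rewrite Re_mult; simpl; ring.
Qed.

Lemma vderiv_parts g t d : is_derive (fun s => Re (g s)) t (Re d) ->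
  is_derive (fun s => Im (g s)) t (Im d) -> vderiv g t d.
Proof.
  intros H1 H2 eps He.
  destruct (eps_is_derive _ _ _ H1 (eps / 2)) as [d1 [P1 K1]]; [lra|].
  destruct (eps_is_derive _ _ _ H2 (eps / 2)) as [d2 [P2 K2]]; [lra|].
  exists (Rmin d1 d2); split; [apply Rmin_pos; assumption|].
  intros h Hh. assert (A := Rmin_l d1 d2). assert (B := Rmin_r d1 d2).
  specialize (K1 h ltac:(lra)). specialize (K2 h ltac:(lra)).
  eapply Rle_trans; [apply Cmod_le_ReIm|].
  rewrite !Re_minus, !Im_minus, Re_mult, Im_mult.
  replace (Re (g (t + h)) - Re (g t) - (Re d * Re h - Im d * Im h))
    with (Re (g (t + h)) - Re (g t) - Re d * h) by (simpl; ring).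
  replace (Im (g (t + h)) - Im (g t) - (Re d * Im h + Im d * Re h))
    with (Im (g (t + h)) - Im (g t) - Im d * h) by (simpl; ring).
  lra.
Qed.

Lemma vderiv_line (p v : C) t : vderiv (fun s => p + RtoC s * v)%C t v.
Proof.
  intros eps He. exists 1; split; [lra|]. intros h _.
  replace (p + RtoC (t + h) * v - (p + t * v) - v * h)%C with (RtoC 0)
    by (rewrite RtoC_plus; ring).
  rewrite Cmod_0. assert (H := Rabs_pos h). nra.
Qed.

(* Project the increment onto its own direction and compare real functions. *)
Lemma vderiv_bound (g g' : R -> C) (G G' : R -> R) a b : a <= b ->
  (forall t, a <= t <= b -> vderiv g t (g' t)) ->
  (forall t, a <= t <= b -> is_derive G t (G' t)) ->
  (forall t, a <= t <= b -> Cmod (g' t) <= G' t) ->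
  Cmod (g b - g a) <= G b - G a.
Proof.
  intros Hab Hg HG Hle.
  set (c := Cconj (g b - g a)).
  set (m := Cmod (g b - g a)). assert (Pm : 0 <= m) by apply Cmod_ge_0.
  assert (Hd : forall t, a <= t <= b ->
     is_derive (fun s => minus (Re (c * g s)%C) (m * G s)) t (minus (Re (c * g' t)%C) (m * G' t))).
  { intros t Ht. apply (is_derive_minus (fun s => Re (c * g s)%C) (fun s => m * G s)).
    - apply vderiv_Re, Hg, Ht.
    - apply (is_derive_scal G t m (G' t)), HG, Ht. }
  destruct (MVT_gen (fun s => minus (Re (c * g s)%C) (m * G s)) a b
     (fun t => minus (Re (c * g' t)%C) (m * G' t))) as [x [Hx E]].
  - rewrite Rmin_left, Rmax_right by assumption. intros t Ht. apply Hd; lra.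
  - rewrite Rmin_left, Rmax_right by assumption. intros t Ht.
    apply continuity_pt_filterlim.
    apply (ex_derive_continuous (fun s => minus (Re (c * g s)%C) (m * G s))).
    eexists; apply Hd, Ht.
  - rewrite Rmin_left, Rmax_right in Hx by assumption.
    change ((Re (c * g b)%C - m * G b) - (Re (c * g a)%C - m * G a) = (Re (c * g' x)%C - m * G' x) * (b - a)) in E.
    assert (N : Re (c * g' x)%C <= m * G' x).
    { eapply Rle_trans; [apply Rle_abs|]. eapply Rle_trans; [apply re_le_Cmod|].
      rewrite Cmod_mult. unfold c; rewrite Cmod_conj. apply Rmult_le_compat_l; [exact Pm|]. apply Hle, Hx. }
    assert (Sq : Re (c * g b)%C - Re (c * g a)%C = m * m).
    { rewrite <- Re_minus. replace (c * g b - c * g a)%C with ((g b - g a) * Cconj (g b - g a))%C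
        by (unfold c; ring).
      rewrite <- Cmod2_conj. fold m. simpl. ring. }
    assert (m * m <= m * (G b - G a)).
    { assert ((Re (c * g' x)%C - m * G' x) * (b - a) <= 0) by nra. lra. }
    (* For [m = 0] there is nothing to cancel; what remains is that [G] does not decrease. *)
    destruct Pm as [Pm|Pm].
    + nra.
    + assert (G a <= G b); [|lra].
      apply (Rmult_le_reg_l 1); [lra|].
      destruct (MVT_gen G a b G') as [y [Hy Ey]].
      * rewrite Rmin_left, Rmax_right by assumption. intros t Ht. apply HG; lra.
      * rewrite Rmin_left, Rmax_right by assumption. intros t Ht.
        apply continuity_pt_filterlim, (ex_derive_continuous G). eexists; apply HG, Ht.
      * rewrite Rmin_left, Rmax_right in Hy by assumption.
        assert (0 <= G' y) by (eapply Rle_trans; [apply Cmod_ge_0|apply Hle, Hy]). nra.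
Qed.

(** * Integrals of complex-valued functions *)

Definition vcont (g : R -> C) (t : R) : Prop :=
  continuous (fun s => Re (g s)) t /\ continuous (fun s => Im (g s)) t.

Lemma vcont_const c t : vcont (fun _ => c) t.
Proof. split; apply continuous_const. Qed.

Lemma vcont_plus g h t : vcont g t -> vcont h t -> vcont (fun s => g s + h s)%C t.
Proof.
  intros [A B] [A' B']; split.
  - apply (continuous_plus (fun s => Re (g s)) (fun s => Re (h s))); assumption.
  - apply (continuous_plus (fun s => Im (g s)) (fun s => Im (h s))); assumption.
Qed.

Lemma vcont_mult g h t : vcont g t -> vcont h t -> vcont (fun s => g s * h s)%C t.
Proof.
  intros [A B] [A' B']; split.
  - apply (continuous_minus (fun s => mult (Re (g s)) (Re (h s))) (fun s => mult (Im (g s)) (Im (h s))));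
      apply (continuous_mult (K := R_AbsRing)); assumption.
  - apply (continuous_plus (fun s => mult (Re (g s)) (Im (h s))) (fun s => mult (Im (g s)) (Re (h s))));
      apply (continuous_mult (K := R_AbsRing)); assumption.
Qed.

Lemma vcont_vderiv g t d : vderiv g t d -> vcont g t.
Proof.
  intros H; split.
  - apply (ex_derive_continuous (fun s => Re (g s))). eexists; apply vderiv_re, H.
  - apply (ex_derive_continuous (fun s => Im (g s))). eexists; apply vderiv_im, H.
Qed.

Definition isCInt (g : R -> C) (a b : R) (I : C) : Prop :=
  is_RInt (fun t => Re (g t)) a b (Re I) /\ is_RInt (fun t => Im (g t)) a b (Im I).

Lemma isCInt_eq g a b I J : isCInt g a b I -> I = J -> isCInt g a b J.
Proof. intros H <-; exact H. Qed.

Lemma isCInt_ext g h a b I : a <= b -> (forall t, a <= t <= b -> g t = h t) -> isCInt g a b I -> isCInt h a b I.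
Proof.
  intros Hab E [H1 H2]; split.
  - eapply is_RInt_ext; [|exact H1]. rewrite Rmin_left, Rmax_right by assumption.
    intros t Ht. cbv beta. rewrite E by lra. reflexivity.
  - eapply is_RInt_ext; [|exact H2]. rewrite Rmin_left, Rmax_right by assumption.
    intros t Ht. cbv beta. rewrite E by lra. reflexivity.
Qed.

Lemma isCInt_unique g a b I J : isCInt g a b I -> isCInt g a b J -> I = J.
Proof.
  intros [A B] [A' B'].
  assert (U := is_RInt_unique (V := R_CompleteNormedModule)).
  apply C_eq; etransitivity; [symmetry; exact (U _ _ _ _ A)|exact (U _ _ _ _ A')
    |symmetry; exact (U _ _ _ _ B)|exact (U _ _ _ _ B')].
Qed.

Lemma isCInt_plus g h a b I J : isCInt g a b I -> isCInt h a b J ->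
  isCInt (fun t => g t + h t)%C a b (I + J)%C.
Proof.
  intros [A B] [A' B']; split.
  - apply (is_RInt_plus (fun t => Re (g t)) (fun t => Re (h t)) a b (Re I) (Re J)); assumption.
  - apply (is_RInt_plus (fun t => Im (g t)) (fun t => Im (h t)) a b (Im I) (Im J)); assumption.
Qed.

Lemma isCInt_scal c g a b I : isCInt g a b I -> isCInt (fun t => c * g t)%C a b (c * I)%C.
Proof.
  intros [A B]; split.
  - apply (is_RInt_minus (fun t => scal (Re c) (Re (g t))) (fun t => scal (Im c) (Im (g t))) a b
      (scal (Re c) (Re I)) (scal (Im c) (Im I)));
    [apply (is_RInt_scal (fun t => Re (g t)))|apply (is_RInt_scal (fun t => Im (g t)))]; assumption.
  - apply (is_RInt_plus (fun t => scal (Re c) (Im (g t))) (fun t => scal (Im c) (Re (g t))) a b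
      (scal (Re c) (Im I)) (scal (Im c) (Re I)));
    [apply (is_RInt_scal (fun t => Im (g t)))|apply (is_RInt_scal (fun t => Re (g t)))]; assumption.
Qed.

Lemma isCInt_Chasles g a b c I J : isCInt g a b I -> isCInt g b c J -> isCInt g a c (I + J)%C.
Proof.
  intros [A B] [A' B']; split.
  - exact (is_RInt_Chasles _ _ _ _ _ _ A A').
  - exact (is_RInt_Chasles _ _ _ _ _ _ B B').
Qed.

Lemma isCInt_ex g a b : a <= b -> (forall t, a <= t <= b -> vcont g t) -> exists I, isCInt g a b I.
Proof.
  intros Hab H.
  exists (RInt (fun t => Re (g t)) a b, RInt (fun t => Im (g t)) a b).
  split; apply (RInt_correct (V := R_CompleteNormedModule)), (ex_RInt_continuous (V := R_CompleteNormedModule));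
    rewrite Rmin_left, Rmax_right by assumption; intros t Ht; apply (H t Ht).
Qed.

Lemma isCInt_const c a b : isCInt (fun _ => c) a b (RtoC (b - a) * c)%C.
Proof.
  split.
  - replace (Re (RtoC (b - a) * c)%C) with ((b - a) * Re c) by (rewrite Re_mult; simpl; ring).
    apply (is_RInt_const (V := R_NormedModule) a b (Re c)).
  - replace (Im (RtoC (b - a) * c)%C) with ((b - a) * Im c) by (rewrite Im_mult; simpl; ring).
    apply (is_RInt_const (V := R_NormedModule) a b (Im c)).
Qed.

Lemma isCInt_FTC g g' a b : a <= b -> (forall t, a <= t <= b -> vderiv g t (g' t)) ->
  (forall t, a <= t <= b -> vcont g' t) -> isCInt g' a b (g b - g a)%C.
Proof.
  intros Hab Hd Hc; split.
  - apply (is_RInt_derive (fun t => Re (g t)) (fun t => Re (g' t)));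
      rewrite Rmin_left, Rmax_right by assumption; intros t Ht.
    + apply vderiv_re, Hd, Ht.
    + apply Hc, Ht.
  - apply (is_RInt_derive (fun t => Im (g t)) (fun t => Im (g' t)));
      rewrite Rmin_left, Rmax_right by assumption; intros t Ht.
    + apply vderiv_im, Hd, Ht.
    + apply Hc, Ht.
Qed.

(** Multiplying by [Cconj I] projects the integrand onto the direction of the integral, which
    reduces the claim to monotonicity of a real integral. *)
Lemma isCInt_bound g a b I M : a <= b -> isCInt g a b I ->
  (forall t, a <= t <= b -> Cmod (g t) <= M) -> Cmod I <= M * (b - a).
Proof.
  intros Hab HI HM.
  assert (H := isCInt_scal (Cconj I) _ _ _ _ HI). destruct H as [H _].
  replace (Re (Cconj I * I)%C) with (Cmod I * Cmod I) in H.
  2:{ replace (Cmod I * Cmod I) with (Cmod I ^ 2) by ring. rewrite Cmod2_alt, Re_mult.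
      unfold Cconj, Re, Im; simpl. ring. }
  assert (Hc := is_RInt_const (V := R_NormedModule) a b (Cmod I * M)).
  assert (L := is_RInt_le _ _ _ _ _ _ Hab H Hc).
  change (scal (b - a) (Cmod I * M)) with ((b - a) * (Cmod I * M)) in L.
  assert (P := Cmod_ge_0 I).
  assert (L' : Cmod I * Cmod I <= (b - a) * (Cmod I * M)).
  { apply L. intros t Ht. eapply Rle_trans; [apply Rle_abs|]. eapply Rle_trans; [apply re_le_Cmod|].
    rewrite Cmod_mult, Cmod_conj. apply Rmult_le_compat_l; [exact P|]. apply HM; lra. }
  destruct P as [P|P]; [nra|].
  rewrite <- P. assert (0 <= M) by (eapply Rle_trans; [apply Cmod_ge_0|apply (HM a); lra]).
  nra.
Qed.

(* Subdivide into four and intersect: a square on which [Q] fails contains arbitrarily small bad squares shrinking to a point. *)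
Lemma square_bisection (Q : R -> R -> R -> Prop) :
  (forall x y h, 0 < h -> 0 <= x -> x + h <= 1 -> 0 <= y -> y + h <= 1 ->
     Q x y (h / 2) -> Q (x + h / 2) y (h / 2) ->
     Q x (y + h / 2) (h / 2) -> Q (x + h / 2) (y + h / 2) (h / 2) -> Q x y h) ->
  (forall u v, 0 <= u <= 1 -> 0 <= v <= 1 -> exists d, 0 < d /\ forall x y h,
     0 < h < d -> 0 <= x -> x + h <= 1 -> 0 <= y -> y + h <= 1 ->
     x <= u <= x + h -> y <= v <= y + h -> Q x y h) ->
  Q 0 0 1.
Proof.
  intros Hq Hloc. apply NNPP. intros Hbad.
  pose (good := fun (p : R * R) (h : R) => 0 <= fst p /\ fst p + h <= 1 /\ 0 <= snd p /\ snd p + h <= 1).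
  assert (step : forall (p : R * R) (h : R), exists p' : R * R,
    0 < h -> good p h -> ~ Q (fst p) (snd p) h ->
    good p' (h / 2) /\ ~ Q (fst p') (snd p') (h / 2) /\
    fst p <= fst p' <= fst p + h / 2 /\ snd p <= snd p' <= snd p + h / 2).
  { intros [x y] h. unfold good; simpl.
    destruct (classic (0 < h /\ good (x, y) h /\ ~ Q x y h)) as [[Hh [G N]]|N].
    2:{ exists (x, y). intros A B D. exfalso. apply N. unfold good; simpl. tauto. }
    unfold good in G; simpl in G. destruct G as [G1 [G2 [G3 G4]]].
    assert (K : ~ Q x y (h / 2) \/ ~ Q (x + h / 2) y (h / 2) \/
       ~ Q x (y + h / 2) (h / 2) \/ ~ Q (x + h / 2) (y + h / 2) (h / 2)).
    { apply NNPP. intros M. apply N. apply Hq; auto;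
      apply NNPP; intros M'; apply M; tauto. }
    destruct K as [K|[K|[K|K]]];
      [exists (x, y)|exists (x + h / 2, y)|exists (x, y + h / 2)|exists (x + h / 2, y + h / 2)];
      intros _ _ _; simpl; repeat split; try assumption; lra. }
  destruct (choice _ (fun ph : (R * R) * R => step (fst ph) (snd ph))) as [nx Hnx].
  pose (hh := fun n : nat => (/ 2) ^ n).
  pose (s := fix s n : R * R := match n with O => (0, 0) | S m => nx (s m, hh m) end).
  assert (Hh : forall n, 0 < hh n) by (intros n; apply pow_lt; lra).
  assert (HS : forall n, hh (S n) = hh n / 2) by (intros n; unfold hh; simpl; lra).
  assert (Inv : forall n, good (s n) (hh n) /\ ~ Q (fst (s n)) (snd (s n)) (hh n)).
  { induction n as [|n [IH1 IH2]].
    - unfold good, hh; simpl. repeat split; try lra. exact Hbad.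
    - destruct (Hnx (s n, hh n) (Hh n) IH1 IH2) as [A [B _]]. rewrite HS. split; assumption. }
  assert (Step : forall n, fst (s n) <= fst (s (S n)) <= fst (s n) + hh n / 2 /\
                           snd (s n) <= snd (s (S n)) <= snd (s n) + hh n / 2).
  { intros n. destruct (Inv n) as [A B]. apply (Hnx (s n, hh n) (Hh n) A B). }
  (* Nested intervals, once for both coordinates: lower ends increase and upper ends decrease, so
     the supremum of the lower ends lies in every interval. *)
  assert (L : forall proj : R * R -> R,
    (forall n, proj (s n) <= proj (s (S n)) <= proj (s n) + hh n / 2) ->
    exists u, forall n, proj (s n) <= u <= proj (s n) + hh n).
  { intros proj Hp.
    assert (Hup : forall n k, proj (s (n + k)%nat) + hh (n + k)%nat <= proj (s n) + hh n).
    { intros n; induction k as [|k IH]; [rewrite Nat.add_0_r; lra|].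
      rewrite Nat.add_succ_r. assert (A := Hp (n + k)%nat). rewrite HS. lra. }
    assert (Hlo : forall n k, proj (s n) <= proj (s (n + k)%nat)).
    { intros n; induction k as [|k IH]; [rewrite Nat.add_0_r; lra|].
      rewrite Nat.add_succ_r. assert (A := Hp (n + k)%nat). lra. }
    assert (Hcross : forall n m, proj (s n) <= proj (s m) + hh m).
    { intros n m. assert (A := Hlo n m). assert (B := Hup m n). rewrite Nat.add_comm in B.
      assert (D := Hh (n + m)%nat). lra. }
    destruct (completeness (fun x => exists n, x = proj (s n))) as [u [U1 U2]].
    - exists (proj (s O) + hh O). intros x [n ->]. apply Hcross.
    - exists (proj (s O)), O. reflexivity.
    - exists u. intros n. split; [apply U1; exists n; reflexivity|].
      apply U2. intros x [m ->]. apply Hcross. }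
  destruct (L fst (fun n => proj1 (Step n))) as [u Hu].
  destruct (L snd (fun n => proj2 (Step n))) as [v Hv].
  assert (Bu : 0 <= u <= 1) by (assert (A := Hu O); unfold hh in A; simpl in A; lra).
  assert (Bv : 0 <= v <= 1) by (assert (A := Hv O); unfold hh in A; simpl in A; lra).
  destruct (Hloc u v Bu Bv) as [d [Hd K]].
  destruct (pow_lt_1_zero (/ 2)) with (y := d) as [N HN].
  { rewrite Rabs_pos_eq; lra. } { exact Hd. }
  specialize (HN N (Nat.le_refl N)). rewrite Rabs_pos_eq in HN by (apply Rlt_le, Hh).
  destruct (Inv N) as [[A1 [A2 [A3 A4]]] B]. apply B.
  apply K; auto.
Qed.

(** * Goursat's theorem *)

Lemma Ci_sqr : (Ci * Ci)%C = Copp (RtoC 1).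
Proof. apply C_eq; simpl; ring. Qed.

Lemma vderiv_hor (y t : R) : vderiv (fun x => (x, y) : C) t (RtoC 1).
Proof.
  apply vderiv_parts; simpl.
  - apply (is_derive_id (K := R_AbsRing)).
  - apply (is_derive_const (K := R_AbsRing) (V := R_NormedModule)).
Qed.

Lemma vderiv_ver (x t : R) : vderiv (fun y => (x, y) : C) t Ci.
Proof.
  apply vderiv_parts; simpl.
  - apply (is_derive_const (K := R_AbsRing) (V := R_NormedModule)).
  - apply (is_derive_id (K := R_AbsRing)).
Qed.

(** Compactness of the rectangle: a bound passes from the four quarters to the whole, so bisection
    applies after rescaling to the unit square. *)
Lemma locally_bounded_bounded (f : C -> C) (x0 y0 W H : R) : 0 < W -> 0 < H ->
  (forall x y, x0 <= x <= x0 + W -> y0 <= y <= y0 + H -> exists M del, 0 < del /\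
     forall h : C, Cmod h < del -> Cmod (f ((x, y) + h)%C) <= M) ->
  exists M, forall x y, x0 <= x <= x0 + W -> y0 <= y <= y0 + H -> Cmod (f (x, y)) <= M.
Proof.
  intros HW HH Hf.
  assert (B : exists M, forall s t, 0 <= s <= 0 + 1 -> 0 <= t <= 0 + 1 -> Cmod (f (x0 + W * s, y0 + H * t)) <= M).
  { apply (square_bisection (fun x y h => exists M, forall s t, x <= s <= x + h -> y <= t <= y + h ->
       Cmod (f (x0 + W * s, y0 + H * t)) <= M)).
    - intros x y h Hh _ _ _ _ [M1 K1] [M2 K2] [M3 K3] [M4 K4].
      exists (Rmax (Rmax M1 M2) (Rmax M3 M4)). intros s t Hs Ht.
      assert (A1 := Rmax_l (Rmax M1 M2) (Rmax M3 M4)). assert (A2 := Rmax_r (Rmax M1 M2) (Rmax M3 M4)).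
      assert (A3 := Rmax_l M1 M2). assert (A4 := Rmax_r M1 M2).
      assert (A5 := Rmax_l M3 M4). assert (A6 := Rmax_r M3 M4).
      destruct (Rle_dec s (x + h / 2)), (Rle_dec t (y + h / 2)).
      + specialize (K1 s t); lra.
      + specialize (K3 s t); lra.
      + specialize (K2 s t); lra.
      + specialize (K4 s t); lra.
    - intros u v Hu Hv.
      destruct (Hf (x0 + W * u) (y0 + H * v)) as [M [del [Pd K]]]; [nra|nra|].
      exists (del / (W + H)). split; [apply Rdiv_lt_0_compat; lra|].
      intros x y h [Hh Hh'] _ _ _ _ Hux Hvy.
      exists M. intros s t Hs Ht.
      apply Rlt_div_r in Hh'; [|lra].
      assert (Es := Rabs_le_between' s u h). assert (Et := Rabs_le_between' t v h).
      assert (Bs : Rabs (s - u) <= h) by (apply Es; lra).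
      assert (Bt : Rabs (t - v) <= h) by (apply Et; lra).
      specialize (K ((W * (s - u))%R, (H * (t - v))%R)).
      replace (((x0 + W * u)%R, (y0 + H * v)%R) + ((W * (s - u))%R, (H * (t - v))%R))%C
        with ((x0 + W * s, y0 + H * t) : C) in K.
      2:{ unfold Cplus; simpl. f_equal; ring. }
      apply K.
      eapply Rle_lt_trans; [apply Cmod_le_ReIm|]. simpl. rewrite !Rabs_mult.
      rewrite (Rabs_pos_eq W), (Rabs_pos_eq H) by lra. nra. }
  destruct B as [M K]. exists M. intros x y Hx Hy.
  specialize (K ((x - x0) / W) ((y - y0) / H)).
  replace (x0 + W * ((x - x0) / W)) with x in K by (field; lra).
  replace (y0 + H * ((y - y0) / H)) with y in K by (field; lra).
  apply K; rewrite Rplus_0_l; split.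
  - apply Rdiv_le_0_compat; lra.
  - apply Rle_div_l; lra.
  - apply Rdiv_le_0_compat; lra.
  - apply Rle_div_l; lra.
Qed.

Lemma cderiv_locally_bounded f z d : cderiv f z d -> exists M del, 0 < del /\
  forall h : C, Cmod h < del -> Cmod (f (z + h)%C) <= M.
Proof.
  intros Hd. destruct (cderiv_cont _ _ _ Hd 1 Rlt_0_1) as [del [Pd K]].
  exists (Cmod (f z) + 1), del. split; [exact Pd|]. intros h Hh. specialize (K h Hh).
  assert (T := Cmod_triangle_inv (f (z + h)%C) (f z)). lra.
Qed.

(** The counterclockwise contour integral; [Ci] comes from [dw = i dy] on the vertical sides. As a
    relation it carries the existence of the four side integrals. *)
Definition is_boundary_int (f : C -> C) (x0 x1 y0 y1 : R) (I : C) : Prop :=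
  exists A B D E : C, isCInt (fun x => f (x, y0)) x0 x1 A /\ isCInt (fun x => f (x, y1)) x0 x1 B /\
    isCInt (fun y => f (x0, y)) y0 y1 D /\ isCInt (fun y => f (x1, y)) y0 y1 E /\
    I = (A - B + Ci * (E - D))%C.

Lemma boundary_int_plus f g x0 x1 y0 y1 I J : is_boundary_int f x0 x1 y0 y1 I ->
  is_boundary_int g x0 x1 y0 y1 J -> is_boundary_int (fun w => f w + g w)%C x0 x1 y0 y1 (I + J)%C.
Proof.
  intros [A [B [D [E [HA [HB [HD [HE ->]]]]]]]] [A' [B' [D' [E' [HA' [HB' [HD' [HE' ->]]]]]]]].
  exists (A + A')%C, (B + B')%C, (D + D')%C, (E + E')%C.
  refine (conj _ (conj _ (conj _ (conj _ _)))); try (apply isCInt_plus; assumption). ring.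
Qed.

Lemma boundary_int_bound f x0 x1 y0 y1 I M : x0 <= x1 -> y0 <= y1 -> is_boundary_int f x0 x1 y0 y1 I ->
  (forall x y, x0 <= x <= x1 -> y0 <= y <= y1 -> Cmod (f (x, y)) <= M) ->
  Cmod I <= 2 * M * ((x1 - x0) + (y1 - y0)).
Proof.
  intros Hx Hy [A [B [D [E [HA [HB [HD [HE ->]]]]]]]] HM.
  assert (QA := isCInt_bound _ _ _ _ M Hx HA). assert (QB := isCInt_bound _ _ _ _ M Hx HB).
  assert (QD := isCInt_bound _ _ _ _ M Hy HD). assert (QE := isCInt_bound _ _ _ _ M Hy HE).
  eapply Rle_trans; [apply Cmod_triangle|]. rewrite Cmod_mult, Cmod_Ci.
  assert (T1 := Cmod_triangle_minus A B). assert (T2 := Cmod_triangle_minus E D).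
  assert (Cmod A <= M * (x1 - x0)) by (apply QA; intros; apply HM; lra).
  assert (Cmod B <= M * (x1 - x0)) by (apply QB; intros; apply HM; lra).
  assert (Cmod D <= M * (y1 - y0)) by (apply QD; intros; apply HM; lra).
  assert (Cmod E <= M * (y1 - y0)) by (apply QE; intros; apply HM; lra).
  lra.
Qed.

(** The quadratic primitive [F] turns each side into a difference of values at two corners, and
    these cancel around the rectangle. *)
Lemma boundary_int_affine (a d p : C) x0 x1 y0 y1 : x0 <= x1 -> y0 <= y1 ->
  is_boundary_int (fun w => a + d * (w - p))%C x0 x1 y0 y1 0%C.
Proof.
  intros Hx Hy.
  pose (F := fun w : C => (a * w + (d / 2) * ((w - p) * (w - p)))%C).
  assert (HF : forall w, cderiv F w (a + d * (w - p))%C).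
  { intros w. unfold F. eapply cderiv_eq.
    - apply cderiv_plus; [apply cderiv_scal, cderiv_id|]. apply cderiv_scal.
      apply (cderiv_comp (fun u => u * u)%C (fun w => w - p)%C); [apply cderiv_sqr|].
      apply cderiv_minus; [apply cderiv_id|apply cderiv_const].
    - field. }
  assert (Hl : forall w, cderiv (fun w => a + d * (w - p))%C w d).
  { intros w. eapply cderiv_eq.
    - apply cderiv_plus; [apply cderiv_const|]. apply cderiv_scal.
      apply cderiv_minus; [apply cderiv_id|apply cderiv_const].
    - ring. }
  assert (Hhor : forall y, isCInt (fun x => a + d * ((x, y) - p))%C x0 x1 (F (x1, y) - F (x0, y))%C).
  { intros y. apply (isCInt_FTC (fun x => F (x, y))); [assumption| |].
    - intros t _. eapply vderiv_eq; [apply (vderiv_comp F); [apply HF|apply vderiv_hor]|ring].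
    - intros t _. eapply vcont_vderiv.
      apply (vderiv_comp (fun w => a + d * (w - p))%C (fun x => (x, y) : C)); [apply Hl|apply vderiv_hor]. }
  assert (Hver : forall x, isCInt (fun y => a + d * ((x, y) - p))%C y0 y1 (- Ci * (F (x, y1) - F (x, y0)))%C).
  { intros x.
    assert (K : isCInt (fun y => (a + d * ((x, y) - p)) * Ci)%C y0 y1 (F (x, y1) - F (x, y0))%C).
    { apply (isCInt_FTC (fun y => F (x, y))); [assumption| |].
      - intros t _. apply (vderiv_comp F); [apply HF|apply vderiv_ver].
      - intros t _. apply vcont_mult; [|apply vcont_const]. eapply vcont_vderiv.
        apply (vderiv_comp (fun w => a + d * (w - p))%C (fun y => (x, y) : C)); [apply Hl|apply vderiv_ver]. }
    apply (isCInt_scal (- Ci)%C) in K. eapply isCInt_ext; [assumption| |exact K].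
    intros t _. cbv beta. replace (- Ci * ((a + d * ((x, t) - p)) * Ci))%C
      with (- (Ci * Ci) * (a + d * ((x, t) - p)))%C by ring.
    rewrite Ci_sqr. ring. }
  exists (F (x1, y0) - F (x0, y0))%C, (F (x1, y1) - F (x0, y1))%C,
    (- Ci * (F (x0, y1) - F (x0, y0)))%C, (- Ci * (F (x1, y1) - F (x1, y0)))%C.
  refine (conj (Hhor _) (conj (Hhor _) (conj (Hver _) (conj (Hver _) _)))).
  replace (Ci * (- Ci * (F (x1, y1) - F (x1, y0)) - - Ci * (F (x0, y1) - F (x0, y0))))%C
    with (- (Ci * Ci) * ((F (x1, y1) - F (x1, y0)) - (F (x0, y1) - F (x0, y0))))%C by ring.
  rewrite Ci_sqr. ring.
Qed.

(** An error [eps * h^2], proportional to the area, is stable under subdivision into four. On small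
    squares it follows from differentiability at one point, since the affine part integrates to
    zero. No continuity of the derivative enters. *)
Theorem goursat f x0 y0 W H I : 0 < W -> 0 < H ->
  (forall x y, x0 <= x <= x0 + W -> y0 <= y <= y0 + H -> exists d, cderiv f (x, y) d) ->
  is_boundary_int f x0 (x0 + W) y0 (y0 + H) I -> I = 0%C.
Proof.
  intros HW HH Hf HI.
  assert (Hhor : forall a b y, x0 <= a -> a <= b -> b <= x0 + W -> y0 <= y <= y0 + H ->
     exists J, isCInt (fun x => f (x, y)) a b J).
  { intros a b y Ha Hab Hb Hy. apply isCInt_ex; [assumption|]. intros t Ht.
    destruct (Hf t y) as [d Hd]; [lra|assumption|]. eapply vcont_vderiv.
    apply (vderiv_comp f (fun x => (x, y) : C)); [apply Hd|apply vderiv_hor]. }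
  assert (Hver : forall a b x, y0 <= a -> a <= b -> b <= y0 + H -> x0 <= x <= x0 + W ->
     exists J, isCInt (fun y => f (x, y)) a b J).
  { intros a b x Ha Hab Hb Hx. apply isCInt_ex; [assumption|]. intros t Ht.
    destruct (Hf x t) as [d Hd]; [assumption|lra|]. eapply vcont_vderiv.
    apply (vderiv_comp f (fun y => (x, y) : C)); [apply Hd|apply vderiv_ver]. }
  assert (Key : forall eps, 0 < eps -> Cmod I <= eps).
  { intros eps He.
    enough (Q : forall J, is_boundary_int f (x0 + W * 0) (x0 + W * (0 + 1)) (y0 + H * 0) (y0 + H * (0 + 1)) J ->
      Cmod J <= eps * (1 * 1)).
    { rewrite !Rmult_0_r, !Rplus_0_l, !Rplus_0_r, !Rmult_1_r in Q. apply Q, HI. }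
    apply (square_bisection (fun x y h => forall J,
      is_boundary_int f (x0 + W * x) (x0 + W * (x + h)) (y0 + H * y) (y0 + H * (y + h)) J ->
      Cmod J <= eps * (h * h))).
    - intros x y h Hh X1 X2 Y1 Y2 Q1 Q2 Q3 Q4 J [A [B [D [E [HA [HB [HD [HE ->]]]]]]]].
      set (a0 := x0 + W * x) in *. set (a2 := x0 + W * (x + h)) in *.
      set (b0 := y0 + H * y) in *. set (b2 := y0 + H * (y + h)) in *.
      replace (x + h / 2 + h / 2) with (x + h) in * by field.
      replace (y + h / 2 + h / 2) with (y + h) in * by field.
      set (a1 := x0 + W * (x + h / 2)) in *. set (b1 := y0 + H * (y + h / 2)) in *.
      assert (x0 <= a0) by (unfold a0; nra). assert (a0 <= a1) by (unfold a0, a1; nra).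
      assert (a1 <= a2) by (unfold a2, a1; nra). assert (a2 <= x0 + W) by (unfold a2; nra).
      assert (y0 <= b0) by (unfold b0; nra). assert (b0 <= b1) by (unfold b0, b1; nra).
      assert (b1 <= b2) by (unfold b2, b1; nra). assert (b2 <= y0 + H) by (unfold b2; nra).
      fold a2 in Q2, Q4. fold b2 in Q3, Q4. fold a2 in Q2. fold b2 in Q3.
      destruct (Hhor a0 a1 b0) as [h00 K00]; try lra. destruct (Hhor a1 a2 b0) as [h10 K10]; try lra.
      destruct (Hhor a0 a1 b1) as [h01 K01]; try lra. destruct (Hhor a1 a2 b1) as [h11 K11]; try lra.
      destruct (Hhor a0 a1 b2) as [h02 K02]; try lra. destruct (Hhor a1 a2 b2) as [h12 K12]; try lra.
      destruct (Hver b0 b1 a0) as [v00 L00]; try lra. destruct (Hver b1 b2 a0) as [v10 L10]; try lra.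
      destruct (Hver b0 b1 a1) as [v01 L01]; try lra. destruct (Hver b1 b2 a1) as [v11 L11]; try lra.
      destruct (Hver b0 b1 a2) as [v02 L02]; try lra. destruct (Hver b1 b2 a2) as [v12 L12]; try lra.
      rewrite (isCInt_unique _ _ _ _ _ HA (isCInt_Chasles _ _ _ _ _ _ K00 K10)).
      rewrite (isCInt_unique _ _ _ _ _ HB (isCInt_Chasles _ _ _ _ _ _ K02 K12)).
      rewrite (isCInt_unique _ _ _ _ _ HD (isCInt_Chasles _ _ _ _ _ _ L00 L10)).
      rewrite (isCInt_unique _ _ _ _ _ HE (isCInt_Chasles _ _ _ _ _ _ L02 L12)).
      specialize (Q1 (h00 - h01 + Ci * (v01 - v00))%C).
      specialize (Q2 (h10 - h11 + Ci * (v02 - v01))%C).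
      specialize (Q3 (h01 - h02 + Ci * (v11 - v10))%C).
      specialize (Q4 (h11 - h12 + Ci * (v12 - v11))%C).
      assert (R1 : Cmod (h00 - h01 + Ci * (v01 - v00)) <= eps * (h / 2 * (h / 2))).
      { apply Q1. exists h00, h01, v00, v01. tauto. }
      assert (R2 : Cmod (h10 - h11 + Ci * (v02 - v01)) <= eps * (h / 2 * (h / 2))).
      { apply Q2. exists h10, h11, v01, v02. tauto. }
      assert (R3 : Cmod (h01 - h02 + Ci * (v11 - v10)) <= eps * (h / 2 * (h / 2))).
      { apply Q3. exists h01, h02, v10, v11. tauto. }
      assert (R4 : Cmod (h11 - h12 + Ci * (v12 - v11)) <= eps * (h / 2 * (h / 2))).
      { apply Q4. exists h11, h12, v11, v12. tauto. }
      replace (h00 + h10 - (h02 + h12) + Ci * (v02 + v12 - (v00 + v10)))%C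
        with (((h00 - h01 + Ci * (v01 - v00)) + (h10 - h11 + Ci * (v02 - v01)))
           + ((h01 - h02 + Ci * (v11 - v10)) + (h11 - h12 + Ci * (v12 - v11))))%C by ring.
      eapply Rle_trans; [apply Cmod_triangle|].
      assert (T1 := Cmod_triangle (h00 - h01 + Ci * (v01 - v00))%C (h10 - h11 + Ci * (v02 - v01))%C).
      assert (T2 := Cmod_triangle (h01 - h02 + Ci * (v11 - v10))%C (h11 - h12 + Ci * (v12 - v11))%C).
      lra.
    - intros u v Hu Hv. set (p := (x0 + W * u, y0 + H * v) : C).
      destruct (Hf (x0 + W * u) (y0 + H * v)) as [d Hd]; [nra|nra|]. fold p in Hd.
      set (S := W + H). assert (PS : 0 < S) by (unfold S; lra).
      (* On a small rectangle the remainder is at most [eps / (2 S^2) * (S h)] and the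
         half-perimeter is [S h]; doubling the product gives exactly [eps * h^2]. *)
      destruct (Hd (eps / (2 * (S * S)))) as [del [Pd K]].
      { apply Rdiv_lt_0_compat; [lra|]. assert (0 < S * S) by nra. lra. }
      exists (del / S). split; [apply Rdiv_lt_0_compat; lra|].
      intros x y h [Hh Hh'] X1 X2 Y1 Y2 Hux Hvy J HJ.
      apply Rlt_div_r in Hh'; [|lra].
      assert (HX : x0 + W * x <= x0 + W * (x + h)) by nra.
      assert (HY : y0 + H * y <= y0 + H * (y + h)) by nra.
      assert (HJ' := boundary_int_plus _ _ _ _ _ _ _ _ HJ
        (boundary_int_affine (- f p) (- d) p (x0 + W * x) (x0 + W * (x + h)) (y0 + H * y) (y0 + H * (y + h)) HX HY)).
      rewrite Cplus_0_r in HJ'.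
      assert (Bd := boundary_int_bound _ _ _ _ _ _ (eps / (2 * (S * S)) * (S * h)) HX HY HJ').
      replace (x0 + W * (x + h) - (x0 + W * x) + (y0 + H * (y + h) - (y0 + H * y))) with (S * h) in Bd by (unfold S; ring).
      replace (2 * (eps / (2 * (S * S)) * (S * h)) * (S * h)) with (eps * (h * h)) in Bd by (field; lra).
      apply Bd. intros s t Hs Ht.
      assert (Q : Cmod ((s, t) - p)%C <= S * h).
      { eapply Rle_trans; [apply Cmod_le_ReIm|]. rewrite Re_minus, Im_minus. unfold p; simpl.
        assert (Rabs (s - (x0 + W * u)) <= W * h) by (apply Rabs_le_between'; nra).
        assert (Rabs (t - (y0 + H * v)) <= H * h) by (apply Rabs_le_between'; nra).
        unfold S; lra. }
      specialize (K ((s, t) - p)%C ltac:(lra)).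
      assert (Est : (p + ((s, t) - p))%C = (s, t)) by (apply C_eq; simpl; ring).
      rewrite Est in K. clear Est.
      replace (f (s, t) + (- f p + - d * ((s, t) - p)))%C with (f (s, t) - f p - d * ((s, t) - p))%C
        by (apply C_eq; simpl; ring).
      eapply Rle_trans; [exact K|]. apply Rmult_le_compat_l; [|exact Q].
      apply Rlt_le, Rdiv_lt_0_compat; [lra|]. assert (0 < S * S) by nra. lra. }
  apply Cmod_eq_0. assert (P := Cmod_ge_0 I).
  destruct P as [P|P]; [|auto]. specialize (Key (Cmod I / 2) ltac:(lra)). lra.
Qed.

(** * The complex exponential *)

Definition cexp (w : C) : C := (exp (Re w) * cos (Im w), exp (Re w) * sin (Im w)).

Lemma cexp_plus a b : cexp (a + b)%C = (cexp a * cexp b)%C.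
Proof.
  unfold cexp. rewrite Re_plus, Im_plus, exp_plus, cos_plus, sin_plus.
  unfold Cmult; simpl. f_equal; ring.
Qed.

Lemma cexp_0 : cexp 0%C = RtoC 1.
Proof. unfold cexp; simpl. rewrite exp_0, cos_0, sin_0. unfold RtoC; f_equal; ring. Qed.

Lemma Cmod_cexp w : Cmod (cexp w) = exp (Re w).
Proof.
  assert (P := exp_pos (Re w)).
  apply Rsqr_inj; [apply Cmod_ge_0|lra|]. unfold Rsqr.
  replace (Cmod (cexp w) * Cmod (cexp w)) with (Cmod (cexp w) ^ 2) by ring.
  rewrite Cmod2_alt. unfold cexp; simpl.
  assert (S := sin2_cos2 (Im w)). unfold Rsqr in S.
  replace (_ + _) with (exp (Re w) * exp (Re w) * (sin (Im w) * sin (Im w) + cos (Im w) * cos (Im w))) by ring.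
  rewrite S. ring.
Qed.

Lemma cexp_nz w : cexp w <> RtoC 0.
Proof. apply Cmod_gt_0. rewrite Cmod_cexp. apply exp_pos. Qed.

Lemma cexp_opp w : cexp (- w)%C = (/ cexp w)%C.
Proof.
  assert (N := cexp_nz w).
  assert (E : (cexp (- w) * cexp w)%C = RtoC 1).
  { rewrite <- cexp_plus. replace (- w + w)%C with (RtoC 0) by ring. apply cexp_0. }
  replace (cexp (- w)) with (cexp (- w) * cexp w * / cexp w)%C by (field; exact N).
  rewrite E. ring.
Qed.

Lemma cexp_minus a b : cexp (a - b)%C = (cexp a / cexp b)%C.
Proof. unfold Cminus. rewrite cexp_plus, cexp_opp. reflexivity. Qed.

(** Only the real derivatives of [exp], [cos] and [sin] at 0 are used; the functional equation then
    carries differentiability to every point. *)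
Lemma cexp_sub_1_estimate eps : 0 < eps -> exists del, 0 < del /\ forall h : C, Cmod h < del ->
    Cmod (cexp h - 1 - h) <= eps * Cmod h.
Proof.
  intros He. set (e := Rmin 1 (eps / 8)).
  assert (Pe : 0 < e) by (apply Rmin_pos; lra).
  assert (e <= 1) by apply Rmin_l. assert (e <= eps / 8) by apply Rmin_r.
  destruct (eps_is_derive exp 0 1) with (eps := e) as [d1 [P1 K1]]; [|exact Pe|].
  { apply is_derive_Reals, derivable_pt_lim_exp_0. }
  destruct (eps_is_derive cos 0 0) with (eps := e) as [d2 [P2 K2]]; [|exact Pe|].
  { apply is_derive_Reals. assert (A := derivable_pt_lim_cos 0). rewrite sin_0, Ropp_0 in A. exact A. }
  destruct (eps_is_derive sin 0 1) with (eps := e) as [d3 [P3 K3]]; [|exact Pe|].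
  { apply is_derive_Reals. assert (A := derivable_pt_lim_sin 0). rewrite cos_0 in A. exact A. }
  exists (Rmin (Rmin d1 d2) (Rmin d3 e)). split; [apply Rmin_pos; apply Rmin_pos; assumption|].
  intros h Hh.
  assert (A1 := Rmin_l (Rmin d1 d2) (Rmin d3 e)). assert (A2 := Rmin_r (Rmin d1 d2) (Rmin d3 e)).
  assert (A3 := Rmin_l d1 d2). assert (A4 := Rmin_r d1 d2).
  assert (A5 := Rmin_l d3 e). assert (A6 := Rmin_r d3 e).
  assert (Hx := re_le_Cmod h). assert (Hy := im_le_Cmod h).
  specialize (K1 (Re h) ltac:(lra)). specialize (K2 (Im h) ltac:(lra)). specialize (K3 (Im h) ltac:(lra)).
  rewrite Rplus_0_l, exp_0 in K1. rewrite Rplus_0_l, cos_0 in K2. rewrite Rplus_0_l, sin_0 in K3.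
  rewrite Rmult_1_l in K1, K3. rewrite Rmult_0_l, Rminus_0_r in K2. rewrite Rminus_0_r in K3.
  eapply Rle_trans; [apply Cmod_le_ReIm|].
  rewrite !Re_minus, !Im_minus. unfold cexp.
  set (x := Re h) in *. set (y := Im h) in *. set (m := Cmod h) in *.
  change (Rabs (exp x * cos y - 1 - x) + Rabs (exp x * sin y - 0 - y) <= eps * m).
  assert (Pm : 0 <= m) by apply Cmod_ge_0.
  assert (Px := Rabs_pos x). assert (Py := Rabs_pos y).
  assert (C1 : Rabs (cos y) <= 1) by (apply Rabs_le; assert (B := COS_bound y); lra).
  assert (B1 : Rabs (1 + x) <= 2).
  { eapply Rle_trans; [apply Rabs_triang|]. rewrite Rabs_R1. lra. }
  assert (B2 : Rabs (exp x - 1) <= 2 * Rabs x).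
  { replace (exp x - 1) with ((exp x - 1 - x) + x) by ring.
    eapply Rle_trans; [apply Rabs_triang|].
    assert (e * Rabs x <= 1 * Rabs x) by (apply Rmult_le_compat_r; lra). lra. }
  assert (B3 : Rabs (exp x) <= 3).
  { replace (exp x) with ((exp x - 1) + 1) by ring.
    eapply Rle_trans; [apply Rabs_triang|]. rewrite Rabs_R1. lra. }
  assert (E1 : e * Rabs x <= e * m) by (apply Rmult_le_compat_l; lra).
  assert (E2 : e * Rabs y <= e * m) by (apply Rmult_le_compat_l; lra).
  replace (exp x * cos y - 1 - x) with ((exp x - 1 - x) * cos y + (1 + x) * (cos y - 1)) by ring.
  replace (exp x * sin y - 0 - y) with (exp x * (sin y - y) + (exp x - 1) * y) by ring.
  assert (Q1 : Rabs ((exp x - 1 - x) * cos y + (1 + x) * (cos y - 1)) <= e * m * 1 + 2 * (e * m)).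
  { eapply Rle_trans; [apply Rabs_triang|]. rewrite !Rabs_mult.
    apply Rplus_le_compat; apply Rmult_le_compat; try apply Rabs_pos; lra. }
  assert (Q2 : Rabs (exp x * (sin y - y) + (exp x - 1) * y) <= 3 * (e * m) + (2 * e) * m).
  { eapply Rle_trans; [apply Rabs_triang|]. rewrite !Rabs_mult.
    apply Rplus_le_compat; apply Rmult_le_compat; try apply Rabs_pos; lra. }
  assert (e * m <= eps / 8 * m) by (apply Rmult_le_compat_r; lra).
  lra.
Qed.

Lemma cderiv_cexp z : cderiv cexp z (cexp z).
Proof.
  intros eps He. assert (P := exp_pos (Re z)).
  destruct (cexp_sub_1_estimate (eps / exp (Re z))) as [del [Pd K]]; [apply Rdiv_lt_0_compat; lra|].
  exists del; split; [assumption|]. intros h Hh. specialize (K h Hh).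
  rewrite cexp_plus. replace (cexp z * cexp h - cexp z - cexp z * h)%C with (cexp z * (cexp h - 1 - h))%C by ring.
  rewrite Cmod_mult, Cmod_cexp.
  replace (eps * Cmod h) with (exp (Re z) * (eps / exp (Re z) * Cmod h)) by (field; lra).
  apply Rmult_le_compat_l; lra.
Qed.

Lemma cexp_period w : cexp (w + (0%R, (2 * PI)%R))%C = cexp w.
Proof.
  assert (E : 2 * PI = 2 * INR 1 * PI) by (simpl; ring).
  unfold cexp. rewrite Re_plus, Im_plus. simpl. rewrite Rplus_0_r, E, cos_period, sin_period. reflexivity.
Qed.

Lemma cexp_eq_1 w : cexp w = RtoC 1 -> exists k : Z, w = (0, 2 * IZR k * PI).
Proof.
  intros H.
  assert (M : exp (Re w) = 1) by (rewrite <- Cmod_cexp, H; apply Cmod_1).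
  assert (E0 : Re w = 0) by (apply exp_inv; rewrite exp_0; exact M).
  assert (Hc : cos (Im w) = 1).
  { assert (A := f_equal Re H). unfold cexp in A; simpl in A. rewrite M in A. lra. }
  assert (Hs : sin (Im w / 2) = 0).
  { replace (Im w) with (2 * (Im w / 2)) in Hc by field. rewrite cos_2a_sin in Hc. nra. }
  destruct (sin_eq_0_0 _ Hs) as [k Hk]. exists k. apply C_eq; simpl; lra.
Qed.

Lemma cexp_eq a b : cexp a = cexp b -> exists k : Z, a = (b + (0%R, (2 * IZR k * PI)%R))%C.
Proof.
  intros H. destruct (cexp_eq_1 (a - b)) as [k Hk].
  - rewrite cexp_minus, H. field. apply cexp_nz.
  - exists k. rewrite <- Hk. ring.
Qed.

Lemma cexp_surj z : z <> RtoC 0 -> exists w, cexp w = z /\ Re w = ln (Cmod z).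
Proof.
  intros Hz. assert (P := Cmod_nz z Hz). set (m := Cmod z) in *.
  set (a := Re z / m). set (b := Im z / m).
  assert (Sq : a * a + b * b = 1).
  { unfold a, b. replace (Re z / m * (Re z / m) + Im z / m * (Im z / m)) with ((Re z ^ 2 + Im z ^ 2) / (m ^ 2)) by (field; lra).
    rewrite <- Cmod2_alt. fold m. field; lra. }
  assert (Ba : -1 <= a <= 1) by nra.
  assert (Sa : sin (acos a) = Rabs b).
  { rewrite sin_acos by exact Ba. replace (1 - a²) with (b²) by (unfold Rsqr; lra). apply sqrt_Rsqr_abs. }
  assert (Hth : exists th, cos th = a /\ sin th = b).
  { destruct (Rle_dec 0 b) as [Hb|Hb].
    - exists (acos a). rewrite cos_acos, Sa by exact Ba. rewrite Rabs_pos_eq; lra.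
    - exists (- acos a). rewrite cos_neg, sin_neg, cos_acos, Sa by exact Ba. rewrite Rabs_left; lra. }
  destruct Hth as [th [Hc Hs]].
  exists (ln m, th). split; [|reflexivity].
  unfold cexp. simpl. rewrite exp_ln, Hc, Hs by exact P.
  apply C_eq; unfold a, b; simpl; field; lra.
Qed.

Lemma Re_cexp_lt w A : 0 < A -> Re w < ln A -> Cmod (cexp w) < A.
Proof.
  intros HA H. rewrite Cmod_cexp. rewrite <- (exp_ln A HA). apply exp_increasing, H.
Qed.

(* By periodicity the horizontal sides cancel in Goursat's theorem, so the mean does not depend on [u]. *)
Lemma periodic_mean (g : C -> C) (A : R) (c : C) :
  (forall w, Re w < A -> exists d, cderiv g w d) ->
  (forall w, g (w + (0%R, (2 * PI)%R))%C = g w) ->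
  (forall eps, 0 < eps -> exists B, forall w, Re w < B -> Cmod (g w - c) < eps) ->
  forall u, u < A -> isCInt (fun v => g (u, v)) 0 (2 * PI) (RtoC (2 * PI) * c)%C.
Proof.
  intros Hg Hper Hlim u Hu. assert (HPI := PI_RGT_0).
  assert (Hint : forall u, u < A -> exists I, isCInt (fun v => g (u, v)) 0 (2 * PI) I).
  { intros u' Hu'. apply isCInt_ex; [lra|]. intros t _.
    destruct (Hg (u', t)) as [d Hd]; [exact Hu'|]. eapply vcont_vderiv.
    apply (vderiv_comp g (fun y => (u', y) : C)); [apply Hd|apply vderiv_ver]. }
  destruct (Hint u Hu) as [I HI].
  eapply isCInt_eq; [exact HI|].
  enough (K : forall eps, 0 < eps -> Cmod (I - RtoC (2 * PI) * c) <= eps).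
  { assert (E : (I - RtoC (2 * PI) * c)%C = RtoC 0).
    { apply Cmod_eq_0. assert (P := Cmod_ge_0 (I - RtoC (2 * PI) * c)).
      destruct P as [P|P]; [|auto]. specialize (K (Cmod (I - RtoC (2 * PI) * c) / 2) ltac:(lra)). lra. }
    replace I with ((I - RtoC (2 * PI) * c) + RtoC (2 * PI) * c)%C by ring. rewrite E. ring. }
  intros eps He.
  destruct (Hlim (eps / (2 * PI))) as [B HB]; [apply Rdiv_lt_0_compat; lra|].
  set (u0 := Rmin u B - 1).
  assert (u0 < u) by (unfold u0; assert (Q := Rmin_l u B); lra).
  assert (u0 < B) by (unfold u0; assert (Q := Rmin_r u B); lra).
  destruct (Hint u0) as [J HJ]; [lra|].
  assert (Hh : forall y, exists J, isCInt (fun x => g (x, y)) u0 u J).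
  { intros y. apply isCInt_ex; [lra|]. intros t Ht.
    destruct (Hg (t, y)) as [d Hd]; [simpl; lra|]. eapply vcont_vderiv.
    apply (vderiv_comp g (fun x => (x, y) : C)); [apply Hd|apply vderiv_hor]. }
  destruct (Hh 0) as [S HS].
  assert (HS' : isCInt (fun x => g (x, 2 * PI)) u0 u S).
  { eapply isCInt_ext; [lra| |exact HS]. intros t _. cbv beta.
    rewrite <- (Hper (t, 0)). f_equal. apply C_eq; simpl; ring. }
  assert (Z : (S - S + Ci * (I - J))%C = RtoC 0).
  { apply (goursat g u0 0 (u - u0) (2 * PI)); [lra|lra| |].
    - intros x y Hx Hy. apply Hg. simpl. lra.
    - replace (u0 + (u - u0)) with u by ring. rewrite Rplus_0_l.
      exists S, S, J, I. tauto. }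
  assert (EJ : I = J).
  { replace I with (J + - Ci * (S - S + Ci * (I - J)))%C.
    - rewrite Z. ring.
    - replace (J + - Ci * (S - S + Ci * (I - J)))%C with (J - (Ci * Ci) * (I - J))%C by ring.
      rewrite Ci_sqr. ring. }
  subst J.
  assert (HK := isCInt_plus _ _ _ _ _ _ HJ (isCInt_const (- c) 0 (2 * PI))).
  rewrite Rminus_0_r in HK.
  replace (I + RtoC (2 * PI) * - c)%C with (I - RtoC (2 * PI) * c)%C in HK by ring.
  replace eps with (eps / (2 * PI) * (2 * PI - 0)) by (field; lra).
  eapply isCInt_bound; [|exact HK|]; [lra|]. intros t _.
  apply Rlt_le. apply (HB (u0, t)). simpl. lra.
Qed.

(** * Circle means and regularity *)

Lemma vcont_eps g t : vcont g t <->
  forall eps, 0 < eps -> exists del, 0 < del /\ forall h : R, Rabs h < del -> Cmod (g (t + h)%R - g t) < eps.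
Proof.
  split.
  - intros [H1 H2] eps He.
    assert (He2 : 0 < eps / 2) by lra.
    destruct (proj1 (filterlim_locally _ _) H1 (mkposreal _ He2)) as [d1 K1].
    destruct (proj1 (filterlim_locally _ _) H2 (mkposreal _ He2)) as [d2 K2].
    exists (Rmin d1 d2). split; [apply Rmin_pos; apply cond_pos|]. intros h Hh.
    assert (A := Rmin_l d1 d2). assert (B := Rmin_r d1 d2).
    assert (Q : forall d : posreal, Rabs h < d -> ball t d (t + h)).
    { intros d Hd. change (Rabs (t + h - t) < d). replace (t + h - t) with h by ring. exact Hd. }
    specialize (K1 (t + h) (Q d1 ltac:(lra))). specialize (K2 (t + h) (Q d2 ltac:(lra))).
    change (Rabs (Re (g (t + h)) - Re (g t)) < eps / 2) in K1.
    change (Rabs (Im (g (t + h)) - Im (g t)) < eps / 2) in K2.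
    eapply Rle_lt_trans; [apply Cmod_le_ReIm|]. rewrite Re_minus, Im_minus. lra.
  - intros H.
    assert (K : forall (p : C -> R) (eps : posreal), (forall z, Rabs (p z) <= Cmod z) ->
      (forall z w, p (z - w)%C = p z - p w) ->
      locally t (fun y : R => Rabs (p (g y) - p (g t)) < eps)).
    { intros p [eps He] Hp Hlin. destruct (H eps He) as [del [Pd K]]. exists (mkposreal del Pd).
      intros y Hy. change (Rabs (y - t) < del) in Hy. change R in y.
      specialize (K (y - t) Hy). replace (t + (y - t)) with y in K by ring.
      simpl. rewrite <- Hlin. eapply Rle_lt_trans; [apply Hp|exact K]. }
    split; apply filterlim_locally; intros eps.
    + apply (K Re eps re_le_Cmod Re_minus).
    + apply (K Im eps im_le_Cmod Im_minus).
Qed.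

Lemma vcont_comp (F : C -> C) g t :
  (forall eps, 0 < eps -> exists del, 0 < del /\ forall h : C, Cmod h < del -> Cmod (F (g t + h) - F (g t)) < eps)%C ->
  vcont g t -> vcont (fun s => F (g s)) t.
Proof.
  intros HF Hg. apply vcont_eps. intros eps He.
  destruct (HF eps He) as [d1 [P1 K1]].
  destruct (proj1 (vcont_eps g t) Hg d1 P1) as [d2 [P2 K2]].
  exists d2; split; [exact P2|]. intros h Hh. specialize (K1 _ (K2 h Hh)).
  replace (g t + (g (t + h)%R - g t))%C with (g (t + h)%R) in K1 by ring. exact K1.
Qed.

(** Written through [cexp], the circle is the image of a vertical segment, which is the form that
    [periodic_mean] evaluates. *)
Definition circ (r v : R) : C := cexp (ln r, v).

Lemma Cmod_circ r v : 0 < r -> Cmod (circ r v) = r.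
Proof. intros H. unfold circ. rewrite Cmod_cexp. simpl. apply exp_ln, H. Qed.

Lemma circ_nz r v : circ r v <> RtoC 0.
Proof. apply cexp_nz. Qed.

Lemma vderiv_circ r t : vderiv (circ r) t (circ r t * Ci)%C.
Proof. apply (vderiv_comp cexp (fun v => (ln r, v) : C)); [apply cderiv_cexp|apply vderiv_ver]. Qed.

Section CircleMeans.

Variables (f : C -> C) (z0 : C) (R : R).
Hypothesis HR : 0 < R.
Hypothesis Hf : forall w : C, Cmod (w - z0) < R -> exists d, cderiv f w d.

Lemma circle_param_derivable w : Re w < ln R -> exists d, cderiv (fun w => f (z0 + cexp w)%C) w d.
Proof using HR Hf.
  intros Hw. destruct (Hf (z0 + cexp w)%C) as [d Hd].
  { replace (z0 + cexp w - z0)%C with (cexp w) by ring. apply Re_cexp_lt; assumption. }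
  eexists. apply (cderiv_comp f (fun w => z0 + cexp w)%C); [exact Hd|].
  apply cderiv_plus; [apply cderiv_const|apply cderiv_cexp].
Qed.

Lemma circle_mean r : 0 < r < R ->
  isCInt (fun v => f (z0 + circ r v)%C) 0 (2 * PI) (RtoC (2 * PI) * f z0)%C.
Proof using HR Hf.
  intros Hr. apply (periodic_mean (fun w => f (z0 + cexp w)%C) (ln R)).
  - apply circle_param_derivable.
  - intros w. rewrite cexp_period. reflexivity.
  - intros eps He. destruct (Hf z0) as [d Hd].
    { replace (z0 - z0)%C with (RtoC 0) by ring. rewrite Cmod_0; exact HR. }
    destruct (cderiv_cont _ _ _ Hd eps He) as [del [Pd K]].
    exists (ln del). intros w Hw. apply K, Re_cexp_lt; assumption.
  - apply ln_increasing; lra.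
Qed.

(** The integrand tends to 0 at the centre, so its mean vanishes: [f] has no Fourier coefficient of
    index -1 on the circle. *)
Lemma circle_mean_conj r : 0 < r < R ->
  isCInt (fun v => f (z0 + circ r v) * circ r v)%C 0 (2 * PI) 0%C.
Proof using HR Hf.
  intros Hr. replace (RtoC 0) with (RtoC (2 * PI) * RtoC 0)%C by ring.
  apply (periodic_mean (fun w => f (z0 + cexp w) * cexp w)%C (ln R)).
  - intros w Hw. destruct (circle_param_derivable w Hw) as [d Hd]. eexists.
    apply cderiv_mult; [exact Hd|apply cderiv_cexp].
  - intros w. rewrite cexp_period. reflexivity.
  - intros eps He. destruct (Hf z0) as [d Hd].
    { replace (z0 - z0)%C with (RtoC 0) by ring. rewrite Cmod_0; exact HR. }
    destruct (cderiv_cont _ _ _ Hd 1 Rlt_0_1) as [del [Pd K]].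
    assert (Pf := Cmod_ge_0 (f z0)).
    assert (Pq : 0 < eps / (Cmod (f z0) + 1)) by (apply Rdiv_lt_0_compat; lra).
    exists (ln (Rmin del (eps / (Cmod (f z0) + 1)))). intros w Hw.
    apply Re_cexp_lt in Hw; [|apply Rmin_pos; assumption].
    assert (A := Rmin_l del (eps / (Cmod (f z0) + 1))). assert (B := Rmin_r del (eps / (Cmod (f z0) + 1))).
    specialize (K (cexp w) ltac:(lra)).
    replace (f (z0 + cexp w) * cexp w - 0)%C with (f (z0 + cexp w) * cexp w)%C by ring.
    rewrite Cmod_mult.
    assert (T := Cmod_triangle_inv (f (z0 + cexp w)%C) (f z0)).
    assert (Pe := Cmod_ge_0 (cexp w)).
    assert (Cmod (cexp w) * (Cmod (f z0) + 1) < eps) by (apply Rlt_div_r; lra).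
    nra.
  - apply ln_increasing; lra.
Qed.

(** The difference quotient tends to [d] at the centre, so [d] is its mean. This replaces Cauchy's
    integral formula for the derivative. *)
Lemma circle_mean_deriv r d : 0 < r < R -> cderiv f z0 d ->
  isCInt (fun v => (f (z0 + circ r v) - f z0) / circ r v)%C 0 (2 * PI) (RtoC (2 * PI) * d)%C.
Proof using HR Hf.
  intros Hr Hd.
  apply (periodic_mean (fun w => (f (z0 + cexp w) - f z0) / cexp w)%C (ln R)).
  - intros w Hw. destruct (circle_param_derivable w Hw) as [d' Hd']. eexists.
    apply cderiv_div; [apply cexp_nz| |apply cderiv_cexp].
    apply cderiv_minus; [exact Hd'|apply cderiv_const].
  - intros w. rewrite cexp_period. reflexivity.
  - intros eps He. destruct (Hd (eps / 2)) as [del [Pd K]]; [lra|].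
    exists (ln del). intros w Hw. apply Re_cexp_lt in Hw; [|assumption].
    specialize (K _ Hw). assert (N := cexp_nz w).
    replace ((f (z0 + cexp w) - f z0) / cexp w - d)%C with ((f (z0 + cexp w) - f z0 - d * cexp w) / cexp w)%C
      by (field; exact N).
    rewrite Cmod_div by exact N. assert (P := Cmod_nz _ N).
    apply Rlt_div_l; [exact P|]. nra.
  - apply ln_increasing; lra.
Qed.

End CircleMeans.

(** * Cauchy estimates and differentiability of the derivative *)

Lemma segment_lipschitz (f df : C -> C) (a b : C) M :
  (forall t, 0 <= t <= 1 -> cderiv f (a + RtoC t * (b - a))%C (df (a + RtoC t * (b - a))%C) /\
     Cmod (df (a + RtoC t * (b - a))%C) <= M) ->
  Cmod (f b - f a) <= M * Cmod (b - a).
Proof.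
  intros H.
  assert (K := vderiv_bound (fun t => f (a + RtoC t * (b - a))%C)
    (fun t => df (a + RtoC t * (b - a)) * (b - a))%C
    (fun t => M * Cmod (b - a) * t) (fun t => M * Cmod (b - a)) 0 1 ltac:(lra)).
  cbv beta in K.
  replace (a + RtoC 1 * (b - a))%C with b in K by ring.
  replace (a + RtoC 0 * (b - a))%C with a in K by ring.
  replace (M * Cmod (b - a) * 1 - M * Cmod (b - a) * 0) with (M * Cmod (b - a)) in K by ring.
  apply K.
  - intros t Ht. apply (vderiv_comp f); [apply H, Ht|apply vderiv_line].
  - intros t Ht. auto_derive; [trivial|ring].
  - intros t Ht. rewrite Cmod_mult. apply Rmult_le_compat_r; [apply Cmod_ge_0|apply H, Ht].
Qed.

Lemma Cmod_segment_lt (z0 a b : C) r t : 0 <= t <= 1 -> Cmod (a - z0) < r -> Cmod (b - z0) < r ->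
  Cmod (a + RtoC t * (b - a) - z0) < r.
Proof.
  intros Ht Ha Hb.
  replace (a + RtoC t * (b - a) - z0)%C with (RtoC (1 - t) * (a - z0) + RtoC t * (b - z0))%C
    by (rewrite RtoC_minus; ring).
  eapply Rle_lt_trans; [apply Cmod_triangle|]. rewrite !Cmod_mult, !Cmod_R.
  rewrite !Rabs_pos_eq by lra. destruct (Rle_dec t (1 / 2)); nra.
Qed.

(** The function [f w - df p * w] has derivative [df w - df p], which is at most [M * Cmod h] on the
    segment. *)
Lemma second_order (f df : C -> C) (z0 : C) (r M : R) (p h : C) :
  (forall w : C, Cmod (w - z0) < r -> cderiv f w (df w)) ->
  (forall w w' : C, Cmod (w - z0) < r -> Cmod (w' - z0) < r -> Cmod (df w' - df w) <= M * Cmod (w' - w)) ->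
  Cmod (p - z0) < r -> Cmod (p + h - z0) < r -> 0 <= M ->
  Cmod (f (p + h)%C - f p - df p * h) <= M * Cmod h * Cmod h.
Proof.
  intros Hf HL Hp Hh HM.
  assert (K := segment_lipschitz (fun w => f w - df p * w)%C (fun w => df w - df p)%C p (p + h)%C (M * Cmod h)).
  cbv beta in K.
  replace (f (p + h) - df p * (p + h) - (f p - df p * p))%C with (f (p + h) - f p - df p * h)%C in K by ring.
  replace (p + h - p)%C with h in K by ring.
  apply K. intros t Ht.
  assert (Q := Cmod_segment_lt z0 p (p + h)%C r t Ht Hp Hh).
  replace (p + h - p)%C with h in Q by ring. split.
  - eapply cderiv_eq; [apply cderiv_minus; [apply Hf, Q|apply cderiv_scal, cderiv_id]|ring].
  - eapply Rle_trans; [apply HL; assumption|]. apply Rmult_le_compat_l; [assumption|].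
    replace (p + RtoC t * h - p)%C with (RtoC t * h)%C by ring.
    rewrite Cmod_mult, Cmod_R, Rabs_pos_eq by lra. assert (P := Cmod_ge_0 h). nra.
Qed.

Lemma circle_int_bound (g : R -> C) r I M : 0 < r -> isCInt (fun v => g v / circ r v)%C 0 (2 * PI) (RtoC (2 * PI) * I)%C ->
  (forall v, Cmod (g v) <= M) -> Cmod I <= M / r.
Proof.
  intros Hr HI HM. assert (HPI := PI_RGT_0).
  assert (B := isCInt_bound _ 0 (2 * PI) _ (M / r) ltac:(lra) HI).
  rewrite Cmod_mult, Cmod_R, Rabs_pos_eq in B by lra.
  apply (Rmult_le_reg_l (2 * PI)); [lra|].
  rewrite (Rmult_comm _ (M / r)). replace (2 * PI) with (2 * PI - 0) at 2 by ring. apply B.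
  intros t _. rewrite Cmod_div by apply circ_nz. rewrite Cmod_circ by exact Hr.
  apply Rmult_le_compat_r; [apply Rlt_le, Rinv_0_lt_compat, Hr|apply HM].
Qed.

(* Cauchy estimates: [f] is bounded near [z0], hence [df] is bounded, hence [f] and then [df] are Lipschitz;
   this is enough to differentiate the circle formula for [df]. *)
Lemma holo_deriv_local (f df : C -> C) z0 R : 0 < R ->
  (forall w : C, Cmod (w - z0) < 24 * R -> cderiv f w (df w)) ->
  exists M2 d2, 0 <= M2 /\ cderiv df z0 d2 /\
   (forall w w' : C, Cmod (w - z0) < 2 * R -> Cmod (w' - z0) < 2 * R -> Cmod (df w' - df w) <= M2 * Cmod (w' - w)).
Proof.
  intros HR Hf.
  (* Points of the square of half-side [8 R] are within [16 R] of [z0]. Bounds hold for [f] on the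
     disk of radius [8 R], for [df] on [4 R], and the Lipschitz bound for [df] on [2 R]; the circles
     of radius [2 R] used in between never leave the preceding disk. *)
  destruct (locally_bounded_bounded f (Re z0 - 8 * R) (Im z0 - 8 * R) (16 * R) (16 * R)) as [M HM]; [lra|lra| |].
  { intros x y Hx Hy. apply cderiv_locally_bounded with (df (x, y)). apply Hf. eapply Rle_lt_trans; [apply Cmod_le_ReIm|].
    rewrite Re_minus, Im_minus. simpl.
    assert (Rabs (x - Re z0) <= 8 * R) by (apply Rabs_le_between'; lra).
    assert (Rabs (y - Im z0) <= 8 * R) by (apply Rabs_le_between'; lra). lra. }
  assert (HM' : forall w : C, Cmod (w - z0) < 8 * R -> Cmod (f w) <= M).
  { intros w Hw. assert (A := re_le_Cmod (w - z0)%C). assert (B := im_le_Cmod (w - z0)%C).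
    rewrite Re_minus in A. rewrite Im_minus in B.
    assert (A' : Rabs (Re w - Re z0) <= 8 * R) by lra. assert (B' : Rabs (Im w - Im z0) <= 8 * R) by lra.
    apply Rabs_le_between' in A'. apply Rabs_le_between' in B'.
    replace w with ((Re w, Im w) : C) by (apply C_eq; reflexivity). apply HM; lra. }
  assert (PM : 0 <= M).
  { eapply Rle_trans; [apply Cmod_ge_0|apply (HM' z0)]. replace (z0 - z0)%C with (RtoC 0) by ring.
    rewrite Cmod_0; lra. }
  assert (Tri : forall a b : C, forall s t, Cmod (a - z0) < s -> Cmod b <= t -> Cmod (a + b - z0) < s + t).
  { intros a b s t Ha Hb. replace (a + b - z0)%C with ((a - z0) + b)%C by ring.
    eapply Rle_lt_trans; [apply Cmod_triangle|]. lra. }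
  assert (Hcirc : forall z : C, Cmod (z - z0) < 4 * R -> forall w : C, Cmod (w - z) < 3 * R -> exists d, cderiv f w d).
  { intros z Hz w Hw. exists (df w). apply Hf.
    replace w with (z + (w - z))%C by ring. eapply Rlt_le_trans; [apply Tri; [exact Hz|apply Rlt_le, Hw]|lra]. }
  set (M1 := 2 * M / (2 * R)).
  assert (HM1 : forall w : C, Cmod (w - z0) < 4 * R -> Cmod (df w) <= M1).
  { intros z Hz.
    assert (I := circle_mean_deriv f z (3 * R) ltac:(lra) (Hcirc z Hz) (2 * R) (df z) ltac:(lra) (Hf z ltac:(lra))).
    apply (circle_int_bound _ (2 * R) _ (2 * M) ltac:(lra) I). intros v.
    eapply Rle_trans; [apply Cmod_triangle_minus|].
    assert (Cmod (f (z + circ (2 * R) v)%C) <= M).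
    { apply HM'. eapply Rlt_le_trans; [apply Tri; [exact Hz|]|].
      - rewrite Cmod_circ by lra. apply Rle_refl.
      - lra. }
    assert (Cmod (f z) <= M) by (apply HM'; lra). lra. }
  assert (PM1 : 0 <= M1) by (unfold M1; apply Rdiv_le_0_compat; lra).
  assert (L1 : forall a b : C, Cmod (a - z0) < 4 * R -> Cmod (b - z0) < 4 * R -> Cmod (f b - f a) <= M1 * Cmod (b - a)).
  { intros a b Ha Hb. apply (segment_lipschitz f df). intros t Ht.
    assert (Q := Cmod_segment_lt z0 a b _ t Ht Ha Hb). split; [apply Hf; lra|apply HM1, Q]. }
  set (M2 := 2 * M1 / (2 * R)).
  assert (PM2 : 0 <= M2) by (unfold M2; apply Rdiv_le_0_compat; lra).
  assert (L2 : forall a b : C, Cmod (a - z0) < 2 * R -> Cmod (b - z0) < 2 * R -> Cmod (df b - df a) <= M2 * Cmod (b - a)).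
  { intros a b Ha Hb.
    assert (Ia := circle_mean_deriv f a (3 * R) ltac:(lra) (Hcirc a ltac:(lra)) (2 * R) (df a) ltac:(lra) (Hf a ltac:(lra))).
    assert (Ib := circle_mean_deriv f b (3 * R) ltac:(lra) (Hcirc b ltac:(lra)) (2 * R) (df b) ltac:(lra) (Hf b ltac:(lra))).
    assert (I := isCInt_plus _ _ _ _ _ _ Ib (isCInt_scal (- (1))%C _ _ _ _ Ia)).
    replace (RtoC (2 * PI) * df b + - (1) * (RtoC (2 * PI) * df a))%C with (RtoC (2 * PI) * (df b - df a))%C in I by ring.
    replace (M2 * Cmod (b - a)) with (2 * M1 * Cmod (b - a) / (2 * R)) by (unfold M2; field; lra).
    apply (circle_int_bound (fun v => (f (b + circ (2 * R) v) - f (a + circ (2 * R) v)) - (f b - f a))%C); [lra| |].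
    - eapply isCInt_ext; [|intros t _|exact I].
      + assert (HPI := PI_RGT_0). lra.
      + cbv beta. field. apply circ_nz.
    - intros v. eapply Rle_trans; [apply Cmod_triangle_minus|].
      assert (A1 := L1 (a + circ (2 * R) v)%C (b + circ (2 * R) v)%C).
      replace (b + circ (2 * R) v - (a + circ (2 * R) v))%C with (b - a)%C in A1 by ring.
      assert (A2 := L1 a b ltac:(lra) ltac:(lra)).
      assert (Ec : Cmod (circ (2 * R) v) <= 2 * R) by (rewrite Cmod_circ by lra; lra).
      assert (B1 := Tri a _ _ _ Ha Ec). assert (B2 := Tri b _ _ _ Hb Ec).
      specialize (A1 ltac:(lra) ltac:(lra)). lra. }
  assert (Hz : Cmod (z0 - z0) < R).
  { replace (z0 - z0)%C with (RtoC 0) by ring. rewrite Cmod_0; lra. }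
  assert (Hcont : forall t, vcont (fun v => (df (z0 + circ R v) - df z0) / circ R v)%C t).
  { intros t. apply vcont_mult.
    - apply vcont_plus; [|apply vcont_const].
      apply (vcont_comp df (fun v => z0 + circ R v)%C).
      + assert (Ec : Cmod (circ R t) <= R) by (rewrite Cmod_circ by lra; lra).
        assert (B0 := Tri z0 _ _ _ Hz Ec).
        intros eps He. exists (Rmin (2 * R - Cmod (circ R t)) (eps / (M2 + 1))).
        split; [apply Rmin_pos; [lra|apply Rdiv_lt_0_compat; lra]|].
        intros h Hh. assert (A := Rmin_l (2 * R - Cmod (circ R t)) (eps / (M2 + 1))).
        assert (B := Rmin_r (2 * R - Cmod (circ R t)) (eps / (M2 + 1))).
        assert (B1 : Cmod (z0 + circ R t + h - z0) < 2 * R).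
        { replace (z0 + circ R t + h - z0)%C with (circ R t + h)%C by ring.
          eapply Rle_lt_trans; [apply Cmod_triangle|]. lra. }
        specialize (L2 (z0 + circ R t)%C (z0 + circ R t + h)%C ltac:(lra) B1).
        replace (z0 + circ R t + h - (z0 + circ R t))%C with h in L2 by ring.
        assert (Cmod h * (M2 + 1) < eps) by (apply Rlt_div_r; lra).
        assert (P := Cmod_ge_0 h). nra.
      + apply vcont_plus; [apply vcont_const|]. eapply vcont_vderiv, vderiv_circ.
    - eapply vcont_vderiv. apply (vderiv_comp (fun w => / w)%C (circ R)); [|apply vderiv_circ].
      apply cderiv_inv_id, circ_nz. }
  destruct (isCInt_ex _ 0 (2 * PI) ltac:(assert (HPI := PI_RGT_0); lra) (fun t _ => Hcont t)) as [J HJ].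
  exists M2, (J / RtoC (2 * PI))%C. split; [exact PM2|]. split; [|exact L2].
  assert (HPI := PI_RGT_0).
  assert (N2 : RtoC (2 * PI) <> RtoC 0) by (intros E; apply RtoC_inj in E; lra).
  intros eps He. exists (Rmin R (eps * R / (2 * M2 + 1))). split.
  { apply Rmin_pos; [lra|]. apply Rdiv_lt_0_compat; nra. }
  intros h Hh.
  assert (A := Rmin_l R (eps * R / (2 * M2 + 1))). assert (B := Rmin_r R (eps * R / (2 * M2 + 1))).
  assert (Hh2 : Cmod (z0 + h - z0) < 2 * R).
  { replace (z0 + h - z0)%C with h by ring. lra. }
  assert (Ia := circle_mean_deriv f z0 (3 * R) ltac:(lra) (Hcirc z0 ltac:(lra)) R (df z0) ltac:(lra) (Hf z0 ltac:(lra))).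
  assert (Ib := circle_mean_deriv f (z0 + h)%C (3 * R) ltac:(lra) (Hcirc (z0 + h)%C ltac:(lra)) R (df (z0 + h)%C) ltac:(lra) (Hf (z0 + h)%C ltac:(lra))).
  assert (I := isCInt_plus _ _ _ _ _ _ (isCInt_plus _ _ _ _ _ _ Ib (isCInt_scal (- (1))%C _ _ _ _ Ia)) (isCInt_scal (- h)%C _ _ _ _ HJ)).
  replace (RtoC (2 * PI) * df (z0 + h) + - (1) * (RtoC (2 * PI) * df z0) + - h * J)%C
    with (RtoC (2 * PI) * (df (z0 + h) - df z0 - J / RtoC (2 * PI) * h))%C in I by (field; exact N2).
  apply Rle_trans with (2 * M2 * Cmod h * Cmod h / R).
  (* The combined integrand is the Taylor remainder on the circle minus the one at the centre, each
     at most [M2 * Cmod h ^ 2]. *)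
  - apply (circle_int_bound (fun v => (f (z0 + circ R v + h) - f (z0 + circ R v) - df (z0 + circ R v) * h)
       - (f (z0 + h) - f z0 - df z0 * h))%C); [lra| |].
    + eapply isCInt_ext; [lra|intros t _|exact I].
      cbv beta. replace (z0 + h + circ R t)%C with (z0 + circ R t + h)%C by ring. field. apply circ_nz.
    + intros v. eapply Rle_trans; [apply Cmod_triangle_minus|].
      assert (Ec : Cmod (circ R v) <= R) by (rewrite Cmod_circ by lra; lra).
      assert (B0 := Tri z0 _ _ _ Hz Ec).
      assert (Q1 := second_order f df z0 (2 * R) M2 (z0 + circ R v)%C h).
      assert (Q2 := second_order f df z0 (2 * R) M2 z0 h).
      assert (B1 : Cmod (z0 + circ R v + h - z0) < 2 * R).
      { replace (z0 + circ R v + h - z0)%C with (circ R v + h)%C by ring.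
        eapply Rle_lt_trans; [apply Cmod_triangle|]. lra. }
      assert (Hf2 : forall w : C, Cmod (w - z0) < 2 * R -> cderiv f w (df w)) by (intros w Hw; apply Hf; lra).
      specialize (Q1 Hf2 L2 ltac:(lra) B1 PM2). specialize (Q2 Hf2 L2 ltac:(lra) Hh2 PM2). lra.
  - apply Rle_div_l; [lra|]. assert (Ph := Cmod_ge_0 h).
    assert (Cmod h * (2 * M2 + 1) < eps * R) by (apply Rlt_div_r; lra). nra.
Qed.

(** * Holomorphic functions on the disk *)

Lemma disk_bounded (f : C -> C) r : r < 1 -> (forall z, in_disk z -> exists d, cderiv f z d) ->
  exists M, 0 <= M /\ forall z : C, Cmod z <= r -> Cmod (f z) <= M.
Proof.
  intros Hr Hf.
  (* Extension by 0 replaces the closed disk by a square: near a point of modulus at least 1 the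
     extension vanishes, because [r < 1]. *)
  set (g := fun z : C => if Rle_dec (Cmod z) r then f z else RtoC 0).
  destruct (locally_bounded_bounded g (-1) (-1) 2 2) as [M HM]; [lra|lra| |].
  - intros x y _ _. destruct (Rlt_dec (Cmod (x, y)) 1) as [H|H].
    + destruct (Hf (x, y) H) as [d Hd].
      destruct (cderiv_locally_bounded _ _ _ Hd) as [M [del [Pd K]]].
      exists (Rmax M 0), del. split; [exact Pd|]. intros h Hh. unfold g.
      assert (A := Rmax_l M 0). assert (B := Rmax_r M 0).
      destruct (Rle_dec (Cmod ((x, y) + h)) r); [specialize (K h Hh); lra|rewrite Cmod_0; lra].
    + exists 0, (1 - r). split; [lra|]. intros h Hh. unfold g.
      destruct (Rle_dec (Cmod ((x, y) + h)) r) as [L|L]; [|rewrite Cmod_0; lra].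
      exfalso. assert (T := Cmod_triangle_inv (x, y) (- h)%C). rewrite Cmod_opp in T.
      replace ((x, y) - - h)%C with ((x, y) + h)%C in T by (apply C_eq; simpl; ring). lra.
  - exists (Rmax M 0). split; [apply Rmax_r|]. intros z Hz.
    assert (A := Rmax_l M 0).
    assert (Bx := re_le_Cmod z). assert (By := im_le_Cmod z).
    assert (Bx' : Rabs (Re z) <= 1) by lra. assert (By' : Rabs (Im z) <= 1) by lra.
    apply Rabs_le_between in Bx'. apply Rabs_le_between in By'.
    specialize (HM (Re z) (Im z) ltac:(lra) ltac:(lra)). unfold g in HM.
    replace ((Re z, Im z) : C) with z in HM by (apply C_eq; reflexivity).
    destruct (Rle_dec (Cmod z) r); [lra|contradiction].
Qed.

Definition holo_on_disk (f df : C -> C) : Prop := forall z, in_disk z -> cderiv f z (df z).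

Lemma holo_deriv_fun f : (forall z, in_disk z -> exists d, cderiv f z d) -> exists df, holo_on_disk f df.
Proof.
  intros H. apply (choice (fun z d => in_disk z -> cderiv f z d)). intros z.
  destruct (classic (in_disk z)) as [Hz|Hz].
  - destruct (H z Hz) as [d Hd]. exists d; auto.
  - exists (RtoC 0). intros; contradiction.
Qed.

Lemma holo_deriv f df : holo_on_disk f df -> exists d2f, holo_on_disk df d2f.
Proof.
  intros H. apply holo_deriv_fun. intros z Hz. unfold in_disk in Hz.
  destruct (holo_deriv_local f df z ((1 - Cmod z) / 24)) as [M [d2 [_ [Hd _]]]]; [lra| |exists d2; exact Hd].
  intros w Hw. apply H. unfold in_disk.
  assert (T := Cmod_triangle_inv w z). lra.
Qed.

Lemma in_disk_0 : in_disk 0%C.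
Proof. unfold in_disk. rewrite Cmod_0. lra. Qed.

Lemma in_disk_scal t z : 0 <= t <= 1 -> in_disk z -> in_disk (RtoC t * z)%C.
Proof.
  unfold in_disk. intros Ht Hz. rewrite Cmod_mult, Cmod_R, Rabs_pos_eq by lra.
  assert (P := Cmod_ge_0 z). nra.
Qed.

Lemma vderiv_ray z t : vderiv (fun s => RtoC s * z)%C t z.
Proof.
  eapply vderiv_eq; [|reflexivity].
  assert (H := vderiv_line 0 z t). intros eps He. destruct (H eps He) as [del [Pd K]].
  exists del; split; [exact Pd|]. intros h Hh. specialize (K h Hh).
  rewrite !Cplus_0_l in K. exact K.
Qed.

Lemma vcont_RtoC t : vcont RtoC t.
Proof.
  split; simpl.
  - apply continuous_id.
  - apply continuous_const.
Qed.

Lemma radial_vcont f df z t : holo_on_disk f df -> in_disk z -> 0 <= t <= 1 -> vcont (fun s => f (RtoC s * z)%C) t.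
Proof.
  intros H Hz Ht. eapply vcont_vderiv. apply (vderiv_comp f (fun s => RtoC s * z)%C).
  - apply H, in_disk_scal; assumption.
  - apply vderiv_ray.
Qed.

(** Differentiation under the integral sign: on a slightly larger disk the second derivative is
    bounded, so the remainder [M * Cmod h ^ 2] is uniform in [t]. *)
Lemma radial_mean k dk : holo_on_disk k dk -> exists K dK, holo_on_disk K dK /\
  (forall z, in_disk z -> isCInt (fun t => k (RtoC t * z)%C) 0 1 (K z)) /\
  (forall z, in_disk z -> isCInt (fun t => RtoC t * dk (RtoC t * z))%C 0 1 (dK z)).
Proof.
  intros H. destruct (holo_deriv _ _ H) as [d2k H2].
  assert (E1 : exists K : C -> C, forall z, in_disk z -> isCInt (fun t => k (RtoC t * z)%C) 0 1 (K z)).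
  { apply (choice (fun z I => in_disk z -> isCInt (fun t => k (RtoC t * z)%C) 0 1 I)). intros z.
    destruct (classic (in_disk z)) as [Hz|Hz]; [|exists (RtoC 0); intros; contradiction].
    destruct (isCInt_ex (fun t => k (RtoC t * z)%C) 0 1) as [I HI]; [lra| |exists I; auto].
    intros t Ht. eapply radial_vcont; eassumption. }
  assert (E2 : exists dK : C -> C, forall z, in_disk z -> isCInt (fun t => RtoC t * dk (RtoC t * z))%C 0 1 (dK z)).
  { apply (choice (fun z I => in_disk z -> isCInt (fun t => RtoC t * dk (RtoC t * z))%C 0 1 I)). intros z.
    destruct (classic (in_disk z)) as [Hz|Hz]; [|exists (RtoC 0); intros; contradiction].
    destruct (isCInt_ex (fun t => RtoC t * dk (RtoC t * z))%C 0 1) as [I HI]; [lra| |exists I; auto].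
    intros t Ht. apply vcont_mult; [apply vcont_RtoC|]. eapply radial_vcont; eassumption. }
  destruct E1 as [K HK]. destruct E2 as [dK HdK]. exists K, dK.
  split; [|split; assumption].
  intros z Hz. assert (Hz' := Hz). unfold in_disk in Hz'. set (r := (1 + Cmod z) / 2).
  assert (Pz := Cmod_ge_0 z). assert (Hr : r < 1) by (unfold r; lra).
  destruct (disk_bounded d2k r Hr) as [M [PM HM]].
  { destruct (holo_deriv _ _ H2) as [d3k H3]. intros w Hw. exists (d3k w). apply H3, Hw. }
  assert (Hk : forall w : C, Cmod (w - 0) < r -> cderiv k w (dk w)).
  { intros w Hw. apply H. unfold in_disk. replace (w - 0)%C with w in Hw by ring. lra. }
  assert (HL : forall w w' : C, Cmod (w - 0) < r -> Cmod (w' - 0) < r -> Cmod (dk w' - dk w) <= M * Cmod (w' - w)).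
  { intros w w' Hw Hw'. apply (segment_lipschitz dk d2k). intros t Ht.
    assert (Q := Cmod_segment_lt 0%C w w' r t Ht Hw Hw').
    replace (w + RtoC t * (w' - w) - 0)%C with (w + RtoC t * (w' - w))%C in Q by ring.
    split; [apply H2; unfold in_disk; lra|apply HM; lra]. }
  intros eps He. exists (Rmin ((1 - Cmod z) / 2) (eps / (M + 1))).
  split; [apply Rmin_pos; [lra|apply Rdiv_lt_0_compat; lra]|].
  intros h Hh. assert (A := Rmin_l ((1 - Cmod z) / 2) (eps / (M + 1))).
  assert (B := Rmin_r ((1 - Cmod z) / 2) (eps / (M + 1))).
  assert (Hzh : Cmod (z + h) < r) by (eapply Rle_lt_trans; [apply Cmod_triangle|]; unfold r; lra).
  assert (Hzr : Cmod z < r) by (unfold r; lra).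
  assert (Dzh : in_disk (z + h)%C) by (unfold in_disk; lra).
  assert (I := isCInt_plus _ _ _ _ _ _ (HK (z + h)%C Dzh)
    (isCInt_plus _ _ _ _ _ _ (isCInt_scal (- (1))%C _ _ _ _ (HK z Hz)) (isCInt_scal (- h)%C _ _ _ _ (HdK z Hz)))).
  replace (K (z + h) + (- (1) * K z + - h * dK z))%C with (K (z + h) - K z - dK z * h)%C in I by ring.
  apply Rle_trans with (M * Cmod h * Cmod h).
  - replace (M * Cmod h * Cmod h) with (M * Cmod h * Cmod h * (1 - 0)) by ring.
    eapply isCInt_bound; [|exact I|]; [lra|]. intros t Ht. cbv beta.
    assert (Q := second_order k dk 0%C r M (RtoC t * z)%C (RtoC t * h)%C Hk HL).
    replace (RtoC t * z + RtoC t * h)%C with (RtoC t * (z + h))%C in Q by ring.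
    replace (k (RtoC t * (z + h)) + (- (1) * k (RtoC t * z) + - h * (RtoC t * dk (RtoC t * z))))%C
      with (k (RtoC t * (z + h)) - k (RtoC t * z) - dk (RtoC t * z) * (RtoC t * h))%C by ring.
    assert (Bt : forall w, Cmod w < r -> Cmod (RtoC t * w - 0) < r).
    { intros w Hw. replace (RtoC t * w - 0)%C with (RtoC t * w)%C by ring.
      rewrite Cmod_mult, Cmod_R, Rabs_pos_eq by lra. assert (P := Cmod_ge_0 w). nra. }
    eapply Rle_trans; [apply Q; auto|].
    rewrite Cmod_mult, Cmod_R, Rabs_pos_eq by lra.
    assert (P := Cmod_ge_0 h).
    assert (0 <= t * Cmod h <= Cmod h) by nra.
    assert (t * Cmod h * (t * Cmod h) <= Cmod h * Cmod h) by (apply Rmult_le_compat; lra).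
    rewrite (Rmult_assoc M (Cmod h)), (Rmult_assoc M (t * Cmod h)). apply Rmult_le_compat_l; assumption.
  - assert (P := Cmod_ge_0 h). assert (Cmod h * (M + 1) < eps) by (apply Rlt_div_r; lra). nra.
Qed.

(** The primitive is [z K(z)] with [K] the radial mean; its derivative [K + z K'] is the integral
    over [[0, 1]] of the [t]-derivative of [t k(t z)], hence [k z]. *)
Lemma holo_primitive k dk : holo_on_disk k dk -> exists G : C -> C, G 0%C = 0%C /\ holo_on_disk G k.
Proof.
  intros H. destruct (radial_mean _ _ H) as [K [dK [HK [I1 I2]]]].
  exists (fun z => z * K z)%C. split; [ring|]. intros z Hz.
  eapply cderiv_eq; [apply cderiv_mult; [apply cderiv_id|apply HK, Hz]|].
  assert (F : isCInt (fun t => k (RtoC t * z) + z * (RtoC t * dk (RtoC t * z)))%C 0 1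
     (RtoC 1 * k (RtoC 1 * z) - RtoC 0 * k (RtoC 0 * z))%C).
  { destruct (holo_deriv _ _ H) as [d2k H2].
    apply (isCInt_FTC (fun t => RtoC t * k (RtoC t * z))%C); [lra| |].
    - intros t Ht.
      assert (L := vderiv_comp (fun w => w * k (w * z))%C RtoC t).
      eapply vderiv_eq; [apply L|].
      + apply cderiv_mult; [apply cderiv_id|].
        apply (cderiv_comp k (fun w => w * z)%C); [apply H, in_disk_scal; assumption|].
        apply cderiv_mult; [apply cderiv_id|apply cderiv_const].
      + assert (R0 := vderiv_ray (RtoC 1) t). intros eps He. destruct (R0 eps He) as [del [Pd Kd]].
        exists del; split; [exact Pd|]. intros h Hh. specialize (Kd h Hh). rewrite !Cmult_1_r in Kd. exact Kd.
      + cbv beta. ring.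
    - intros t Ht. apply vcont_plus; [eapply radial_vcont; eassumption|].
      apply vcont_mult; [apply vcont_const|]. apply vcont_mult; [apply vcont_RtoC|].
      eapply radial_vcont; eassumption. }
  assert (E := isCInt_unique _ _ _ _ _ F (isCInt_plus _ _ _ _ _ _ (I1 z Hz) (isCInt_scal z _ _ _ _ (I2 z Hz)))).
  rewrite Cmult_1_l. rewrite <- E, Cmult_1_l. rewrite Cmult_1_l. ring.
Qed.

(** Taking for [h] the radial mean of [df] makes the quotient [f z / z] holomorphic at 0 without any
    removal of singularities. *)
Lemma holo_divide (f df : C -> C) : holo_on_disk f df -> f 0%C = 0%C -> exists h dh : C -> C, holo_on_disk h dh /\
  h 0%C = df 0%C /\ forall z, in_disk z -> f z = (z * h z)%C.
Proof.
  intros H H0. destruct (holo_deriv _ _ H) as [d2f H2].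
  destruct (radial_mean _ _ H2) as [h [dh [Hh [I1 _]]]].
  exists h, dh. split; [exact Hh|]. split.
  - assert (A := I1 0%C in_disk_0).
    assert (B := isCInt_const (df 0%C) 0 1).
    rewrite (isCInt_unique _ _ _ _ (RtoC (1 - 0) * df 0%C)%C A).
    + rewrite Rminus_0_r. ring.
    + eapply isCInt_ext; [lra| |exact B]. intros t _. cbv beta. f_equal. ring.
  - intros z Hz. symmetry. eapply isCInt_unique; [apply (isCInt_scal z), (I1 z Hz)|].
    replace (f z) with (f (RtoC 1 * z) - f (RtoC 0 * z))%C.
    + eapply isCInt_ext; [lra| |apply (isCInt_FTC (fun t => f (RtoC t * z)%C) (fun t => df (RtoC t * z) * z)%C); [lra| |]].
      * intros t _. cbv beta. ring.
      * intros t Ht. apply (vderiv_comp f (fun s => RtoC s * z)%C); [apply H, in_disk_scal; assumption|apply vderiv_ray].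
      * intros t Ht. apply vcont_mult; [eapply radial_vcont; eassumption|apply vcont_const].
    + rewrite Cmult_1_l. replace (RtoC 0 * z)%C with (RtoC 0) by ring. rewrite H0. ring.
Qed.

(** * Schwarz-Pick on the half-plane *)

Lemma isCInt_inv_circ r : isCInt (fun v => / circ r v)%C 0 (2 * PI) 0%C.
Proof.
  assert (HPI := PI_RGT_0).
  assert (Hd : forall t, vderiv (fun v => / circ r v)%C t (- (/ circ r t) * Ci)%C).
  { intros t. eapply vderiv_eq; [apply (vderiv_comp (fun w => / w)%C (circ r));
      [apply cderiv_inv_id, circ_nz|apply vderiv_circ]|]. field. apply circ_nz. }
  assert (E : circ r (2 * PI) = circ r 0).
  { unfold circ. rewrite <- (cexp_period (ln r, 0)). f_equal. apply C_eq; simpl; ring. }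
  assert (K := isCInt_FTC (fun v => / circ r v)%C (fun v => - (/ circ r v) * Ci)%C 0 (2 * PI)).
  cbv beta in K. rewrite E in K.
  replace (/ circ r 0 - / circ r 0)%C with (RtoC 0) in K by ring.
  assert (K' : isCInt (fun v => - (/ circ r v) * Ci)%C 0 (2 * PI) 0%C).
  { apply K; [lra|intros t _; apply Hd|]. intros t _. apply vcont_mult; [|apply vcont_const].
    eapply vcont_vderiv. apply (vderiv_comp (fun w => - / w)%C (circ r)); [|apply vderiv_circ].
    apply (cderiv_ext (fun w => - (1) * / w)%C); [intros w; ring|].
    apply cderiv_scal, cderiv_inv_id, circ_nz. }
  apply (isCInt_scal Ci) in K'.
  replace (Ci * 0)%C with (RtoC 0) in K' by ring.
  eapply isCInt_ext; [lra| |exact K'].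
  intros t _. cbv beta. replace (Ci * (- / circ r t * Ci))%C with (- (Ci * Ci) * / circ r t)%C by ring.
  rewrite Ci_sqr. ring.
Qed.

(* Integrate [Im V] against the nonnegative kernel [1 - Re (b e^(-iv))], with [b] chosen to align the first Fourier coefficient. *)
Lemma schwarz_pick_center V d : (forall z, in_disk z -> exists d, cderiv V z d) ->
  (forall z, in_disk z -> 0 <= Im (V z)) -> cderiv V 0%C d -> Cmod d <= 2 * Im (V 0%C).
Proof.
  intros HV Hpos Hd. assert (HPI := PI_RGT_0).
  assert (HV' : forall w : C, Cmod (w - 0) < 1 -> exists d, cderiv V w d).
  { intros w Hw. apply HV. unfold in_disk. replace (w - 0)%C with w in Hw by ring. exact Hw. }
  assert (P0 := Hpos _ in_disk_0).
  destruct (Req_dec (Cmod d) 0) as [E0|N0]; [lra|].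
  assert (Pd : 0 < Cmod d) by (assert (Q := Cmod_ge_0 d); lra).
  assert (Nd : d <> RtoC 0) by (intros E; rewrite E, Cmod_0 in N0; lra).
  set (b := (Ci * Cconj d / RtoC (Cmod d))%C).
  assert (NC : RtoC (Cmod d) <> RtoC 0) by (intros E; apply RtoC_inj in E; lra).
  assert (Hb : Cmod b = 1).
  { unfold b. rewrite Cmod_div, Cmod_mult, Cmod_Ci, Cmod_conj, Cmod_R, Rabs_pos_eq by (assumption || lra).
    field. lra. }
  assert (Hbd : (b * d)%C = (Ci * RtoC (Cmod d))%C).
  { unfold b. replace (Ci * Cconj d / RtoC (Cmod d) * d)%C with (Ci * (d * Cconj d) / RtoC (Cmod d))%C
      by (field; exact NC).
    rewrite <- Cmod2_conj. replace (Cmod d ^ 2) with (Cmod d * Cmod d) by ring.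
    rewrite RtoC_mult. field. exact NC. }
  (* The limit [r -> 1]: if the claim failed, the midpoint [r0] between 1 and [2 Im V(0) / |d|]
     would contradict [K]. *)
  enough (K : forall r, 0 < r < 1 -> r * Cmod d <= 2 * Im (V 0%C)).
  { apply Rnot_lt_le. intros L.
    set (r0 := (1 + 2 * Im (V 0%C) / Cmod d) / 2).
    assert (Q : 0 <= 2 * Im (V 0%C) / Cmod d) by (apply Rdiv_le_0_compat; lra).
    assert (Q' : 2 * Im (V 0%C) / Cmod d < 1) by (apply Rlt_div_l; lra).
    specialize (K r0 ltac:(unfold r0; lra)).
    assert (E : 2 * Im (V 0%C) / Cmod d * Cmod d = 2 * Im (V 0%C)) by (field; lra).
    unfold r0 in K. nra. }
  intros r Hr.
  assert (I1 := circle_mean V 0%C 1 Rlt_0_1 HV' r Hr).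
  assert (I2 := circle_mean_conj V 0%C 1 Rlt_0_1 HV' r Hr).
  assert (I3 := circle_mean_deriv V 0%C 1 Rlt_0_1 HV' r d Hr Hd).
  (* Adding [V 0 / u], whose mean is zero, turns the difference quotient of [I3] into [V u / u]. The
     weights in [I5] and [I6] then assemble the kernel, as [r / u] and [u / r] are conjugate on the
     circle. *)
  assert (I4 := isCInt_scal (V 0%C) _ _ _ _ (isCInt_inv_circ r)).
  assert (I5 := isCInt_scal (- (b * RtoC r) / 2)%C _ _ _ _ (isCInt_plus _ _ _ _ _ _ I3 I4)).
  assert (I6 := isCInt_scal (- (Cconj b / RtoC r) / 2)%C _ _ _ _ I2).
  assert (I7 := isCInt_plus _ _ _ _ _ _ I1 (isCInt_plus _ _ _ _ _ _ I5 I6)).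
  assert (Nr : RtoC r <> RtoC 0) by (intros E; apply RtoC_inj in E; lra).
  replace (RtoC (2 * PI) * V 0 +
           (- (b * RtoC r) / 2 * (RtoC (2 * PI) * d + V 0 * 0) + - (Cconj b / RtoC r) / 2 * 0))%C
    with (RtoC (2 * PI) * V 0 - RtoC (PI * r) * (b * d))%C in I7
    by (rewrite !RtoC_mult; field; exact Nr).
  rewrite Hbd in I7.
  destruct I7 as [_ I7].
  assert (Z := is_RInt_const (V := R_NormedModule) 0 (2 * PI) 0).
  change (scal (2 * PI - 0) 0) with ((2 * PI - 0) * 0) in Z. rewrite Rmult_0_r in Z.
  assert (L := fun H => is_RInt_le _ _ 0 (2 * PI) _ _ ltac:(lra) Z I7 H).
  assert (L' : 0 <= Im (RtoC (2 * PI) * V 0 - RtoC (PI * r) * (Ci * RtoC (Cmod d)))%C).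
  { apply L. intros v _. clear L Z I1 I2 I3 I4 I5 I6 I7. cbv beta.
    set (u := circ r v). assert (Nu : u <> RtoC 0) by apply circ_nz.
    assert (Mu : Cmod u = r) by (apply Cmod_circ; lra).
    assert (Iu : (/ u = Cconj u / RtoC (r * r))%C).
    { assert (Euu : (u * Cconj u)%C = RtoC (r * r)).
      { rewrite <- Cmod2_conj, Mu. simpl. rewrite !RtoC_mult. ring. }
      rewrite <- Euu. field. split; [|exact Nu].
      intros E. apply (f_equal Cmod) in E. rewrite Cmod_conj, Mu, Cmod_0 in E. lra. }
    set (x := Re (b * Cconj u)%C / r).
    assert (Hx : x <= 1).
    { unfold x. apply Rle_div_l; [lra|]. eapply Rle_trans; [apply Rle_abs|].
      eapply Rle_trans; [apply re_le_Cmod|]. rewrite Cmod_mult, Cmod_conj, Hb, Mu. lra. }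
    rewrite !Cplus_0_l.
    match goal with |- 0 <= Im ?e => replace e with (RtoC (1 - x) * V u)%C end.
    - rewrite Im_mult. simpl. rewrite Rmult_0_l, Rplus_0_r. apply Rmult_le_pos; [lra|].
      apply Hpos. unfold in_disk. lra.
    - unfold Cdiv at 2. rewrite Iu.
      assert (Hxx : RtoC x = ((b * Cconj u + Cconj b * u) / (2 * RtoC r))%C).
      { unfold x. rewrite RtoC_div by lra.
        rewrite re_alt, Cmult_conj, Cconj_conj. field. exact Nr. }
      rewrite RtoC_minus, Hxx, RtoC_mult. field. exact Nr. }
  rewrite Im_minus, !Im_mult in L'. simpl in L'.
  apply (Rmult_le_reg_l PI); [lra|]. nra.
Qed.

(** The Cayley map [phi] carries the disk to the left half-plane and 0 to [w0]; since
    [phi'(0) = 2 Re w0], the factor 2 of the disk estimate cancels. *)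
Lemma schwarz_pick_half_plane (U : C -> C) (w0 d : C) :
  (forall w, Re w < 0 -> exists d, cderiv U w d) ->
  (forall w, Re w < 0 -> 0 <= Im (U w)) -> Re w0 < 0 -> cderiv U w0 d ->
  Cmod d * - Re w0 <= Im (U w0).
Proof.
  intros HU Hpos Hw Hd.
  set (phi := fun z : C => (RtoC (Re w0) * ((1 + z) / (1 - z)) + Ci * RtoC (Im w0))%C).
  assert (N1 : forall z, in_disk z -> (1 - z)%C <> RtoC 0).
  { intros z Hz E. assert (z = RtoC 1) by (replace z with (1 - (1 - z))%C by ring; rewrite E; ring).
    subst z. unfold in_disk in Hz. rewrite Cmod_1 in Hz. lra. }
  assert (Hphi : forall z, in_disk z -> cderiv phi z (RtoC (Re w0) * (2 / ((1 - z) * (1 - z))))%C).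
  { intros z Hz. unfold phi. eapply cderiv_eq.
    - apply cderiv_plus; [|apply cderiv_const]. apply cderiv_scal.
      apply cderiv_div; [apply N1, Hz| |]; [apply cderiv_plus|apply cderiv_minus];
        [apply cderiv_const|apply cderiv_id|apply cderiv_const|apply cderiv_id].
    - cbv beta. field. apply N1, Hz. }
  assert (Hneg : forall z, in_disk z -> Re (phi z) < 0).
  { intros z Hz. unfold phi. rewrite Re_plus, !Re_mult. simpl (Re (RtoC _)). simpl (Im (RtoC _)). simpl (Re Ci). simpl (Im Ci).
    assert (P := Cmod_nz _ (N1 z Hz)).
    assert (E : Re ((1 + z) / (1 - z))%C = (1 - Cmod z ^ 2) / (Cmod (1 - z) ^ 2)).
    { rewrite !Cmod2_alt. assert (Cmod (1 - z) ^ 2 <> 0) by (apply pow_nonzero; lra).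
      rewrite Cmod2_alt in H. destruct z as [x y]. unfold Re, Im in *. simpl in *. field.
      intros E; apply H; etransitivity; [|exact E]; ring. }
    rewrite E. assert (0 < (1 - Cmod z ^ 2) / Cmod (1 - z) ^ 2).
    { unfold in_disk in Hz. assert (Q := Cmod_ge_0 z). apply Rdiv_lt_0_compat; nra. }
    nra. }
  assert (E0 : phi 0%C = w0).
  { unfold phi. apply C_eq; simpl; field; lra. }
  assert (K := schwarz_pick_center (fun z => U (phi z)) (d * (RtoC (Re w0) * (2 / ((1 - 0) * (1 - 0)))))%C).
  cbv beta in K. rewrite E0 in K.
  assert (B : Cmod (d * (RtoC (Re w0) * (2 / ((1 - 0) * (1 - 0)))))%C <= 2 * Im (U w0)).
  { apply K.
    - intros z Hz. destruct (HU (phi z) (Hneg z Hz)) as [d' Hd']. eexists.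
      apply (cderiv_comp U phi); [exact Hd'|apply Hphi, Hz].
    - intros z Hz. apply Hpos, Hneg, Hz.
    - apply (cderiv_comp U phi); [rewrite E0; exact Hd|apply Hphi, in_disk_0]. }
  replace (2 / ((1 - 0) * (1 - 0)))%C with (RtoC 2) in B.
  - rewrite !Cmod_mult, !Cmod_R, Rabs_left, Rabs_pos_eq in B by lra. lra.
  - replace ((1 - 0) * (1 - 0))%C with (RtoC 1) by ring. field.
Qed.

(** * Injectivity on the half-plane *)

Lemma Cmod_cexp_sub_1 z : Cmod (cexp z - 1) <= exp (Cmod z) - 1.
Proof.
  assert (K := vderiv_bound (fun s => cexp (RtoC s * z)%C) (fun s => cexp (RtoC s * z) * z)%C
    (fun s => exp (s * Cmod z)) (fun s => Cmod z * exp (s * Cmod z)) 0 1 ltac:(lra)).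
  cbv beta in K. rewrite Cmult_1_l, Cmult_0_l, cexp_0, Rmult_1_l, Rmult_0_l, exp_0 in K.
  apply K.
  - intros t _. apply (vderiv_comp cexp (fun s => RtoC s * z)%C); [apply cderiv_cexp|apply vderiv_ray].
  - intros t _. auto_derive; [trivial|ring].
  - intros t Ht. rewrite Cmod_mult, Cmod_cexp, Rmult_comm. apply Rmult_le_compat_l; [apply Cmod_ge_0|].
    assert (Re (RtoC t * z) <= t * Cmod z).
    { rewrite Re_mult. simpl. assert (A := re_le_Cmod z). assert (B := Rle_abs (Re z)). unfold Re in *. nra. }
    destruct H as [H|H]; [left; apply exp_increasing, H|right; rewrite <- H; reflexivity].
Qed.

Lemma exp_le a b : a <= b -> exp a <= exp b.
Proof. intros [H|H]; [left; apply exp_increasing, H|right; rewrite H; reflexivity]. Qed.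

Section HalfPlane.

Variables (F q dq : C -> C) (kappa : R).
Hypothesis Hkappa : 0 < kappa <= 29 / 100.
Hypothesis HF : forall w, Re w < 0 -> cderiv F w (cexp (q w)).
Hypothesis Hq : forall w, Re w < 0 -> cderiv q w (dq w).
Hypothesis Hdq : forall w, Re w < 0 -> Cmod (dq w) * - Re w <= kappa.

(* On the segment from [m] to [b] the point at parameter [t] is at depth at least [s (1 + e - t)],
   so [F'] is distorted from [F' m] by at most the factor [((1 + e) / (1 + e - t))^k], which is integrable up to [t = 1]. *)
Lemma segment_distortion (m b : C) (s R : R) : 0 < s -> Cmod (b - m) <= R -> kappa * R < s ->
  Re m + s < 0 -> Re b <= Re m + s ->
  Cmod (F b - F m - (b - m) * cexp (q m)) <= exp (Re (q m)) * (kappa * R ^ 2 / (s - kappa * R)).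
Proof using Hkappa HF Hq Hdq.
  intros Hs HR HkR Hm Hb.
  assert (PR : 0 <= R) by (assert (P := Cmod_ge_0 (b - m)); lra).
  set (e := - (Re m + s) / s). assert (Pe : 0 < e) by (apply Rdiv_lt_0_compat; lra).
  assert (Ees : e * s = - (Re m + s)) by (unfold e; field; lra).
  set (k := kappa * R / s).
  assert (Pk : 0 <= k) by (apply Rdiv_le_0_compat; [apply Rmult_le_pos; lra|exact Hs]).
  assert (Hk : k < 1) by (apply Rlt_div_l; lra).
  set (g := fun t => (m + RtoC t * (b - m))%C).
  assert (Hg : forall t, vderiv g t (b - m)%C) by (intros t; apply vderiv_line).
  assert (Hdepth : forall t, 0 <= t <= 1 -> s * (1 + e - t) <= - Re (g t)).
  { intros t Ht. unfold g. rewrite Re_plus, Re_mult, Re_minus. simpl. unfold Re in *. nra. }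
  assert (Hin : forall t, 0 <= t <= 1 -> Re (g t) < 0).
  { intros t Ht. assert (A := Hdepth t Ht). assert (0 < s * (1 + e - t)) by (apply Rmult_lt_0_compat; lra). lra. }
  assert (E0 : g 0 = m) by (unfold g; ring).
  assert (E1 : g 1 = b) by (unfold g; ring).
  set (L := ln (1 + e)).
  assert (Kq : forall t, 0 <= t <= 1 -> Cmod (q (g t) - q m) <= k * (L - ln (1 + e - t))).
  { intros t Ht.
    assert (K := vderiv_bound (fun t => q (g t)) (fun t => dq (g t) * (b - m))%C
      (fun t => - k * ln (1 + e - t)) (fun t => k / (1 + e - t)) 0 t (proj1 Ht)).
    cbv beta in K. rewrite E0 in K.
    replace (- k * ln (1 + e - t) - - k * ln (1 + e - 0)) with (k * (L - ln (1 + e - t))) in K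
      by (unfold L; rewrite Rminus_0_r; ring).
    apply K.
    - intros u Hu. apply (vderiv_comp q g); [apply Hq, Hin; lra|apply Hg].
    - intros u Hu. auto_derive; [lra|]. field; lra.
    - intros u Hu. rewrite Cmod_mult.
      assert (A := Hdepth u ltac:(lra)). assert (B := Hdq (g u) (Hin u ltac:(lra))).
      assert (0 < s * (1 + e - u)) by (apply Rmult_lt_0_compat; lra).
      assert (Pd := Cmod_ge_0 (dq (g u))).
      replace (k / (1 + e - u)) with (kappa / (s * (1 + e - u)) * R) by (unfold k; field; lra).
      apply Rmult_le_compat; [exact Pd|apply Cmod_ge_0| |exact HR].
      apply Rle_div_r; [assumption|]. nra. }
  set (M := exp (Re (q m))). assert (PM : 0 < M) by apply exp_pos.
  assert (K := vderiv_bound (fun t => F (g t) - RtoC t * ((b - m) * cexp (q m)))%C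
     (fun t => cexp (q (g t)) * (b - m) - (b - m) * cexp (q m))%C
     (fun t => R * M * (- (exp (k * L) / (1 - k)) * exp ((1 - k) * ln (1 + e - t)) - t))
     (fun t => R * M * (exp (k * (L - ln (1 + e - t))) - 1)) 0 1 ltac:(lra)).
  cbv beta in K. rewrite E0, E1 in K.
  replace (F b - RtoC 1 * ((b - m) * cexp (q m)) - (F m - RtoC 0 * ((b - m) * cexp (q m))))%C
    with (F b - F m - (b - m) * cexp (q m))%C in K by ring.
  eapply Rle_trans; [apply K|].
  - intros t Ht.
    assert (A := vderiv_comp F g t _ _ (HF _ (Hin t Ht)) (Hg t)).
    assert (B := vderiv_ray ((b - m) * cexp (q m)) t).
    apply vderiv_parts.
    + rewrite Re_minus. apply (is_derive_minus (fun s => Re (F (g s))) (fun s => Re (RtoC s * ((b - m) * cexp (q m)))%C)).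
      * apply (vderiv_re (fun s => F (g s))), A.
      * apply (vderiv_re (fun s => RtoC s * ((b - m) * cexp (q m)))%C), B.
    + rewrite Im_minus. apply (is_derive_minus (fun s => Im (F (g s))) (fun s => Im (RtoC s * ((b - m) * cexp (q m)))%C)).
      * apply (vderiv_im (fun s => F (g s))), A.
      * apply (vderiv_im (fun s => RtoC s * ((b - m) * cexp (q m)))%C), B.
  - intros t Ht. auto_derive; [lra|].
    replace (exp (k * (L - ln (1 + e - t)))) with (exp (k * L) * exp ((1 - k) * ln (1 + e - t)) / (1 + e - t)).
    + replace (1 + e + - t) with (1 + e - t) by ring. field. split; lra.
    + rewrite <- exp_plus. rewrite <- (exp_ln (1 + e - t)) at 2 by lra.
      unfold Rdiv. rewrite <- exp_Ropp, <- exp_plus. f_equal. ring.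
  - intros t Ht.
    replace (cexp (q (g t)) * (b - m) - (b - m) * cexp (q m))%C
      with ((b - m) * (cexp (q m) * (cexp (q (g t) - q m) - 1)))%C
      by (rewrite cexp_minus; field; apply cexp_nz).
    rewrite !Cmod_mult, Cmod_cexp. fold M. rewrite Rmult_assoc.
    apply Rmult_le_compat; [apply Cmod_ge_0| |exact HR|].
    { apply Rmult_le_pos; [lra|apply Cmod_ge_0]. }
    apply Rmult_le_compat_l; [lra|]. eapply Rle_trans; [apply Cmod_cexp_sub_1|].
    assert (A := exp_le _ _ (Kq t Ht)). lra.
  (* [X = (1 + e)^k e^(1 - k)] is at least [e], so [(1 + e) - X <= 1] and [e] disappears;
     [R M (1 / (1 - k) - 1)] is the stated bound. *)
  - set (X := exp (k * L) * exp ((1 - k) * ln e)).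
    assert (HX : e <= X).
    { unfold X. rewrite <- exp_plus. rewrite <- (exp_ln e Pe) at 1. apply exp_le.
      assert (ln e <= L) by (apply Rlt_le, ln_increasing; lra). nra. }
    assert (HY : exp (k * L) * exp ((1 - k) * ln (1 + e)) = 1 + e).
    { rewrite <- exp_plus. fold L. replace (k * L + (1 - k) * L) with L by ring. apply exp_ln. lra. }
    replace (1 + e - 1) with e by ring. rewrite !Rminus_0_r.
    replace (R * M * (- (exp (k * L) / (1 - k)) * exp ((1 - k) * ln e) - 1) -
       R * M * (- (exp (k * L) / (1 - k)) * exp ((1 - k) * ln (1 + e))))
      with (R * M * ((exp (k * L) * exp ((1 - k) * ln (1 + e)) - X) / (1 - k) - 1))
      by (unfold X; field; lra).
    rewrite HY.
    replace (M * (kappa * R ^ 2 / (s - kappa * R))) with (R * M * (1 / (1 - k) - 1)).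
    2:{ unfold k. field. split; lra. }
    apply Rmult_le_compat_l; [apply Rmult_le_pos; lra|].
    apply Rplus_le_compat_r. apply Rmult_le_compat_r; [apply Rlt_le, Rinv_0_lt_compat; lra|lra].
Qed.

(** A nearly horizontal segment already gains depth comparable to its length, so its deeper end
    serves as base point; otherwise a base point is placed below both ends. The ratio [3 / 4]
    divides the two cases. *)
Lemma half_plane_injective_aux (a b : C) : Re a < 0 -> Re b <= Re a -> F a = F b -> a = b.
Proof using Hkappa HF Hq Hdq.
  intros Ha Hab E.
  set (x := Re a - Re b). set (y := Rabs (Im a - Im b)).
  assert (Px : 0 <= x) by (unfold x; lra). assert (Py : 0 <= y) by apply Rabs_pos.
  assert (Hy2 : (Im a - Im b) ^ 2 = y ^ 2) by (unfold y; rewrite pow2_abs; reflexivity).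
  assert (Hr2 : Cmod (a - b) ^ 2 = x ^ 2 + y ^ 2) by (rewrite Cmod2_alt, Re_minus, Im_minus, Hy2; reflexivity).
  assert (Pr := Cmod_ge_0 (a - b)).
  destruct (Rle_dec (3 / 4 * y) x) as [C1|C2].
  - destruct Px as [Px|Px].
    + exfalso. set (r := Cmod (a - b)) in *.
      (* The distortion estimate gives [x <= 2 kappa r <= 10 / 3 * kappa * x], which fails for
         [kappa < 3 / 10]. *)
      assert (Hr : r <= 5 / 3 * x) by nra.
      assert (Hr' : x <= r) by nra.
      assert (Hkr : kappa * r < x) by nra.
      assert (K := segment_distortion b a x r Px (Rle_refl _) Hkr ltac:(unfold x; lra) ltac:(unfold x; lra)).
      rewrite E in K. replace (F b - F b - (a - b) * cexp (q b))%C with (- ((a - b) * cexp (q b)))%C in K by ring.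
      rewrite Cmod_opp, Cmod_mult, Cmod_cexp in K. fold r in K.
      assert (PM := exp_pos (Re (q b))). rewrite Rmult_comm in K. apply Rmult_le_reg_l in K; [|exact PM].
      apply Rle_div_r in K; [|lra]. nra.
    + assert (Z : (a - b)%C = RtoC 0) by (apply Cmod_eq_0; nra).
      replace a with ((a - b) + b)%C by ring. rewrite Z. ring.
  - exfalso. assert (Hy : 0 < y) by lra.
    (* [m] lies at mid-height, deeper than [a] by [3 / 4 * y]. Both ends are within
       [sqrt (9 / 16 + 1 / 4) * y], about [0.9014 * y], which [R] rounds up. For [kappa = 29 / 100]
       the distortion bound is about [0.483 * y], just below the required [y / 2]. *)
    set (m := (Re a - 3 / 4 * y, (Im a + Im b) / 2) : C).
    set (R := 902 / 1000 * y).
    assert (Ra : Cmod (a - m) <= R).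
    { assert (Q : Cmod (a - m) ^ 2 = (3 / 4 * y) ^ 2 + (y / 2) ^ 2).
      { rewrite Cmod2_alt, Re_minus, Im_minus. unfold m; simpl (Re (_, _)); simpl (Im (_, _)).
        replace ((y / 2) ^ 2) with (y ^ 2 / 4) by field. rewrite <- Hy2. field. }
      assert (P := Cmod_ge_0 (a - m)). unfold R. nra. }
    assert (Rb : Cmod (b - m) <= R).
    { assert (Q : Cmod (b - m) ^ 2 = (3 / 4 * y - x) ^ 2 + (y / 2) ^ 2).
      { rewrite Cmod2_alt, Re_minus, Im_minus. unfold m; simpl (Re (_, _)); simpl (Im (_, _)).
        replace ((y / 2) ^ 2) with (y ^ 2 / 4) by field. rewrite <- Hy2. unfold x. field. }
      assert (P := Cmod_ge_0 (b - m)). unfold R. nra. }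
    assert (Em : Re m = Re a - 3 / 4 * y) by reflexivity.
    assert (HkR : kappa * R < 3 / 4 * y) by (unfold R; nra).
    assert (Ka := segment_distortion m a (3 / 4 * y) R ltac:(lra) Ra HkR ltac:(lra) ltac:(lra)).
    assert (Kb := segment_distortion m b (3 / 4 * y) R ltac:(lra) Rb HkR ltac:(lra) ltac:(unfold x in *; lra)).
    assert (T := Cmod_triangle_minus (F a - F m - (a - m) * cexp (q m))%C (F b - F m - (b - m) * cexp (q m))%C).
    rewrite E in T at 1.
    replace (F b - F m - (a - m) * cexp (q m) - (F b - F m - (b - m) * cexp (q m)))%C
      with (- ((a - b) * cexp (q m)))%C in T by ring.
    rewrite Cmod_opp, Cmod_mult, Cmod_cexp in T.
    assert (PM := exp_pos (Re (q m))).
    assert (B : exp (Re (q m)) * Cmod (a - b) <= exp (Re (q m)) * (2 * (kappa * R ^ 2 / (3 / 4 * y - kappa * R)))) by lra.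
    apply Rmult_le_reg_l in B; [|exact PM].
    assert (Hyr : y <= Cmod (a - b)) by nra.
    assert (B' : y / 2 <= kappa * R ^ 2 / (3 / 4 * y - kappa * R)) by lra.
    apply Rle_div_r in B'; [|lra]. unfold R in B'. nra.
Qed.

Lemma half_plane_injective (a b : C) : Re a < 0 -> Re b < 0 -> F a = F b -> a = b.
Proof using Hkappa HF Hq Hdq.
  intros Ha Hb E. destruct (Rle_dec (Re b) (Re a)).
  - apply half_plane_injective_aux; assumption.
  - symmetry. apply half_plane_injective_aux; [assumption|lra|auto].
Qed.

End HalfPlane.

(** * Lower bound *)

Lemma exp_le_inv a b : exp a <= exp b -> a <= b.
Proof. intros H. apply Rnot_lt_le. intros L. apply exp_increasing in L. lra. Qed.

Lemma cexp_2kpi (k : Z) : cexp (0%R, 2 * IZR k * PI) = RtoC 1.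
Proof.
  assert (S : sin (IZR k * PI) = 0) by (apply sin_eq_0_1; exists k; reflexivity).
  unfold cexp; simpl. replace (2 * IZR k * PI) with (2 * (IZR k * PI)) by ring.
  rewrite cos_2a_sin, sin_2a, S, exp_0. apply C_eq; simpl; ring.
Qed.

Lemma holo_const f : (forall z, in_disk z -> cderiv f z 0%C) -> forall z, in_disk z -> f z = f 0%C.
Proof.
  intros H z Hz.
  assert (K := segment_lipschitz f (fun _ => RtoC 0) 0%C z 0).
  rewrite Rmult_0_l in K.
  assert (E : (f z - f 0)%C = RtoC 0).
  { apply Cmod_eq_0. apply Rle_antisym; [|apply Cmod_ge_0]. apply K. intros t Ht. split.
    - apply H. replace (0 + RtoC t * (z - 0))%C with (RtoC t * z)%C by ring. apply in_disk_scal; assumption.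
    - rewrite Cmod_0. lra. }
  replace (f z) with ((f z - f 0) + f 0)%C by ring. rewrite E. ring.
Qed.

(** A primitive of [h' / h] is a logarithm up to a constant, because [h / cexp H] has zero
    derivative. *)
Lemma holo_log (h dh : C -> C) : holo_on_disk h dh -> (forall z, in_disk z -> h z <> RtoC 0) ->
  exists H : C -> C, H 0%C = 0%C /\ holo_on_disk H (fun z => dh z / h z)%C /\
    forall z, in_disk z -> h z = (h 0 * cexp (H z))%C.
Proof.
  intros Hh Hn. destruct (holo_deriv _ _ Hh) as [d2h H2].
  destruct (holo_primitive (fun z => dh z / h z)%C (fun z => (d2h z * h z - dh z * dh z) / (h z * h z))%C) as [H [H0 HH]].
  { intros z Hz. apply cderiv_div; [apply Hn, Hz|apply H2, Hz|apply Hh, Hz]. }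
  exists H. split; [exact H0|]. split; [exact HH|]. intros z Hz.
  assert (K := holo_const (fun z => h z / cexp (H z))%C). cbv beta in K.
  rewrite H0, cexp_0 in K.
  replace (h z) with (h z / cexp (H z) * cexp (H z))%C by (field; apply cexp_nz).
  rewrite K; [field| |exact Hz].
  intros w Hw. eapply cderiv_eq.
  - apply cderiv_div; [apply cexp_nz|apply Hh, Hw|].
    apply (cderiv_comp cexp H); [apply cderiv_cexp|apply HH, Hw].
  - cbv beta. field. split; [apply Hn, Hw|apply cexp_nz].
Qed.

(** * Extremal values of the modulus of z f'/f *)

Lemma Lf_is_lub f : Rbar_is_lub (quot_values f) (Lf f).
Proof. exact (proj2_sig (Rbar_ex_lub (quot_values f))). Qed.

Lemma lf_is_glb f : Rbar_is_glb (quot_values f) (lf f).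
Proof. exact (proj2_sig (Rbar_ex_glb (quot_values f))). Qed.

Lemma quot_values_at_0 f : classA f -> quot_values f (Finite 1).
Proof.
  intros [_ [_ H1]]. exists 0%C, 1%C. split; [apply in_disk_0|]. split; [exact H1|]. left. auto.
Qed.

Lemma lf_finite f : classA f -> exists l, lf f = Finite l /\ 0 <= l <= 1.
Proof.
  intros HA. destruct (lf_is_glb f) as [G1 G2].
  assert (A1 := G1 _ (quot_values_at_0 f HA)).
  assert (A0 : Rbar_le (Finite 0) (lf f)).
  { apply G2. intros x [z [d [Hz [Hd [[_ ->]|[[_ [_ ->]]|[_ [_ ->]]]]]]]]; [simpl; lra|exact I|apply Cmod_ge_0]. }
  destruct (lf f) as [l| |]; try contradiction. exists l. split; [reflexivity|split; assumption].
Qed.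

(** Allows one failing [delta] to bound the whole set from above. *)
Lemma good_delta_mono d d' : d' <= d -> good_delta d -> good_delta d'.
Proof.
  intros Hd Hg f HA HL. apply (Hg f HA). eapply Rbar_le_trans; [exact HL|].
  destruct (lf_finite f HA) as [l [-> Hl]]. simpl. apply Rmult_le_compat_r; [lra|apply exp_le, Hd].
Qed.

(** The value 1 at the origin forces [Lf f >= 1], so [lf f] cannot be 0. The right-hand side is
    finite, which excludes the value [p_infty]: [f] has no zero other than the origin. *)
Lemma quot_values_bounds f delta : classA f ->
  Rbar_le (Lf f) (Rbar_mult (Finite (exp delta)) (lf f)) ->
  exists l, 0 < l /\ l <= 1 <= exp delta * l /\
   forall z d : C, in_disk z -> z <> RtoC 0 -> cderiv f z d ->
     f z <> RtoC 0 /\ l <= Cmod (z * d / f z) <= exp delta * l.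
Proof.
  intros HA HL. destruct (Lf_is_lub f) as [U1 _]. destruct (lf_is_glb f) as [G1 _].
  destruct (lf_finite f HA) as [l [El [L0 L1]]]. rewrite El in HL, G1. simpl in HL.
  assert (A := Rbar_le_trans _ _ _ (U1 _ (quot_values_at_0 f HA)) HL). simpl in A.
  assert (Pl : 0 < l).
  { destruct L0 as [L0|L0]; [exact L0|]. rewrite <- L0, Rmult_0_r in A. lra. }
  exists l. split; [exact Pl|]. split; [split; assumption|].
  intros z d Hz Nz Hd. apply has_cderiv_cderiv in Hd.
  assert (Nf : f z <> RtoC 0).
  { intros E. assert (V : quot_values f p_infty) by (exists z, d; split; [|split]; auto 10).
    exact (Rbar_le_trans _ _ _ (U1 _ V) HL). }
  split; [exact Nf|].
  assert (V : quot_values f (Finite (Cmod (z * d / f z)))).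
  { exists z, d. split; [exact Hz|]. split; [exact Hd|]. right; right. auto. }
  split; [exact (G1 _ V)|exact (Rbar_le_trans _ _ _ (U1 _ V) HL)].
Qed.

Theorem good_delta_small kappa : 0 < kappa <= 29 / 100 -> good_delta (kappa * PI).
Proof.
  intros Hk f HA HL. assert (HPI := PI_RGT_0).
  destruct (quot_values_bounds f _ HA HL) as [l [Pl [Hl1 Hquot]]].
  destruct HA as [Han [H0 H1]].
  destruct (holo_deriv_fun f) as [df Hdf].
  { intros z Hz. destruct (Han z Hz) as [d Hd]. exists d. apply has_cderiv_cderiv, Hd. }
  assert (E1 : df 0%C = RtoC 1).
  { apply (cderiv_unique f 0%C); [apply Hdf, in_disk_0|apply has_cderiv_cderiv, H1]. }
  destruct (holo_divide f df Hdf H0) as [h [dh [Hh [Eh Efh]]]]. rewrite E1 in Eh.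
  assert (Nh : forall z, in_disk z -> h z <> RtoC 0).
  { intros z Hz E. destruct (classic (z = RtoC 0)) as [->|Nz].
    - rewrite Eh in E. apply RtoC_inj in E. lra.
    - apply (proj1 (Hquot z (df z) Hz Nz (Hdf z Hz))). rewrite (Efh z Hz), E. ring. }
  destruct (holo_log h dh Hh Nh) as [H [HH0 [HH Hlog]]].
  destruct (holo_deriv _ _ HH) as [d2H H2].
  (* This is [z f' / f] written through [f = z h], a form that is holomorphic at 0 and takes the
     value 1 there. *)
  set (p := fun z => (1 + z * (dh z / h z))%C).
  assert (Hp : holo_on_disk p (fun z => 0 + (1 * (dh z / h z) + z * d2H z))%C).
  { intros z Hz. apply cderiv_plus; [apply cderiv_const|].
    apply (cderiv_mult (fun z => z) (fun z => dh z / h z)%C); [apply cderiv_id|apply H2, Hz]. }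
  assert (Hdf' : forall z, in_disk z -> df z = (h z + z * dh z)%C).
  { intros z Hz. apply (cderiv_unique f z); [apply Hdf, Hz|].
    apply (cderiv_ext_loc (fun z => z * h z)%C f z _ (1 - Cmod z)).
    - unfold in_disk in Hz. lra.
    - intros w Hw. symmetry. apply Efh. unfold in_disk. assert (T := Cmod_triangle_inv w z). lra.
    - eapply cderiv_eq; [apply cderiv_mult; [apply cderiv_id|apply Hh, Hz]|]. cbv beta. ring. }
  assert (Bp : forall z, in_disk z -> l <= Cmod (p z) <= exp (kappa * PI) * l).
  { intros z Hz. destruct (classic (z = RtoC 0)) as [->|Nz].
    - unfold p. replace (1 + 0 * (dh 0 / h 0))%C with (RtoC 1) by ring. rewrite Cmod_1. exact Hl1.
    - replace (p z) with (z * df z / f z)%C; [apply (Hquot z (df z) Hz Nz (Hdf z Hz))|].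
      unfold p. rewrite (Efh z Hz), (Hdf' z Hz). field. split; [apply Nh, Hz|exact Nz]. }
  assert (Np : forall z, in_disk z -> p z <> RtoC 0).
  { intros z Hz E. assert (B := Bp z Hz). rewrite E, Cmod_0 in B. lra. }
  destruct (holo_log p _ Hp Np) as [Q [HQ0 [HQ HlogQ]]].
  set (dQ := fun z => ((0 + (1 * (dh z / h z) + z * d2H z)) / p z)%C) in *.
  assert (Ep0 : p 0%C = RtoC 1) by (unfold p; ring).
  rewrite Ep0 in HlogQ. rewrite Eh in Hlog.
  assert (Hin : forall w, Re w < 0 -> in_disk (cexp w)).
  { intros w Hw. unfold in_disk. rewrite Cmod_cexp, <- exp_0. apply exp_increasing, Hw. }
  set (F := fun w => (w + H (cexp w))%C).
  set (q := fun w => Q (cexp w)).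
  set (dq := fun w => (dQ (cexp w) * cexp w)%C).
  assert (HF : forall w, Re w < 0 -> cderiv F w (cexp (q w))).
  { intros w Hw. eapply cderiv_eq.
    - apply cderiv_plus; [apply cderiv_id|]. apply (cderiv_comp H cexp); [apply HH, Hin, Hw|apply cderiv_cexp].
    - unfold q. replace (cexp (Q (cexp w))) with (p (cexp w)) by (rewrite (HlogQ _ (Hin w Hw)); ring).
      unfold p. ring. }
  assert (Hq : forall w, Re w < 0 -> cderiv q w (dq w)).
  { intros w Hw. apply (cderiv_comp Q cexp); [apply HQ, Hin, Hw|apply cderiv_cexp]. }
  assert (Bq : forall w, Re w < 0 -> ln l <= Re (q w) <= ln l + kappa * PI).
  { intros w Hw. assert (B := Bp _ (Hin w Hw)). rewrite (HlogQ _ (Hin w Hw)), Cmult_1_l, Cmod_cexp in B.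
    fold (q w) in B. split.
    - apply exp_le_inv. rewrite exp_ln by exact Pl. lra.
    - apply exp_le_inv. rewrite exp_plus, exp_ln by exact Pl. lra. }
  assert (Hdq : forall w, Re w < 0 -> Cmod (dq w) * - Re w <= kappa).
  { intros w Hw.
    assert (NC : RtoC kappa <> RtoC 0) by (intros E; apply RtoC_inj in E; lra).
    (* Rotating and rescaling the strip of [q] to [0 <= Im <= PI] makes [cexp (T w)] take values in
       the closed upper half-plane. *)
    set (T := fun w => (Ci / RtoC kappa * (q w - RtoC (ln l)))%C).
    assert (HT : forall w, Re w < 0 -> cderiv T w (Ci / RtoC kappa * dq w)%C).
    { intros v Hv. apply cderiv_scal. eapply cderiv_eq; [apply cderiv_minus; [apply Hq, Hv|apply cderiv_const]|ring]. }
    assert (HImT : forall v, Im (T v) = (Re (q v) - ln l) / kappa).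
    { intros v. unfold T. replace (Ci / RtoC kappa * (q v - RtoC (ln l)))%C with (RtoC (/ kappa) * (Ci * (q v - RtoC (ln l))))%C
        by (rewrite RtoC_inv by lra; field; exact NC).
      rewrite !Im_mult, Re_minus, Im_minus. simpl. field. lra. }
    assert (K := schwarz_pick_half_plane (fun w => cexp (T w)) w (cexp (T w) * (Ci / RtoC kappa * dq w))%C).
    assert (B : Cmod (cexp (T w) * (Ci / RtoC kappa * dq w)) * - Re w <= Im (cexp (T w))).
    { apply K.
      - intros v Hv. eexists. apply (cderiv_comp cexp T); [apply cderiv_cexp|apply HT, Hv].
      - intros v Hv. change (0 <= exp (Re (T v)) * sin (Im (T v))). apply Rmult_le_pos; [apply Rlt_le, exp_pos|].
        rewrite HImT. assert (Bv := Bq v Hv). apply sin_ge_0.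
        + apply Rdiv_le_0_compat; lra.
        + apply Rle_div_l; lra.
      - exact Hw.
      - apply (cderiv_comp cexp T); [apply cderiv_cexp|apply HT, Hw]. }
    (* Bounding the imaginary part by the modulus lets the factor [Cmod (cexp (T w))] cancel from
       both sides. *)
    assert (B2 := Rle_trans _ _ _ B (Rle_trans _ _ _ (Rle_abs _) (im_le_Cmod _))).
    assert (PU : 0 < Cmod (cexp (T w))) by (rewrite Cmod_cexp; apply exp_pos).
    rewrite !Cmod_mult, Cmod_div, Cmod_Ci, Cmod_R, Rabs_pos_eq in B2 by (assumption || lra).
    assert (B3 : 1 / kappa * Cmod (dq w) * - Re w <= 1).
    { apply (Rmult_le_reg_l (Cmod (cexp (T w)))); [exact PU|]. lra. }
    apply (Rmult_le_compat_l kappa) in B3; [|lra].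
    replace (kappa * (1 / kappa * Cmod (dq w) * - Re w)) with (Cmod (dq w) * - Re w) in B3 by (field; lra).
    lra. }
  assert (Hfexp : forall w, Re w < 0 -> f (cexp w) = cexp (F w)).
  { intros w Hw. rewrite (Efh _ (Hin w Hw)), (Hlog _ (Hin w Hw)). unfold F. rewrite cexp_plus. ring. }
  assert (Nf : forall z, in_disk z -> f z = RtoC 0 -> z = RtoC 0).
  { intros z Hz E. destruct (classic (z = RtoC 0)) as [->|Nz]; [reflexivity|].
    exfalso. exact (proj1 (Hquot z (df z) Hz Nz (Hdf z Hz)) E). }
  assert (Hpol : forall z, in_disk z -> z <> RtoC 0 -> exists w, cexp w = z /\ Re w < 0).
  { intros z Hz Nz. destruct (cexp_surj z Nz) as [w [Ew Hw]]. exists w. split; [exact Ew|].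
    rewrite Hw, <- ln_1. apply ln_increasing; [apply Cmod_nz, Nz|exact Hz]. }
  intros z1 z2 Hz1 Hz2 E.
  destruct (classic (z1 = RtoC 0)) as [->|N1].
  { rewrite H0 in E. symmetry. apply Nf; auto. }
  destruct (classic (z2 = RtoC 0)) as [->|N2].
  { rewrite H0 in E. apply Nf; auto. }
  destruct (Hpol z1 Hz1 N1) as [w1 [<- L1]]. destruct (Hpol z2 Hz2 N2) as [w2 [<- L2]].
  rewrite (Hfexp _ L1), (Hfexp _ L2) in E. destruct (cexp_eq _ _ E) as [k Hk'].
  (* [F] commutes with the translation by [2 pi i], so the multiple lost in taking logarithms can be
     moved into the argument of [F]. *)
  assert (Eper : cexp (w2 + (0%R, (2 * IZR k * PI)%R))%C = cexp w2).
  { rewrite cexp_plus, cexp_2kpi. ring. }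
  assert (Ew : w1 = (w2 + (0%R, (2 * IZR k * PI)%R))%C).
  { apply (half_plane_injective F q dq kappa Hk HF Hq Hdq); [exact L1|change (Re w2 + 0 < 0); lra|].
    rewrite Hk'. unfold F. rewrite Eper. apply C_eq; simpl; ring. }
  rewrite Ew. exact Eper.
Qed.

(** * The extremal strip map *)

Lemma Cconj_plus (a b : C) : Cconj (a + b) = (Cconj a + Cconj b)%C.
Proof. apply C_eq; simpl; ring. Qed.

Lemma Cconj_minus (a b : C) : Cconj (a - b) = (Cconj a - Cconj b)%C.
Proof. apply C_eq; simpl; ring. Qed.

Lemma Cconj_RtoC (x : R) : Cconj (RtoC x) = RtoC x.
Proof. apply C_eq; simpl; ring. Qed.

Lemma Cconj_cexp w : Cconj (cexp w) = cexp (Cconj w).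
Proof.
  unfold cexp. apply C_eq.
  - change (exp (Re w) * cos (Im w) = exp (Re w) * cos (- Im w)). rewrite cos_neg. reflexivity.
  - change (- (exp (Re w) * sin (Im w)) = exp (Re w) * sin (- Im w)). rewrite sin_neg. ring.
Qed.

Lemma in_disk_conj z : in_disk z -> in_disk (Cconj z).
Proof. unfold in_disk. rewrite Cmod_conj. auto. Qed.

Lemma cderiv_conj f z d : cderiv f (Cconj z) d -> cderiv (fun w => Cconj (f (Cconj w))) z (Cconj d).
Proof.
  intros H eps He. destruct (H eps He) as [del [Pd K]]. exists del; split; [exact Pd|].
  intros h Hh. rewrite <- (Cmod_conj h) in Hh |- *. specialize (K _ Hh).
  rewrite <- Cmod_conj in K. rewrite !Cconj_minus, Cmult_conj, Cconj_conj in K.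
  rewrite Cconj_plus. exact K.
Qed.

Lemma primitive_conj (G k : C -> C) : holo_on_disk G k -> G 0%C = 0%C ->
  (forall z, in_disk z -> k (Cconj z) = Cconj (k z)) -> forall z, in_disk z -> G (Cconj z) = Cconj (G z).
Proof.
  intros HG G0 Hk z Hz.
  assert (K := holo_const (fun z => Cconj (G (Cconj z)) - G z)%C).
  assert (E : (Cconj (G (Cconj z)) - G z)%C = (Cconj (G (Cconj 0)) - G 0)%C).
  { apply K; [|exact Hz]. intros w Hw. eapply cderiv_eq.
    - apply cderiv_minus; [apply cderiv_conj, HG, in_disk_conj, Hw|apply HG, Hw].
    - rewrite Hk, Cconj_conj by exact Hw. ring. }
  rewrite Cconj_RtoC, G0, Cconj_RtoC in E.
  rewrite <- (Cconj_conj (G (Cconj z))). f_equal.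
  replace (Cconj (G (Cconj z))) with ((Cconj (G (Cconj z)) - G z) + G z)%C by ring. rewrite E. ring.
Qed.

Lemma one_minus_nz (a z : C) : Cmod a = 1 -> in_disk z -> (1 - a * z)%C <> RtoC 0.
Proof.
  intros Ha Hz E. assert (T : (a * z)%C = RtoC 1) by (replace (a * z)%C with (1 - (1 - a * z))%C by ring; rewrite E; ring).
  apply (f_equal Cmod) in T. rewrite Cmod_mult, Ha, Cmod_1 in T. unfold in_disk in Hz. lra.
Qed.

Lemma IVT_between (f : R -> R) (y : R) :
  (forall t, 0 <= t <= 1 -> continuity_pt f t) -> (f 0 <= y <= f 1 \/ f 1 <= y <= f 0) ->
  exists t, 0 <= t <= 1 /\ f t = y.
Proof.
  intros Hf [H|H].
  - destruct (f_interv_is_interv f 0 1 y Rlt_0_1 H Hf) as [t Ht]. exists t. exact Ht.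
  - destruct (f_interv_is_interv (fun t => - f t) 0 1 (- y) Rlt_0_1 ltac:(lra)) as [t [Ht E]].
    + intros t Ht. apply (continuity_pt_opp f), Hf, Ht.
    + exists t. split; [exact Ht|lra].
Qed.

Section Strip.

Variable alpha : R.
Hypothesis Halpha : 0 < alpha < PI.

Let eta : C := cexp (0%R, alpha).

Lemma Cmod_eta : Cmod eta = 1.
Proof. unfold eta. rewrite Cmod_cexp. simpl. apply exp_0. Qed.

Lemma eta_parts : eta = (cos alpha, sin alpha).
Proof. unfold eta, cexp. simpl. rewrite exp_0. apply C_eq; simpl; ring. Qed.

(* [T = i log ((1 - conj eta z) / (1 - eta z))]; the strip bound selects the branch. *)
Lemma strip_map : exists T dT : C -> C, T 0%C = 0%C /\ holo_on_disk T dT /\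
  (forall z, in_disk z -> T (Cconj z) = Cconj (T z)) /\
  (forall z, in_disk z -> cexp (- Ci * T z)%C = ((1 - Cconj eta * z) / (1 - eta * z))%C) /\
  (forall z, in_disk z -> 0 < alpha - Re (T z) < PI).
Proof using Halpha.
  assert (Me := Cmod_eta). assert (Mc : Cmod (Cconj eta) = 1) by (rewrite Cmod_conj; exact Me).
  assert (N1 := fun z Hz => one_minus_nz eta z Me Hz).
  assert (N2 := fun z Hz => one_minus_nz (Cconj eta) z Mc Hz).
  set (k := fun z : C => (Ci * (eta / (1 - eta * z) - Cconj eta / (1 - Cconj eta * z)))%C).
  assert (Haff : forall a z, cderiv (fun w => 1 - a * w)%C z (- a)%C).
  { intros a z. eapply cderiv_eq; [apply cderiv_minus; [apply cderiv_const|apply cderiv_scal, cderiv_id]|ring]. }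
  assert (Hk : exists dk, holo_on_disk k dk).
  { apply holo_deriv_fun. intros z Hz. eexists. apply cderiv_scal. apply cderiv_minus.
    - apply cderiv_div; [apply N1, Hz|apply cderiv_const|apply Haff].
    - apply cderiv_div; [apply N2, Hz|apply cderiv_const|apply Haff]. }
  destruct Hk as [dk Hk]. destruct (holo_primitive k dk Hk) as [T [T0 HT]].
  assert (Hexp : forall z, in_disk z -> cexp (- Ci * T z)%C = ((1 - Cconj eta * z) / (1 - eta * z))%C).
  { intros z Hz.
    assert (K := holo_const (fun z => cexp (- Ci * T z) * ((1 - eta * z) / (1 - Cconj eta * z)))%C).
    cbv beta in K. rewrite T0 in K. replace (- Ci * 0)%C with (RtoC 0) in K by ring. rewrite cexp_0 in K.
    replace (cexp (- Ci * T z)%C) with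
      (cexp (- Ci * T z) * ((1 - eta * z) / (1 - Cconj eta * z)) * ((1 - Cconj eta * z) / (1 - eta * z)))%C.
    2:{ field. split; (apply N1, Hz || apply N2, Hz). }
    rewrite K; [|clear K|exact Hz].
    - field. apply N1, Hz.
    - intros w Hw. eapply cderiv_eq.
      + apply cderiv_mult.
        * apply (cderiv_comp cexp (fun z => - Ci * T z)%C); [apply cderiv_cexp|apply cderiv_scal, HT, Hw].
        * apply cderiv_div; [apply N2, Hw|apply Haff|apply Haff].
      + cbv beta. unfold k.
        replace (cexp (- Ci * T w) * (- Ci * (Ci * (eta / (1 - eta * w) - Cconj eta / (1 - Cconj eta * w)))))%C
          with (cexp (- Ci * T w) * (- (Ci * Ci)) * (eta / (1 - eta * w) - Cconj eta / (1 - Cconj eta * w)))%C by ring.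
        rewrite Ci_sqr. field. split; [apply N2, Hw|apply N1, Hw]. }
  exists T, k. split; [exact T0|]. split; [exact HT|]. split; [|split; [exact Hexp|]].
  - apply (primitive_conj T k HT T0). intros z Hz. unfold k.
    rewrite Cmult_conj, Cconj_minus, !Cdiv_conj, !Cconj_minus, !Cmult_conj, Cconj_conj, !Cconj_RtoC
      by (apply N1 || apply N2; assumption).
    replace (Cconj Ci) with (- Ci)%C by (apply C_eq; simpl; ring). ring.
  (* The Moebius map [eta (1 - conj eta z) / (1 - eta z)] sends the disk into the upper half-plane,
     and [alpha - Re (T z)] is an argument of its value. *)
  - assert (Hsin : forall z, in_disk z -> 0 < sin (alpha - Re (T z))).
    { intros z Hz.
      assert (E : (eta * cexp (- Ci * T z))%C = cexp (Im (T z), (alpha - Re (T z))%R)).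
      { unfold eta. rewrite <- cexp_plus. f_equal. destruct (T z) as [a b]. apply C_eq; simpl; ring. }
      rewrite Hexp in E by exact Hz.
      assert (P : 0 < Im (eta * ((1 - Cconj eta * z) / (1 - eta * z)))%C).
      { assert (PM := Cmod_nz _ (N1 z Hz)). assert (PM2 : 0 < Cmod (1 - eta * z) ^ 2) by (apply pow_lt, PM).
        assert (Ec : ((1 - eta * z) * Cconj (1 - eta * z))%C = RtoC (Cmod (1 - eta * z) ^ 2)) by (symmetry; apply Cmod2_conj).
        assert (Nn : (eta * Cconj eta)%C = RtoC 1) by (rewrite <- Cmod2_conj, Me; f_equal; ring).
        assert (Nc : Cconj (1 - eta * z) <> RtoC 0).
        { intros E0. apply (f_equal Cmod) in E0. rewrite Cmod_conj, Cmod_0 in E0. lra. }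
        replace (eta * ((1 - Cconj eta * z) / (1 - eta * z)))%C
          with (RtoC (/ Cmod (1 - eta * z) ^ 2) * (eta - (z + Cconj z) * (eta * Cconj eta) + Cconj eta * (z * Cconj z) * (eta * Cconj eta)))%C.
        - rewrite Nn, <- Cmod2_conj. assert (PI2 := Rinv_0_lt_compat _ PM2).
          set (i2 := / Cmod (1 - eta * z) ^ 2) in *. clearbody i2.
          rewrite Im_mult, eta_parts. change (Re (RtoC i2)) with i2. change (Im (RtoC i2)) with 0.
          rewrite Rmult_0_l, Rplus_0_r. apply Rmult_lt_0_compat; [exact PI2|].
          replace (Im ((cos alpha, sin alpha) - (z + Cconj z) * 1 + Cconj (cos alpha, sin alpha) * RtoC (Cmod z ^ 2) * 1)%C)
            with (sin alpha * (1 - Cmod z ^ 2)).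
          + apply Rmult_lt_0_compat; [apply sin_gt_0; lra|].
            unfold in_disk in Hz. assert (Q := Cmod_ge_0 z). nra.
          + generalize (Cmod z ^ 2). intros m. simpl. ring.
        - rewrite RtoC_inv by lra. rewrite <- Ec.
          rewrite Cconj_minus, Cmult_conj, Cconj_RtoC in *. field.
          split; [apply N1, Hz|exact Nc]. }
      rewrite E in P. change (0 < exp (Im (T z)) * sin (alpha - Re (T z))) in P.
      assert (PE := exp_pos (Im (T z))). nra. }
    intros z Hz.
    assert (Hc : forall t, 0 <= t <= 1 -> continuity_pt (fun t => alpha - Re (T (RtoC t * z)%C)) t).
    { intros t Ht. apply continuity_pt_filterlim.
      apply (continuous_minus (fun _ => alpha) (fun t => Re (T (RtoC t * z)%C))); [apply continuous_const|].
      apply (radial_vcont T k z t HT Hz Ht). }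
    assert (F0 : alpha - Re (T (RtoC 0 * z)%C) = alpha).
    { rewrite Cmult_0_l, T0. simpl. ring. }
    assert (F1 : alpha - Re (T (RtoC 1 * z)%C) = alpha - Re (T z)) by (rewrite Cmult_1_l; reflexivity).
    assert (Hnz : forall t, 0 <= t <= 1 -> 0 < sin (alpha - Re (T (RtoC t * z)%C))).
    { intros t Ht. apply Hsin, in_disk_scal; assumption. }
    (* Along the ray the argument starts at [alpha]; to leave [(0, PI)] it would have to take the
       value 0 or [PI], where the sine vanishes. *)
    split; apply Rnot_le_lt; intros L.
    + destruct (IVT_between (fun t => alpha - Re (T (RtoC t * z)%C)) 0) as [t [Ht Et]]; [exact Hc|lra|].
      specialize (Hnz t Ht). rewrite Et, sin_0 in Hnz. lra.
    + destruct (IVT_between (fun t => alpha - Re (T (RtoC t * z)%C)) PI) as [t [Ht Et]]; [exact Hc|lra|].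
      specialize (Hnz t Ht). rewrite Et, sin_PI in Hnz. lra.
Qed.
End Strip.

(** * Functions with a prescribed z f'/f *)

(** Solves [z f' / f = p] by [f = z e^H] with [H' = (p - 1) / z]; conjugation symmetry passes from
    [p] through the quotient to the primitive. *)
Lemma function_of_log_derivative (p dp : C -> C) : holo_on_disk p dp -> p 0%C = 1%C ->
  (forall z, in_disk z -> p (Cconj z) = Cconj (p z)) ->
  exists H g : C -> C, H 0%C = 0%C /\ holo_on_disk H g /\
    (forall z, in_disk z -> (1 + z * g z)%C = p z) /\
    (forall z, in_disk z -> H (Cconj z) = Cconj (H z)).
Proof.
  intros Hp Hp0 Hsym.
  destruct (holo_divide (fun z => p z - 1)%C (fun z => dp z - 0)%C) as [g [dg [Hg [Eg0 Eg]]]].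
  { intros z Hz. apply cderiv_minus; [apply Hp, Hz|apply cderiv_const]. }
  { rewrite Hp0. ring. }
  destruct (holo_primitive g dg Hg) as [H [H0 HH]].
  assert (HHsym : forall z, in_disk z -> H (Cconj z) = Cconj (H z)).
  { assert (Hgn : forall z, in_disk z -> z <> RtoC 0 -> g (Cconj z) = Cconj (g z)).
    { intros z Hz Nz.
      assert (Nc : Cconj z <> RtoC 0) by (intros E; apply Nz; rewrite <- (Cconj_conj z), E; apply Cconj_RtoC).
      assert (A := Eg _ (in_disk_conj z Hz)). rewrite Hsym in A by exact Hz.
      assert (B := f_equal Cconj (Eg z Hz)). rewrite Cconj_minus, Cconj_RtoC, Cmult_conj in B.
      rewrite A in B.
      replace (g (Cconj z)) with (Cconj z * g (Cconj z) / Cconj z)%C by (field; exact Nc).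
      rewrite B. field. exact Nc. }
    apply (primitive_conj H g HH H0). intros z Hz.
    (* At 0 the quotient gives nothing; there [g 0 = p'(0)] is real since [p] equals its own
       conjugate reflection and derivatives are unique. *)
    destruct (classic (z = RtoC 0)) as [->|Nz]; [|apply Hgn; assumption].
    assert (C0 : Cconj (RtoC 0) = RtoC 0) by apply Cconj_RtoC.
    rewrite C0, Eg0, Cconj_minus, C0. f_equal.
    apply (cderiv_unique p 0%C); [apply Hp, in_disk_0|].
    apply (cderiv_ext_loc (fun w => Cconj (p (Cconj w))) p _ _ 1); [lra| |].
    - intros w Hw. replace (w - 0)%C with w in Hw by ring. rewrite Hsym, Cconj_conj by exact Hw. reflexivity.
    - apply cderiv_conj. rewrite C0. apply Hp, in_disk_0. }
  exists H, g. split; [exact H0|]. split; [exact HH|]. split; [|exact HHsym].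
  intros z Hz. rewrite <- (Eg z Hz). ring.
Qed.

Lemma exp_form_holo (H g : C -> C) : holo_on_disk H g ->
  holo_on_disk (fun z => z * cexp (H z))%C (fun z => cexp (H z) * (1 + z * g z))%C.
Proof.
  intros HH z Hz. eapply cderiv_eq.
  - apply (cderiv_mult (fun z => z) (fun z => cexp (H z))); [apply cderiv_id|].
    apply (cderiv_comp cexp H); [apply cderiv_cexp|apply HH, Hz].
  - cbv beta. ring.
Qed.

Lemma exp_form_classA (H g : C -> C) : holo_on_disk H g -> H 0%C = 0%C ->
  classA (fun z => z * cexp (H z))%C.
Proof.
  intros HH H0. assert (Hf := exp_form_holo H g HH). split; [|split].
  - intros z Hz. eexists. apply has_cderiv_cderiv, Hf, Hz.
  - ring.
  - apply has_cderiv_cderiv. eapply cderiv_eq; [apply Hf, in_disk_0|].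
    cbv beta. rewrite H0, cexp_0. ring.
Qed.

Lemma exp_form_ratio_le (H g : C -> C) m delta : holo_on_disk H g -> H 0%C = 0%C ->
  0 < m -> m <= 1 <= exp delta * m ->
  (forall z, in_disk z -> m <= Cmod (1 + z * g z) <= exp delta * m) ->
  let f := (fun z => z * cexp (H z))%C in
  Rbar_le (Lf f) (Rbar_mult (Finite (exp delta)) (lf f)).
Proof.
  intros HH H0 Hm H1 Hb f. assert (HA := exp_form_classA H g HH H0). fold f in HA.
  assert (Hf := exp_form_holo H g HH). fold f in Hf.
  assert (V : forall x, quot_values f x -> Rbar_le (Finite m) x /\ Rbar_le x (Finite (exp delta * m))).
  { intros x [z [d [Hz [Hd [[_ ->]|[[Nz [Z _]]|[Nz [_ ->]]]]]]]].
    - simpl. lra.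
    (* [z e^H] vanishes only at 0, so the value [p_infty] does not occur. *)
    - exfalso. apply (Cmult_neq_0 z (cexp (H z)) Nz (cexp_nz _)), Z.
    - apply has_cderiv_cderiv in Hd. rewrite (cderiv_unique _ _ _ _ Hd (Hf z Hz)).
      replace (z * (cexp (H z) * (1 + z * g z)) / f z)%C with (1 + z * g z)%C.
      + apply Hb, Hz.
      + unfold f. field. split; [apply cexp_nz|exact Nz]. }
  assert (A : Rbar_le (Lf f) (Finite (exp delta * m))) by (apply Lf_is_lub; intros x Hx; apply V, Hx).
  assert (B : Rbar_le (Finite m) (lf f)) by (apply lf_is_glb; intros x Hx; apply V, Hx).
  destruct (lf_finite f HA) as [l [El _]]. rewrite El in B |- *.
  eapply Rbar_le_trans; [exact A|]. simpl in *. apply Rmult_le_compat_l; [apply Rlt_le, exp_pos|exact B].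
Qed.

(* [f (t z) / t] tends to [z] as [t -> 0], so [Im f] changes sign on the segment from [0] to [z]. *)
Lemma exp_form_not_univalent (H g : C -> C) z : holo_on_disk H g -> H 0%C = 0%C ->
  (forall z, in_disk z -> H (Cconj z) = Cconj (H z)) ->
  in_disk z -> Im z < 0 -> 0 <= Im (z * cexp (H z))%C ->
  ~ univalent_on_disk (fun z => z * cexp (H z))%C.
Proof.
  intros HH H0 Hsym Hz Hneg Hpos U.
  destruct (IVT_between (fun t => Im (z * cexp (H (RtoC t * z)))%C) 0) as [t [Ht E]].
  - intros t Ht. apply continuity_pt_filterlim.
    apply (vcont_mult (fun _ => z) (fun t => cexp (H (RtoC t * z)%C))); [apply vcont_const|].
    eapply vcont_vderiv. apply (vderiv_comp cexp (fun t => H (RtoC t * z)%C)); [apply cderiv_cexp|].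
    apply (vderiv_comp H (fun t => RtoC t * z)%C); [apply HH, in_disk_scal; assumption|apply vderiv_ray].
  - left. rewrite Cmult_0_l, H0, cexp_0, Cmult_1_r, Cmult_1_l. lra.
  - cbv beta in E.
    assert (Pt : 0 < t).
    { destruct Ht as [[Ht|Ht] _]; [exact Ht|]. rewrite <- Ht, Cmult_0_l, H0, cexp_0, Cmult_1_r in E. lra. }
    set (u := (RtoC t * z)%C) in *. assert (Hu : in_disk u) by (apply in_disk_scal; assumption).
    assert (Iu : Im u = t * Im z) by (unfold u; rewrite Im_mult; simpl; ring).
    assert (Ef : (u * cexp (H u))%C = (RtoC t * (z * cexp (H u)))%C) by (unfold u at 1; ring).
    assert (If : Im (u * cexp (H u))%C = 0) by (rewrite Ef, Im_mult, E; change (Im (RtoC t)) with 0; ring).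
    assert (E2 : Cconj (u * cexp (H u)) = (u * cexp (H u))%C).
    { apply C_eq; [reflexivity|]. change (- Im (u * cexp (H u))%C = Im (u * cexp (H u))%C). rewrite If. ring. }
    assert (Eq : Cconj u = u).
    { apply U; [apply in_disk_conj, Hu|exact Hu|]. rewrite Hsym by exact Hu.
      rewrite <- Cconj_cexp, <- Cmult_conj. exact E2. }
    apply (f_equal Im) in Eq. change (Im (Cconj u)) with (- Im u) in Eq. nra.
Qed.

(** * The strip coordinate and its inverse *)

Definition ccosh (w : C) : C := ((cexp w + cexp (- w)) / 2)%C.

Section Path.

Variables (alpha kappa : R) (T f df : C -> C).
Hypothesis Halpha : 0 < alpha < PI.
Let eta : C := cexp (0%R, alpha).
Hypothesis HT : forall z, in_disk z -> cexp (- Ci * T z)%C = ((1 - Cconj eta * z) / (1 - eta * z))%C.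
Hypothesis HTs : forall z, in_disk z -> 0 < alpha - Re (T z) < PI.
Hypothesis Hf : holo_on_disk f df.
Hypothesis Hfp : forall z, in_disk z -> (z * df z)%C = (f z * cexp (RtoC kappa * T z))%C.

(** The inverse of the strip coordinate: the solution [z] of [e^w = (eta - z) / (1 - eta z)]. It
    vanishes at [w = i alpha]. *)
Definition strip_point (w : C) : C := ((cexp w - eta) / (eta * cexp w - 1))%C.

Lemma eta_conj : (eta * Cconj eta)%C = RtoC 1.
Proof. rewrite <- Cmod2_conj. unfold eta. rewrite Cmod_eta. f_equal. ring. Qed.

Lemma Im_cexp_pos w : 0 < Im w < PI -> 0 < Im (cexp w).
Proof.
  intros H. change (0 < exp (Re w) * sin (Im w)). apply Rmult_lt_0_compat; [apply exp_pos|apply sin_gt_0; lra].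
Qed.

Lemma strip_point_den w : 0 < Im w < PI -> (eta * cexp w - 1)%C <> RtoC 0.
Proof.
  intros Hw E.
  assert (E' : cexp w = Cconj eta).
  { replace (cexp w) with (Cconj eta * (eta * cexp w - 1) + Cconj eta + (1 - eta * Cconj eta) * cexp w)%C by ring.
    rewrite E, eta_conj. ring. }
  assert (A := Im_cexp_pos w Hw). rewrite E' in A. unfold eta in A. rewrite eta_parts in A. simpl in A.
  assert (B := sin_gt_0 alpha). lra.
Qed.

(** Locates the path: [Re w = 0] corresponds to real [z], and [Re w > 0] to the lower half-disk. The
    real part fixes the sign at the starting point. *)
Lemma strip_point_parts w : 0 < Im w < PI ->
  in_disk (strip_point w) /\
  Im (strip_point w) = sin alpha * (1 - Cmod (cexp w) ^ 2) / Cmod (eta * cexp w - 1) ^ 2 /\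
  Re (strip_point w) = (cos alpha * (1 + Cmod (cexp w) ^ 2) - 2 * Re (cexp w)) / Cmod (eta * cexp w - 1) ^ 2.
Proof using Halpha.
  intros Hw. assert (Nd := strip_point_den w Hw). assert (PM := Cmod_nz _ Nd).
  assert (PM2 : 0 < Cmod (eta * cexp w - 1) ^ 2) by (apply pow_lt, PM).
  assert (A := Im_cexp_pos w Hw). assert (B := sin_gt_0 alpha (proj1 Halpha) (proj2 Halpha)).
  assert (S := sin2_cos2 alpha). unfold Rsqr in S.
  split.
  - unfold in_disk, strip_point. rewrite Cmod_div by exact Nd. apply Rlt_div_l; [exact PM|]. rewrite Rmult_1_l.
    apply Rsqr_incrst_0; [|apply Cmod_ge_0|apply Cmod_ge_0].
    unfold Rsqr.
    replace (Cmod (cexp w - eta) * Cmod (cexp w - eta)) with (Cmod (cexp w - eta) ^ 2) by ring.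
    replace (Cmod (eta * cexp w - 1) * Cmod (eta * cexp w - 1)) with (Cmod (eta * cexp w - 1) ^ 2) by ring.
    rewrite !Cmod2_alt. unfold eta. rewrite eta_parts. destruct (cexp w) as [x y]. simpl in *.
    set (si := sin alpha) in *. set (co := cos alpha) in *. nra.
  - unfold strip_point.
    assert (Ec : ((eta * cexp w - 1) * Cconj (eta * cexp w - 1))%C = RtoC (Cmod (eta * cexp w - 1) ^ 2))
      by (symmetry; apply Cmod2_conj).
    assert (Nc : Cconj (eta * cexp w - 1) <> RtoC 0).
    { intros E0. apply (f_equal Cmod) in E0. rewrite Cmod_conj, Cmod_0 in E0. lra. }
    replace ((cexp w - eta) / (eta * cexp w - 1))%C
      with (RtoC (/ Cmod (eta * cexp w - 1) ^ 2) * (Cconj eta * (cexp w * Cconj (cexp w)) - cexp w - (eta * Cconj eta) * Cconj (cexp w) + eta))%C.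
    + rewrite <- Cmod2_conj, eta_conj. set (i2 := / Cmod (eta * cexp w - 1) ^ 2).
      rewrite Im_mult, Re_mult. change (Re (RtoC i2)) with i2. change (Im (RtoC i2)) with 0.
      unfold Rdiv. fold i2. set (m := Cmod (cexp w) ^ 2). unfold eta. rewrite eta_parts.
      destruct (cexp w) as [x y]. split; simpl; ring.
    + rewrite RtoC_inv by lra. rewrite <- Ec. rewrite Cconj_minus, Cmult_conj, Cconj_RtoC in *. field.
      split; [exact Nd|exact Nc].
Qed.

(** Exponentials agree, which leaves a multiple of [2 pi]; both sides lie in a strip of width [PI],
    so the multiple is zero. *)
Lemma T_strip_point w : 0 < Im w < PI -> T (strip_point w) = (Ci * w + RtoC alpha)%C.
Proof using Halpha HT HTs.
  intros Hw. destruct (strip_point_parts w Hw) as [Hz _].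
  assert (Nd := strip_point_den w Hw). assert (B := sin_gt_0 alpha (proj1 Halpha) (proj2 Halpha)).
  assert (Nee : (eta - Cconj eta)%C <> RtoC 0).
  { intros E. apply (f_equal Im) in E. unfold eta in E. rewrite eta_parts in E. simpl in E. lra. }
  assert (Ne : eta <> RtoC 0) by apply cexp_nz.
  assert (Ece : Cconj eta = (1 / eta)%C).
  { rewrite <- eta_conj. field. exact Ne. }
  assert (E : cexp (- Ci * T (strip_point w))%C = cexp (w - (0%R, alpha))%C).
  { rewrite HT by exact Hz. rewrite cexp_minus. fold eta. unfold strip_point.
    rewrite Ece in *. field. repeat split; try assumption.
    intros E0. apply Nee.
    replace (eta - 1 / eta)%C with ((eta * cexp w - 1 - eta * (cexp w - eta)) / eta)%C by (field; exact Ne).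
    rewrite E0. field. exact Ne. }
  destruct (cexp_eq _ _ E) as [k Hk].
  assert (ET : T (strip_point w) = (Ci * w + RtoC alpha - RtoC (2 * IZR k * PI))%C).
  { replace (T (strip_point w)) with (Ci * (- Ci * T (strip_point w)))%C.
    - rewrite Hk. apply C_eq; destruct w; simpl; ring.
    - replace (Ci * (- Ci * T (strip_point w)))%C with (- (Ci * Ci) * T (strip_point w))%C by ring.
      rewrite Ci_sqr. ring. }
  assert (Bs := HTs _ Hz). rewrite ET in Bs.
  replace (Re (Ci * w + RtoC alpha - RtoC (2 * IZR k * PI))%C) with (alpha - Im w - 2 * IZR k * PI) in Bs
    by (destruct w; simpl; ring).
  assert (K : k = 0%Z).
  { assert (HPI := PI_RGT_0). assert (-1 < IZR k < 1) by nra.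
    destruct H as [L1 L2]. apply lt_IZR in L1. apply lt_IZR in L2. lia. }
  rewrite ET, K. apply C_eq; destruct w; simpl; ring.
Qed.

(** The exponential factor is [z f' / f] at [strip_point w], since [T = i w + alpha] there; the
    remaining quotient is the logarithmic derivative of [strip_point]. *)
Definition strip_log_deriv (w : C) : C :=
  (Ci * RtoC (sin alpha) * cexp (RtoC kappa * (Ci * w + RtoC alpha)) / (ccosh w - RtoC (cos alpha)))%C.

Lemma ccosh_sub_factor w : (ccosh w - RtoC (cos alpha))%C = ((cexp w - eta) * (cexp w - Cconj eta) / (2 * cexp w))%C.
Proof.
  unfold ccosh. rewrite cexp_opp.
  replace (RtoC (cos alpha)) with ((eta + Cconj eta) / 2)%C.
  - replace ((cexp w - eta) * (cexp w - Cconj eta))%C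
      with (cexp w * cexp w - (eta + Cconj eta) * cexp w + eta * Cconj eta)%C by ring.
    rewrite eta_conj. field. apply cexp_nz.
  - unfold eta. rewrite eta_parts. apply C_eq; simpl; field.
Qed.

Lemma strip_param_deriv w : 0 < Im w < PI -> cexp w <> eta ->
  cderiv (fun w => f (strip_point w)) w (f (strip_point w) * strip_log_deriv w)%C.
Proof using Halpha HT HTs Hf Hfp.
  intros Hw Nw. destruct (strip_point_parts w Hw) as [Hz _].
  assert (Nd := strip_point_den w Hw). assert (NE := cexp_nz w). assert (Ne : eta <> RtoC 0) by apply cexp_nz.
  assert (Nz : strip_point w <> RtoC 0).
  { unfold strip_point. apply Cmult_neq_0; [|intros E; apply Nd].
    - intros E. apply Nw. replace (cexp w) with ((cexp w - eta) + eta)%C by ring. rewrite E. ring.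
    - apply Cmod_eq_0. apply (f_equal Cmod) in E. rewrite Cmod_inv, Cmod_0 in E by exact Nd.
      apply Rmult_eq_reg_r with (/ Cmod (eta * cexp w - 1)).
      + rewrite E. ring.
      + rewrite E. exfalso. assert (P := Rinv_0_lt_compat _ (Cmod_nz _ Nd)). lra. }
  eapply cderiv_eq.
  - apply (cderiv_comp f strip_point); [apply Hf, Hz|]. unfold strip_point.
    apply cderiv_div; [exact Nd| |].
    + apply cderiv_minus; [apply cderiv_cexp|apply cderiv_const].
    + apply cderiv_minus; [apply cderiv_scal, cderiv_cexp|apply cderiv_const].
  - cbv beta.
    replace (df (strip_point w)) with (f (strip_point w) * cexp (RtoC kappa * (Ci * w + RtoC alpha)) / strip_point w)%C.
    2:{ rewrite <- (T_strip_point w Hw), <- (Hfp _ Hz). field. exact Nz. }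
    unfold strip_log_deriv. rewrite ccosh_sub_factor.
    assert (Ece : Cconj eta = (1 / eta)%C) by (rewrite <- eta_conj; field; exact Ne).
    replace (Ci * RtoC (sin alpha))%C with ((eta - Cconj eta) / 2)%C
      by (unfold eta; rewrite eta_parts; apply C_eq; simpl; field).
    rewrite Ece.
    set (A := f (strip_point w)). set (B := cexp (RtoC kappa * (Ci * w + RtoC alpha))%C). unfold strip_point.
    assert (Nw' : (cexp w - eta)%C <> RtoC 0).
    { intros E. apply Nw. replace (cexp w) with ((cexp w - eta) + eta)%C by ring. rewrite E. ring. }
    assert (Nc : (cexp w * eta - 1)%C <> RtoC 0) by (rewrite Cmult_comm; exact Nd).
    field. repeat split; assumption.
Qed.

End Path.

(** * Integration along a path in the strip *)

Lemma vderiv_plus g h t a b : vderiv g t a -> vderiv h t b -> vderiv (fun s => g s + h s)%C t (a + b)%C.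
Proof.
  intros Hg Hh. apply vderiv_parts.
  - apply (is_derive_plus (fun s => Re (g s)) (fun s => Re (h s))); apply vderiv_re; assumption.
  - apply (is_derive_plus (fun s => Im (g s)) (fun s => Im (h s))); apply vderiv_im; assumption.
Qed.

Lemma vderiv_scal c g t a : vderiv g t a -> vderiv (fun s => c * g s)%C t (c * a)%C.
Proof.
  intros Hg. apply (vderiv_comp (fun w => c * w)%C g); [|exact Hg].
  eapply cderiv_eq; [apply cderiv_scal, cderiv_id|ring].
Qed.

Lemma vderiv_mult g h t a b : vderiv g t a -> vderiv h t b ->
  vderiv (fun s => g s * h s)%C t (a * h t + g t * b)%C.
Proof.
  intros Hg Hh.
  assert (S1 := vderiv_comp (fun w => w * w)%C _ _ _ _ (cderiv_sqr _) (vderiv_plus _ _ _ _ _ Hg Hh)).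
  assert (S2 := vderiv_comp (fun w => w * w)%C _ _ _ _ (cderiv_sqr _)
    (vderiv_plus _ _ _ _ _ Hg (vderiv_scal (- (1))%C _ _ _ Hh))).
  assert (K := vderiv_scal (/ 4)%C _ _ _ (vderiv_plus _ _ _ _ _ S1 (vderiv_scal (- (1))%C _ _ _ S2))).
  assert (E : forall s, (/ 4 * ((g s + h s) * (g s + h s) + - (1) * ((g s + - (1) * h s) * (g s + - (1) * h s))))%C = (g s * h s)%C)
    by (intros s; field).
  intros eps He. destruct (K eps He) as [del [Pd Kd]]. exists del; split; [exact Pd|].
  intros r Hr. specialize (Kd r Hr). cbv beta in Kd. rewrite !E in Kd.
  match goal with |- Cmod ?x <= _ => match type of Kd with Cmod ?y <= _ => replace x with y by field end end.
  exact Kd.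
Qed.

Lemma antiderivative (w : R -> C) a : (forall t, vcont w t) ->
  exists I : R -> C, I a = 0%C /\ forall t, vderiv I t (w t).
Proof.
  intros Hw.
  exists (fun t => (RInt (fun s => Re (w s)) a t, RInt (fun s => Im (w s)) a t)).
  assert (K : forall g : R -> R, (forall t, continuous g t) -> forall t, is_derive (fun t => RInt g a t) t (g t)).
  { intros g Hg t. apply (is_derive_RInt g (fun t => RInt g a t) a t); [|apply Hg].
    apply filter_forall. intros u. apply (RInt_correct (V := R_CompleteNormedModule)).
    apply (ex_RInt_continuous (V := R_CompleteNormedModule)). intros z _. apply Hg. }
  split.
  - rewrite !RInt_point. reflexivity.
  - intros t. apply vderiv_parts; apply (K (fun s => _ (w s))); intros s; apply Hw.
Qed.

(** The integrating factor [cexp (- I)] makes the product constant. The change of argument of [y] is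
    thus read from [Im (I b)] without choosing a branch of its logarithm. *)
Lemma linear_ode (y w I : R -> C) a b : a <= b -> I a = 0%C -> (forall t, a <= t <= b -> vderiv I t (w t)) ->
  (forall t, a <= t <= b -> vderiv y t (y t * w t)%C) -> y b = (y a * cexp (I b))%C.
Proof.
  intros Hab I0 HI Hy.
  assert (K := vderiv_bound (fun t => y t * cexp (- (1) * I t))%C (fun _ => RtoC 0) (fun _ => 0) (fun _ => 0) a b Hab).
  cbv beta in K. rewrite I0 in K. replace (- (1) * 0)%C with (RtoC 0) in K by ring. rewrite cexp_0 in K.
  assert (E : (y b * cexp (- (1) * I b) - y a * 1)%C = RtoC 0).
  { apply Cmod_eq_0, Rle_antisym; [|apply Cmod_ge_0]. rewrite Rminus_0_r in K. apply K.
    - intros t Ht. eapply vderiv_eq.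
      + apply vderiv_mult; [apply Hy, Ht|].
        apply (vderiv_comp cexp (fun t => - (1) * I t)%C); [apply cderiv_cexp|apply vderiv_scal, HI, Ht].
      + cbv beta. ring.
    - intros t _. apply (is_derive_const (K := R_AbsRing) (V := R_NormedModule)).
    - intros t _. rewrite Cmod_0. lra. }
  replace (- (1) * I b)%C with (- I b)%C in E by ring. rewrite cexp_opp in E.
  replace (y b) with ((y b * / cexp (I b) - y a * 1 + y a) * cexp (I b))%C by (field; apply cexp_nz).
  rewrite E. ring.
Qed.

Section PathIntegral.

Variables (alpha kappa : R) (T f df : C -> C).
Hypothesis Halpha : 0 < alpha < PI.
Hypothesis HT : forall z, in_disk z ->
  cexp (- Ci * T z)%C = ((1 - Cconj (cexp (0%R, alpha)) * z) / (1 - cexp (0%R, alpha) * z))%C.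
Hypothesis HTs : forall z, in_disk z -> 0 < alpha - Re (T z) < PI.
Hypothesis Hf : holo_on_disk f df.
Hypothesis Hfp : forall z, in_disk z -> (z * df z)%C = (f z * cexp (RtoC kappa * T z))%C.

Lemma cexp_ne_eta_hor s phi : alpha < phi < PI -> cexp (s, phi) <> cexp (0%R, alpha) /\ cexp (s, phi) <> Cconj (cexp (0%R, alpha)).
Proof using Halpha.
  intros Hp. assert (P := exp_pos s).
  split; intros E.
  - assert (A := f_equal Cmod E). rewrite !Cmod_cexp in A. simpl in A.
    assert (B := f_equal Re E). unfold cexp in B. simpl in B. rewrite A in B. rewrite exp_0, !Rmult_1_l in B.
    assert (D := cos_decreasing_1 alpha phi). lra.
  - assert (B := f_equal Im E). unfold cexp in B. simpl in B. rewrite exp_0, Rmult_1_l in B.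
    assert (S1 := sin_gt_0 alpha). assert (S2 := sin_gt_0 phi). nra.
Qed.

Lemma cexp_ne_eta_ver s phi : 0 < s -> cexp (s, phi) <> cexp (0%R, alpha) /\ cexp (s, phi) <> Cconj (cexp (0%R, alpha)).
Proof.
  intros Hs. assert (L : 1 < exp s) by (rewrite <- exp_0; apply exp_increasing, Hs).
  split; intros E; apply (f_equal Cmod) in E; rewrite ?Cmod_conj, !Cmod_cexp in E; simpl in E; rewrite exp_0 in E; lra.
Qed.

Lemma strip_log_deriv_derivable w : cexp w <> cexp (0%R, alpha) -> cexp w <> Cconj (cexp (0%R, alpha)) ->
  exists d, cderiv (strip_log_deriv alpha kappa) w d.
Proof.
  intros N1 N2. unfold strip_log_deriv. eexists. apply cderiv_div.
  - rewrite ccosh_sub_factor.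
    assert (A1 : forall u v : C, u <> v -> (u - v)%C <> RtoC 0).
    { intros u v N E. apply N. replace u with ((u - v) + v)%C by ring. rewrite E. ring. }
    assert (N2' : (2 * cexp w)%C <> RtoC 0).
    { apply Cmult_neq_0; [|apply cexp_nz]. intros E; apply RtoC_inj in E; lra. }
    intros E. apply (Cmult_neq_0 _ _ (A1 _ _ N1) (A1 _ _ N2)).
    match type of E with (?a / ?b)%C = _ => replace a with (a / b * b)%C by (field; apply cexp_nz) end.
    rewrite E. ring.
  - apply cderiv_scal. apply (cderiv_comp cexp (fun w => RtoC kappa * (Ci * w + RtoC alpha))%C); [apply cderiv_cexp|].
    apply cderiv_scal, cderiv_plus; [apply cderiv_scal, cderiv_id|apply cderiv_const].
  - apply cderiv_minus; [|apply cderiv_const]. unfold ccosh.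
    apply cderiv_div; [intros E; apply RtoC_inj in E; lra| |apply cderiv_const].
    apply cderiv_plus; [apply cderiv_cexp|].
    apply (cderiv_comp cexp (fun w => - w)%C); [apply cderiv_cexp|].
    apply (cderiv_ext (fun w => - (1) * w)%C); [intros u; ring|]. apply cderiv_scal, cderiv_id.
Qed.

(** The horizontal side passes above the pole [i alpha] of the kernel and the vertical side to its
    right. [I2] is taken upwards from [phi2] while the path descends, whence its minus sign. *)
Lemma path_value S phi1 phi2 : 0 < S -> alpha < phi1 < PI -> 0 < phi2 <= phi1 ->
  exists I1 I2 : R -> C, I1 0 = 0%C /\ I2 phi2 = 0%C /\
    (forall s, vderiv I1 s (strip_log_deriv alpha kappa (s, phi1))) /\
    (forall t, vderiv I2 t (strip_log_deriv alpha kappa (S, t) * Ci)%C) /\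
    f (strip_point alpha (S, phi2)) = (f (strip_point alpha (0%R, phi1)) * cexp (I1 S - I2 phi1))%C.
Proof using Halpha HT HTs Hf Hfp.
  intros HS H1 H2.
  destruct (antiderivative (fun s => strip_log_deriv alpha kappa (s, phi1)) 0) as [I1 [Z1 D1]].
  { intros t. destruct (cexp_ne_eta_hor t phi1 H1) as [N1 N2].
    destruct (strip_log_deriv_derivable (t, phi1) N1 N2) as [d Hd]. eapply vcont_vderiv.
    apply (vderiv_comp (strip_log_deriv alpha kappa) (fun s => (s, phi1) : C)); [apply Hd|apply vderiv_hor]. }
  destruct (antiderivative (fun t => strip_log_deriv alpha kappa (S, t) * Ci)%C phi2) as [I2 [Z2 D2]].
  { intros t. apply vcont_mult; [|apply vcont_const]. destruct (cexp_ne_eta_ver S t HS) as [N1 N2].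
    destruct (strip_log_deriv_derivable (S, t) N1 N2) as [d Hd]. eapply vcont_vderiv.
    apply (vderiv_comp (strip_log_deriv alpha kappa) (fun s => (S, s) : C)); [apply Hd|apply vderiv_ver]. }
  exists I1, I2. split; [exact Z1|]. split; [exact Z2|]. split; [exact D1|]. split; [exact D2|].
  assert (E1 := linear_ode (fun s => f (strip_point alpha (s, phi1))) _ I1 0 S ltac:(lra) Z1 (fun t _ => D1 t)).
  assert (E2 := linear_ode (fun t => f (strip_point alpha (S, t))) _ I2 phi2 phi1 ltac:(lra) Z2 (fun t _ => D2 t)).
  cbv beta in E1, E2.
  rewrite E1 in E2.
  - unfold Cminus. rewrite cexp_plus, cexp_opp.
    replace (f (strip_point alpha (S, phi2))) with
      (f (strip_point alpha (S, phi2)) * cexp (I2 phi1) * / cexp (I2 phi1))%C by (field; apply cexp_nz).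
    rewrite <- E2; [ring|].
    intros t Ht. eapply vderiv_eq.
    + apply (vderiv_comp (fun w => f (strip_point alpha w)) (fun s => (S, s) : C)); [|apply vderiv_ver].
      apply (strip_param_deriv alpha kappa T f df Halpha HT HTs Hf Hfp); [simpl; lra|apply cexp_ne_eta_ver, HS].
    + ring.
  - intros t Ht. eapply vderiv_eq.
    + apply (vderiv_comp (fun w => f (strip_point alpha w)) (fun s => (s, phi1) : C)); [|apply vderiv_hor].
      apply (strip_param_deriv alpha kappa T f df Halpha HT HTs Hf Hfp); [simpl; lra|apply cexp_ne_eta_hor, H1].
    + ring.
Qed.

End PathIntegral.

(** * Numerical estimates *)

Lemma derive_nonneg_le (f f' : R -> R) a b : a <= b -> (forall x, a <= x <= b -> is_derive f x (f' x)) ->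
  (forall x, a <= x <= b -> 0 <= f' x) -> f a <= f b.
Proof.
  intros Hab Hd Hp.
  destruct (MVT_gen f a b f') as [c [Hc E]].
  - rewrite Rmin_left, Rmax_right by assumption. intros x Hx. apply Hd; lra.
  - rewrite Rmin_left, Rmax_right by assumption. intros x Hx.
    apply continuity_pt_filterlim, (ex_derive_continuous f). eexists; apply Hd, Hx.
  - rewrite Rmin_left, Rmax_right in Hc by assumption. specialize (Hp c Hc). nra.
Qed.

(** Consecutive partial sums of the alternating series for
    [PI / 4 = 2 atan (1 / 3) + atan (1 / 7)]. *)
Lemma PI_bounds : 3.14 < PI < 3.1421.
Proof.
  assert (H := PI_2_3_7_ineq 1). unfold tg_alt, PI_2_3_7_tg, Ratan_seq in H. simpl in H.
  replace (1 + 1 + 1 + 1 + 1 + 1 + 1) with 7 in H by ring.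
  replace (1 + 1 + 1 + 1 + 1) with 5 in H by ring.
  replace (1 + 1 + 1) with 3 in H by ring. lra.
Qed.

(** The cubic times [e^(-x)] has derivative [- x^3 / 6 * e^(-x)], hence maximum 1 at 0. Validity for
    negative [x] also yields upper bounds for [exp], by inversion. *)
Lemma exp_ge_cubic x : 1 + x + x ^ 2 / 2 + x ^ 3 / 6 <= exp x.
Proof.
  set (h := fun x => - ((1 + x + x ^ 2 / 2 + x ^ 3 / 6) * exp (- x))).
  set (h' := fun x => x ^ 3 / 6 * exp (- x)).
  assert (Hd : forall t, is_derive h t (h' t)).
  { intros t. unfold h, h'. auto_derive; [trivial|]. field. }
  assert (Hd' : forall t, is_derive (fun t => - h t) t (- h' t)).
  { intros t. apply (is_derive_opp h), Hd. }
  assert (H0 : h 0 = -1).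
  { unfold h. rewrite Ropp_0, exp_0. field. }
  assert (K : h 0 <= h x).
  { destruct (Rle_dec 0 x) as [P|P].
    - apply (derive_nonneg_le h h'); [exact P|intros; apply Hd|]. intros t Ht. unfold h'.
      apply Rmult_le_pos; [|apply Rlt_le, exp_pos]. assert (0 <= t ^ 3) by (apply pow_le; lra). lra.
    - enough (- h x <= - h 0) by lra.
      apply (derive_nonneg_le (fun t => - h t) (fun t => - h' t)); [lra|intros; apply Hd'|]. intros t Ht. unfold h'.
      assert (E := exp_pos (- t)). assert (t ^ 3 <= 0) by (simpl; nra). nra. }
  rewrite H0 in K. unfold h in K. rewrite exp_Ropp in K. assert (E := exp_pos x).
  assert (K' : (1 + x + x ^ 2 / 2 + x ^ 3 / 6) * / exp x <= 1) by lra.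
  apply (Rmult_le_compat_r (exp x)) in K'; [|lra].
  rewrite Rmult_assoc, Rinv_l, Rmult_1_r, Rmult_1_l in K' by lra. exact K'.
Qed.

Lemma exp_mult_nat n x : exp (INR n * x) = exp x ^ n.
Proof.
  induction n as [|n IH]; [simpl; rewrite Rmult_0_l, exp_0; reflexivity|].
  rewrite S_INR, Rmult_plus_distr_r, exp_plus, IH, Rmult_1_l. simpl. ring.
Qed.

(** Dividing the exponent by 16 brings it into the range where the cubic is accurate. *)
Lemma exp_ge_pow16 x a : 0 <= a <= 1 + x + x ^ 2 / 2 + x ^ 3 / 6 -> a ^ 16 <= exp (16 * x).
Proof.
  intros [H0 H1]. replace (16 * x) with (INR 16 * x) by (simpl; ring). rewrite exp_mult_nat.
  apply pow_incr. split; [exact H0|]. eapply Rle_trans; [exact H1|apply exp_ge_cubic].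
Qed.

Lemma exp_7PI_10_ge : 8.95 <= exp (7 / 10 * PI).
Proof.
  assert (B := PI_bounds).
  (* [16 * 0.137375 = 0.7 * 3.14]. *)
  apply Rle_trans with (exp (16 * 0.137375)); [|apply exp_le; lra].
  eapply Rle_trans; [|apply (exp_ge_pow16 _ 1.1472)]; simpl; lra.
Qed.

Lemma exp_5PI_7_bounds : 9.3 <= exp (5 * PI / 7) <= 9.6.
Proof.
  assert (B := PI_bounds). split.
  - apply Rle_trans with (exp (16 * 0.14)); [|apply exp_le; lra].
    eapply Rle_trans; [|apply (exp_ge_pow16 _ 1.15025)]; simpl; lra.
  - assert (K : / 9.6 <= exp (- (5 * PI / 7))).
    { apply Rle_trans with (exp (16 * - 0.1403)); [|apply exp_le; lra].
      eapply Rle_trans; [|apply (exp_ge_pow16 _ 0.869)]; simpl; lra. }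
    rewrite exp_Ropp in K. assert (P := exp_pos (5 * PI / 7)).
    apply Rinv_le_contravar in K; [|lra]. rewrite !Rinv_inv in K. exact K.
Qed.

Lemma sin_le_id x : 0 <= x -> sin x <= x.
Proof. intros [H|<-]; [left; apply sin_lt_x, H|rewrite sin_0; lra]. Qed.

Lemma cos_ge_quadratic x : 0 <= x <= 1 -> 1 - x ^ 2 / 2 <= cos x.
Proof.
  intros H. assert (B := PI_bounds). replace x with (2 * (x / 2)) at 2 by field. rewrite cos_2a_sin.
  assert (S1 := sin_le_id (x / 2) ltac:(lra)). assert (S2 := sin_ge_0 (x / 2) ltac:(lra) ltac:(lra)).
  assert (sin (x / 2) * sin (x / 2) <= x / 2 * (x / 2)) by (apply Rmult_le_compat; assumption). nra.
Qed.

Section Estimates.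

Variables (alpha kappa : R).
Hypothesis Halpha : 0 < alpha < PI.

Let A : R := sin alpha * exp (kappa * alpha).

Lemma ccosh_parts s phi : ccosh (s, phi) = ((exp s + exp (- s)) / 2 * cos phi, (exp s - exp (- s)) / 2 * sin phi).
Proof.
  unfold ccosh, cexp. change (Re (- (s, phi))%C) with (- s). change (Im (- (s, phi))%C) with (- phi).
  rewrite cos_neg, sin_neg. apply C_eq; simpl; field.
Qed.

Lemma Cmod_strip_log_deriv s phi : ccosh (s, phi) <> RtoC (cos alpha) ->
  Cmod (strip_log_deriv alpha kappa (s, phi)) = A * exp (- kappa * phi) / Cmod (ccosh (s, phi) - RtoC (cos alpha)).
Proof using Halpha.
  intros N. assert (N' : (ccosh (s, phi) - RtoC (cos alpha))%C <> RtoC 0).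
  { intros E. apply N. replace (ccosh (s, phi)) with ((ccosh (s, phi) - RtoC (cos alpha)) + RtoC (cos alpha))%C by ring.
    rewrite E. ring. }
  assert (S := sin_gt_0 alpha (proj1 Halpha) (proj2 Halpha)).
  unfold strip_log_deriv. rewrite Cmod_div by exact N'.
  rewrite !Cmod_mult, Cmod_Ci, Cmod_R, Cmod_cexp, Rabs_pos_eq by lra. unfold A.
  replace (Re (RtoC kappa * (Ci * (s, phi) + RtoC alpha))%C) with (kappa * alpha + - kappa * phi) by (simpl; ring).
  rewrite exp_plus. unfold Rdiv. ring.
Qed.

(** As [q] is below both [cos alpha] and [- cos phi], the real part of [cosh w - cos alpha] is at
    most [- q (1 + cosh s)]. An antiderivative of [1 / (1 + cosh s)] is
    [tanh (s / 2) = (e^s - 1) / (e^s + 1)]. *)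
Lemma horizontal_bound (I : R -> C) S phi q : 0 <= S -> I 0 = 0%C -> 0 < q -> q <= cos alpha -> cos phi <= - q ->
  (forall s, vderiv I s (strip_log_deriv alpha kappa (s, phi))) ->
  Cmod (I S) <= A * exp (- kappa * phi) / q * ((exp S - 1) / (exp S + 1)).
Proof using Halpha.
  intros HS I0 Hq Ha Hphi HI.
  assert (SA := sin_gt_0 alpha (proj1 Halpha) (proj2 Halpha)).
  assert (PA : 0 < A * exp (- kappa * phi)) by (repeat apply Rmult_lt_0_compat; try apply exp_pos; exact SA).
  set (G := fun s => A * exp (- kappa * phi) / q * (1 - 2 / (exp s + 1))).
  set (G' := fun s => A * exp (- kappa * phi) / q * (2 * exp s / (exp s + 1) ^ 2)).
  assert (K := vderiv_bound I _ G G' 0 S HS (fun s _ => HI s)).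
  rewrite I0 in K. replace (I S - 0)%C with (I S) in K by ring.
  assert (EG : G S - G 0 = A * exp (- kappa * phi) / q * ((exp S - 1) / (exp S + 1))).
  { unfold G. rewrite exp_0. assert (P := exp_pos S). field. lra. }
  rewrite <- EG. apply K.
  - intros t _. unfold G, G'. assert (P := exp_pos t). auto_derive; [lra|]. field. lra.
  - intros t _. assert (P := exp_pos t).
    assert (Low : q * ((exp t + 1) ^ 2 / (2 * exp t)) <= Cmod (ccosh (t, phi) - RtoC (cos alpha))).
    { eapply Rle_trans; [|apply re_le_Cmod]. eapply Rle_trans; [|apply Rabs_maj2].
      rewrite Re_minus, ccosh_parts. simpl (Re _). rewrite exp_Ropp.
      set (ch := (exp t + / exp t) / 2).
      assert (Ech : (exp t + 1) ^ 2 / (2 * exp t) = 1 + ch) by (unfold ch; field; lra).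
      assert (0 < ch) by (unfold ch; assert (Q := Rinv_0_lt_compat _ P); lra).
      rewrite Ech. nra. }
    assert (Pl : 0 < q * ((exp t + 1) ^ 2 / (2 * exp t))).
    { apply Rmult_lt_0_compat; [exact Hq|]. apply Rdiv_lt_0_compat; [apply pow_lt|]; lra. }
    rewrite Cmod_strip_log_deriv.
    + unfold G'. replace (A * exp (- kappa * phi) / q * (2 * exp t / (exp t + 1) ^ 2))
        with (A * exp (- kappa * phi) / (q * ((exp t + 1) ^ 2 / (2 * exp t)))) by (field; lra).
      unfold Rdiv at 1 2. apply Rmult_le_compat_l; [lra|]. apply Rinv_le_contravar; assumption.
    + intros E. rewrite E in Low. replace (RtoC (cos alpha) - RtoC (cos alpha))%C with (RtoC 0) in Low by ring.
      rewrite Cmod_0 in Low. lra.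
Qed.

Section Vertical.

Variables (S Ch : R).
Hypothesis HkS : kappa * S = PI / 2.
Hypothesis Hkappa : 0 < kappa.
Hypothesis HCh : Ch = (exp S + exp (- S)) / 2.
Hypothesis HCh3 : 3 <= Ch.
Hypothesis Hca : 0 <= cos alpha.

(** The identity [|cosh w - 1| = 2 |sinh (w / 2)|^2 = cosh (Re w) - cos (Im w)]; this closed form is
    the reason for comparing with [alpha = 0]. *)
Lemma ccosh_sub_1 phi : Cmod (ccosh (S, phi) - 1) = Ch - cos phi.
Proof.
  assert (B := COS_bound phi).
  apply Rsqr_inj; [apply Cmod_ge_0|lra|]. unfold Rsqr.
  replace (Cmod (ccosh (S, phi) - 1) * Cmod (ccosh (S, phi) - 1)) with (Cmod (ccosh (S, phi) - 1) ^ 2) by ring.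
  rewrite Cmod2_alt, Re_minus, Im_minus, ccosh_parts. simpl (Re _). simpl (Im _). rewrite <- HCh.
  set (Sh := (exp S - exp (- S)) / 2).
  assert (E : Sh * Sh = Ch * Ch - 1).
  { unfold Sh. rewrite HCh, exp_Ropp. assert (P := exp_pos S). field. lra. }
  assert (S2 := sin2_cos2 phi). unfold Rsqr in S2.
  replace ((Sh * sin phi - 0) ^ 2) with ((Sh * Sh) * (1 - cos phi * cos phi)) by (rewrite <- S2; ring).
  rewrite E. ring.
Qed.

Lemma ccosh_sub_cos_ge phi : Ch - 2 + cos alpha <= Cmod (ccosh (S, phi) - RtoC (cos alpha)).
Proof.
  assert (B := COS_bound phi). assert (Ba := COS_bound alpha).
  assert (T := Cmod_triangle_inv (ccosh (S, phi) - 1)%C (RtoC (cos alpha - 1))).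
  rewrite Cmod_R, (Rabs_left1 (cos alpha - 1)), ccosh_sub_1 in T by lra.
  replace (ccosh (S, phi) - 1 - RtoC (cos alpha - 1))%C with (ccosh (S, phi) - RtoC (cos alpha))%C in T
    by (rewrite RtoC_minus; ring). lra.
Qed.

(** Bounds the error of replacing [cos alpha] by 1 in [1 / (cosh w - cos alpha)]: the difference has
    numerator [1 - cos alpha], and the two factors below are lower bounds for the moduli of the
    denominators. *)
Definition resolvent_error : R := (1 - cos alpha) / ((Ch - 1) * (Ch - 2 + cos alpha)).

Lemma Re_resolvent_ge phi :
  (Ch * cos phi - 1) / (Ch - cos phi) ^ 2 - resolvent_error <= Re (/ (ccosh (S, phi) - RtoC (cos alpha)))%C.
Proof.
  assert (B := COS_bound phi). assert (Ba := COS_bound alpha).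
  assert (L := ccosh_sub_cos_ge phi). assert (L1 := ccosh_sub_1 phi).
  set (u := (ccosh (S, phi) - RtoC (cos alpha))%C) in *. set (v := (ccosh (S, phi) - 1)%C) in *.
  assert (Nu : u <> RtoC 0) by (apply Cmod_gt_0; lra). assert (Nv : v <> RtoC 0) by (apply Cmod_gt_0; lra).
  assert (Ev : Re (/ v)%C = (Ch * cos phi - 1) / (Ch - cos phi) ^ 2).
  { rewrite <- L1, Cmod2_alt. assert (M : Re v = Ch * cos phi - 1).
    { unfold v. rewrite Re_minus, ccosh_parts, HCh. reflexivity. }
    rewrite <- M. destruct v as [a b]. simpl. f_equal. }
  assert (Euv : (/ v - / u)%C = (RtoC (1 - cos alpha) / (v * u))%C).
  { rewrite RtoC_minus. replace (1 - RtoC (cos alpha))%C with (u - v)%C by (unfold u, v; ring).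
    field. split; assumption. }
  assert (Bd : Re (/ v - / u)%C <= resolvent_error).
  { eapply Rle_trans; [apply Rle_abs|]. eapply Rle_trans; [apply re_le_Cmod|].
    rewrite Euv, Cmod_div, Cmod_mult, Cmod_R, Rabs_pos_eq, L1 by (lra || (apply Cmult_neq_0; assumption)).
    unfold resolvent_error. apply Rmult_le_compat_l; [lra|]. apply Rinv_le_contravar; nra. }
  rewrite Re_minus, Ev in Bd. lra.
Qed.

(** Since [kappa * S = PI / 2], the exponential is [i] times a positive number. The imaginary part
    is therefore a negative multiple of the real part of the resolvent. *)
Lemma strip_log_deriv_vertical phi :
  (strip_log_deriv alpha kappa (S, phi) * Ci)%C =
  (RtoC (- (A * exp (- kappa * phi))) * (Ci * / (ccosh (S, phi) - RtoC (cos alpha))))%C.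
Proof.
  unfold strip_log_deriv.
  replace (cexp (RtoC kappa * (Ci * (S, phi) + RtoC alpha))%C)
    with (RtoC (exp (kappa * alpha) * exp (- kappa * phi)) * Ci)%C.
  - unfold A. rewrite RtoC_opp, !RtoC_mult.
    replace (Ci * RtoC (sin alpha) * (RtoC (exp (kappa * alpha)) * RtoC (exp (- kappa * phi)) * Ci) / (ccosh (S, phi) - RtoC (cos alpha)) * Ci)%C
      with ((Ci * Ci) * (RtoC (sin alpha) * (RtoC (exp (kappa * alpha)) * RtoC (exp (- kappa * phi))) * (Ci * / (ccosh (S, phi) - RtoC (cos alpha)))))%C
      by (unfold Cdiv; ring).
    rewrite Ci_sqr. ring.
  - rewrite <- exp_plus. unfold cexp.
    replace (Re (RtoC kappa * (Ci * (S, phi) + RtoC alpha))%C) with (kappa * alpha + - kappa * phi) by (simpl; ring).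
    replace (Im (RtoC kappa * (Ci * (S, phi) + RtoC alpha))%C) with (kappa * S) by (simpl; ring).
    rewrite HkS, cos_PI2, sin_PI2. apply C_eq; simpl; ring.
Qed.

(* The first summand of [vertical_minorant] differentiates to the resolvent at [alpha = 0]
   minus [kappa sin / (Ch - cos)], which the second one recovers up to [1 / (Ch - x) >= (1 + x / Ch) / Ch]. *)
Definition vertical_minorant (phi : R) : R :=
  exp (- kappa * phi) * (sin phi / (Ch - cos phi) - kappa / Ch *
    ((kappa * sin phi + cos phi) / (1 + kappa ^ 2) +
     (kappa * sin (2 * phi) + 2 * cos (2 * phi)) / (2 * Ch * (4 + kappa ^ 2)))) - resolvent_error * phi.

(** The first estimate decides the sign of the final argument; the cruder second one keeps that
    argument below [PI]. *)
Lemma vertical_bounds (I : R -> C) phi1 phi2 : I phi2 = 0%C -> 0 <= phi2 <= phi1 -> phi1 <= PI ->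
  (forall t, vderiv I t (strip_log_deriv alpha kappa (S, t) * Ci)%C) ->
  A * (vertical_minorant phi1 - vertical_minorant phi2) <= - Im (I phi1) /\
  Cmod (I phi1) <= A / (Ch - 2 + cos alpha) * (phi1 - phi2).
Proof using Halpha HkS Hkappa HCh HCh3 Hca.
  intros I0 H2 H1 HI.
  assert (SA := sin_gt_0 alpha (proj1 Halpha) (proj2 Halpha)).
  assert (PA : 0 < A) by (apply Rmult_lt_0_compat; [exact SA|apply exp_pos]).
  assert (Ba := COS_bound alpha).
  assert (Pe : 0 <= resolvent_error).
  { unfold resolvent_error. apply Rdiv_le_0_compat; [lra|]. apply Rmult_lt_0_compat; lra. }
  assert (He : forall t, phi2 <= t <= phi1 -> 0 < exp (- kappa * t) <= 1).
  { intros t Ht. split; [apply exp_pos|]. rewrite <- exp_0. apply exp_le. nra. }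
  split.
  (* [psi'] lies below the weighted resolvent: the subtracted multiple of [kappa * sin t] is
     nonnegative on [[0, PI]], and the error is taken with weight 1 instead of
     [exp (- kappa * t)]. *)
  - set (psi' := fun t => exp (- kappa * t) * ((Ch * cos t - 1) / (Ch - cos t) ^ 2
      - kappa * sin t * (/ (Ch - cos t) - (1 + cos t / Ch) / Ch)) - resolvent_error).
    assert (Hpsi : forall t, is_derive vertical_minorant t (psi' t)).
    { intros t. unfold vertical_minorant, psi'. assert (B := COS_bound t).
      assert (S2 := sin2_cos2 t). unfold Rsqr in S2.
      assert (Nk1 : 1 + kappa ^ 2 <> 0) by nra. assert (Nk2 : 4 + kappa ^ 2 <> 0) by nra.
      auto_derive; [lra|].
      transitivity (exp (- kappa * t) * ((cos t * (Ch - cos t) - sin t * sin t) / (Ch - cos t) ^ 2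
        - kappa * sin t / (Ch - cos t) + kappa / Ch * (sin t + sin (2 * t) / (2 * Ch))) - resolvent_error).
      - field. lra.
      - replace (cos t * (Ch - cos t) - sin t * sin t) with (Ch * cos t - 1) by lra.
        rewrite sin_2a. field. lra. }
    set (L := fun t => - Im (I t) - A * vertical_minorant t).
    assert (K := derive_nonneg_le L (fun t => - Im (strip_log_deriv alpha kappa (S, t) * Ci)%C - A * psi' t) phi2 phi1 (proj2 H2)).
    assert (E : L phi2 <= L phi1).
    { apply K.
      - intros t _. apply (is_derive_minus (fun t => - Im (I t)) (fun t => A * vertical_minorant t)).
        + apply (is_derive_opp (fun t => Im (I t))), (vderiv_im I), HI.
        + apply (is_derive_scal vertical_minorant), Hpsi.
      - intros t Ht. rewrite strip_log_deriv_vertical.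
        assert (R1 := Re_resolvent_ge t). set (r := (/ (ccosh (S, t) - RtoC (cos alpha)))%C) in *.
        replace (Im (RtoC (- (A * exp (- kappa * t))) * (Ci * r))%C) with (- (A * exp (- kappa * t)) * Re r)
          by (simpl; ring).
        assert (Et := He t Ht). assert (B := COS_bound t).
        assert (St : 0 <= sin t) by (apply sin_ge_0; lra).
        assert (Tan : (1 + cos t / Ch) / Ch <= / (Ch - cos t)).
        { apply (Rmult_le_reg_r (Ch - cos t)); [lra|]. rewrite Rinv_l by lra.
          replace ((1 + cos t / Ch) / Ch * (Ch - cos t)) with (1 - (cos t / Ch) ^ 2) by (field; lra).
          assert (Q := pow2_ge_0 (cos t / Ch)). lra. }
        unfold psi'.
        set (K1 := (Ch * cos t - 1) / (Ch - cos t) ^ 2) in *.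
        set (D := / (Ch - cos t) - (1 + cos t / Ch) / Ch) in *. assert (PD : 0 <= D) by (unfold D; lra).
        set (e := exp (- kappa * t)) in *.
        assert (Q1 : e * (K1 - resolvent_error) <= e * Re r) by (apply Rmult_le_compat_l; lra).
        assert (Q2 : 0 <= e * (kappa * sin t * D)) by (repeat apply Rmult_le_pos; lra).
        assert (Q3 : e * resolvent_error <= 1 * resolvent_error) by (apply Rmult_le_compat_r; lra).
        assert (Q4 : 0 <= A * (e * Re r - (e * (K1 - kappa * sin t * D) - resolvent_error))).
        { apply Rmult_le_pos; lra. }
        lra. }
    unfold L in E. rewrite I0 in E. change (Im (RtoC 0)) with 0 in E. lra.
  - assert (K := vderiv_bound I _ (fun t => A / (Ch - 2 + cos alpha) * t) (fun _ => A / (Ch - 2 + cos alpha)) phi2 phi1 (proj2 H2) (fun t _ => HI t)).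
    rewrite I0 in K. replace (I phi1 - 0)%C with (I phi1) in K by ring.
    rewrite Rmult_minus_distr_l. apply K.
    + intros t _. auto_derive; [trivial|ring].
    + intros t Ht. rewrite strip_log_deriv_vertical. assert (L := ccosh_sub_cos_ge t).
      assert (Nu : (ccosh (S, t) - RtoC (cos alpha))%C <> RtoC 0) by (apply Cmod_gt_0; lra).
      assert (Et := He t Ht).
      rewrite !Cmod_mult, Cmod_inv, Cmod_Ci, Cmod_R, Rmult_1_l by exact Nu.
      rewrite Rabs_Ropp, Rabs_pos_eq by (apply Rmult_le_pos; lra).
      apply Rmult_le_compat; [apply Rmult_le_pos; lra| |nra|].
      * apply Rlt_le, Rinv_0_lt_compat; lra.
      * apply Rinv_le_contravar; lra.
Qed.

End Vertical.

End Estimates.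

(** * Upper bound *)

Lemma cosh_5PI_7_bounds : 4.7 <= (exp (5 * PI / 7) + exp (- (5 * PI / 7))) / 2 <= 4.854.
Proof.
  assert (B := exp_5PI_7_bounds). rewrite exp_Ropp. set (X := exp (5 * PI / 7)) in *.
  assert (X * / X = 1) by (field; lra). assert (Q : 0 < / X) by (apply Rinv_0_lt_compat; lra).
  split; nra.
Qed.

Lemma minorant_gap : let Ch := (exp (5 * PI / 7) + exp (- (5 * PI / 7))) / 2 in
  0.098 <= vertical_minorant (1 / 10) (7 / 10) Ch (PI - 1 / 100) - vertical_minorant (1 / 10) (7 / 10) Ch (1 / 100).
Proof.
  intros Ch. assert (BC : 4.7 <= Ch <= 4.854) by apply cosh_5PI_7_bounds. assert (BP := PI_bounds). clearbody Ch.
  assert (Ca := cos_ge_quadratic (1 / 10) ltac:(lra)). assert (Ca' := COS_bound (1 / 10)).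
  assert (C1 := cos_ge_quadratic (1 / 100) ltac:(lra)). assert (C1' := COS_bound (1 / 100)).
  assert (C2 := cos_ge_quadratic (2 * (1 / 100)) ltac:(lra)). assert (C2' := COS_bound (2 * (1 / 100))).
  assert (S1 := sin_le_id (1 / 100) ltac:(lra)). assert (S1' := sin_ge_0 (1 / 100) ltac:(lra) ltac:(lra)).
  assert (S2 := sin_le_id (2 * (1 / 100)) ltac:(lra)). assert (S2' := sin_ge_0 (2 * (1 / 100)) ltac:(lra) ltac:(lra)).
  assert (He : 0 <= resolvent_error (1 / 10) Ch <= 0.00037).
  { unfold resolvent_error. split.
    - apply Rdiv_le_0_compat; [lra|]. apply Rmult_lt_0_compat; lra.
    - assert (Pd : 13.67 <= (Ch - 1) * (Ch - 2 + cos (1 / 10))).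
      { apply Rle_trans with (3.7 * 3.695); [lra|]. apply Rmult_le_compat; lra. }
      apply Rle_div_l; lra. }
  unfold vertical_minorant. replace (1 + (7 / 10) ^ 2) with (149 / 100) by field.
  replace (4 + (7 / 10) ^ 2) with (449 / 100) by field. set (re := resolvent_error (1 / 10) Ch) in *. clearbody re.
  replace (2 * (PI - 1 / 100)) with (- (2 * (1 / 100)) + 2 * PI) by field.
  rewrite cos_plus, sin_plus, cos_2PI, sin_2PI, !Rmult_0_r, !Rmult_1_r, Rminus_0_r, Rplus_0_r.
  rewrite cos_neg, sin_neg, sin_PI_x.
  replace (cos (PI - 1 / 100)) with (- cos (1 / 100)).
  2:{ rewrite cos_minus, cos_PI, sin_PI. ring. }
  set (c1 := cos (1 / 100)) in *. set (s1 := sin (1 / 100)) in *.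
  set (c2 := cos (2 * (1 / 100))) in *. set (s2 := sin (2 * (1 / 100))) in *.
  set (E1 := exp (- (7 / 10) * (PI - 1 / 100))). set (E2 := exp (- (7 / 10) * (1 / 100))).
  assert (P1 : 0 < E1) by apply exp_pos.
  assert (P2 : 0.993 <= E2).
  { eapply Rle_trans; [|apply exp_ineq1_le]. lra. }
  clearbody E1 E2 c1 s1 c2 s2.
  set (i := / Ch). assert (Hi : Ch * i = 1) by (unfold i; field; lra).
  assert (Bi : 0.206 <= i <= 0.2128) by (split; nra).
  (* The contribution of the upper end carries the small factor [E1] and is nonnegative, so it is
     dropped. The gap comes from the lower end, where the bracket is negative and [E2] is close to
     1. *)
  assert (U1 : 0 <= E1 * (s1 / (Ch - - c1) - 7 / 10 / Ch *
     ((7 / 10 * s1 + - c1) / (149 / 100) + (7 / 10 * - s2 + 2 * c2) / (2 * Ch * (449 / 100))))).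
  { apply Rmult_le_pos; [lra|].
    assert (0 <= s1 / (Ch - - c1)) by (apply Rdiv_le_0_compat; lra).
    replace (7 / 10 / Ch) with (7 / 10 * i) by (unfold i; field; lra).
    replace ((7 / 10 * - s2 + 2 * c2) / (2 * Ch * (449 / 100))) with ((7 / 10 * - s2 + 2 * c2) * i * (100 / 898))
      by (unfold i; field; lra).
    assert ((7 / 10 * - s2 + 2 * c2) * i <= 2 * 0.2128) by (apply Rmult_le_compat; lra).
    assert (0 <= i * (- ((7 / 10 * s1 + - c1) / (149 / 100) + (7 / 10 * - s2 + 2 * c2) * i * (100 / 898)))) by (apply Rmult_le_pos; lra).
    lra. }
  assert (U2 : s1 / (Ch - c1) - 7 / 10 / Ch *
     ((7 / 10 * s1 + c1) / (149 / 100) + (7 / 10 * s2 + 2 * c2) / (2 * Ch * (449 / 100))) <= - 0.1002).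
  { assert (s1 / (Ch - c1) <= 0.00271) by (apply Rle_div_l; lra).
    replace (7 / 10 / Ch) with (7 / 10 * i) by (unfold i; field; lra).
    replace ((7 / 10 * s2 + 2 * c2) / (2 * Ch * (449 / 100))) with ((7 / 10 * s2 + 2 * c2) * i * (100 / 898))
      by (unfold i; field; lra).
    assert (1.9996 * 0.206 <= (7 / 10 * s2 + 2 * c2) * i) by (apply Rmult_le_compat; lra).
    assert (0.206 * 0.7169 <= i * ((7 / 10 * s1 + c1) / (149 / 100) + (7 / 10 * s2 + 2 * c2) * i * (100 / 898))) by (apply Rmult_le_compat; lra).
    lra. }
  set (B1 := E1 * _) in *. set (B2 := s1 / (Ch - c1) - _) in *. clearbody B1 B2.
  assert (re * PI <= 0.00037 * 3.1421) by (apply Rmult_le_compat; lra).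
  (* [0.993 * 0.1002 - 0.00037 * 3.1421] exceeds [0.098]. *)
  nra.
Qed.

Lemma not_good_7PI_10 : ~ good_delta (7 / 10 * PI).
Proof.
  intros Hgood. assert (BP := PI_bounds).
  (* [S] is [PI / (2 kappa)]. The heights [phi1] and [phi2] stay [1 / 100] inside the strip because
     [strip_point] maps into the disk only for [0 < Im w < PI]. *)
  set (alpha := 1 / 10). set (kappa := 7 / 10). set (S := 5 * PI / 7).
  set (phi1 := PI - 1 / 100). set (phi2 := 1 / 100).
  assert (Ha : 0 < alpha < PI) by (unfold alpha; lra).
  destruct (strip_map alpha Ha) as [T [dT [T0 [HT [Tsym [Texp Tstrip]]]]]].
  destruct (function_of_log_derivative (fun z => cexp (RtoC kappa * T z)%C)
     (fun z => cexp (RtoC kappa * T z) * (RtoC kappa * dT z))%C) as [H [g [H0 [HH [Hg Hsym]]]]].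
  { intros z Hz. apply (cderiv_comp cexp (fun z => RtoC kappa * T z)%C); [apply cderiv_cexp|apply cderiv_scal, HT, Hz]. }
  { rewrite T0. replace (RtoC kappa * 0)%C with (RtoC 0) by ring. apply cexp_0. }
  { intros z Hz. rewrite Tsym, Cconj_cexp, Cmult_conj, Cconj_RtoC by exact Hz. reflexivity. }
  assert (Hf := exp_form_holo H g HH).
  assert (Hfp : forall z, in_disk z -> (z * (cexp (H z) * (1 + z * g z)))%C = (z * cexp (H z) * cexp (RtoC kappa * T z))%C).
  { intros z Hz. rewrite (Hg z Hz). ring. }
  assert (Hmod : forall z, in_disk z -> Cmod (1 + z * g z) = exp (kappa * Re (T z))).
  { intros z Hz. rewrite (Hg z Hz), Cmod_cexp. f_equal. rewrite Re_mult. simpl. ring. }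
  (* [Re (T z)] ranges in [(alpha - PI, alpha)], so the least admissible modulus is
     [exp (kappa * (alpha - PI))] and the ratio is [exp (kappa * PI)]. *)
  assert (Hratio := exp_form_ratio_le H g (exp (kappa * (alpha - PI))) (kappa * PI) HH H0 (exp_pos _)).
  assert (U : univalent_on_disk (fun z => z * cexp (H z))%C).
  { apply Hgood; [apply (exp_form_classA H g HH H0)|]. apply Hratio.
    - rewrite <- exp_plus, <- exp_0. split; apply exp_le; unfold kappa, alpha; lra.
    - intros z Hz. rewrite (Hmod z Hz), <- exp_plus. assert (B := Tstrip z Hz).
      split; apply exp_le; unfold kappa; nra. }
  revert U.
  assert (BX := exp_5PI_7_bounds). assert (BC := cosh_5PI_7_bounds). fold S in BX, BC.
  assert (PS : 0 < S) by (unfold S; lra).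
  destruct (path_value alpha kappa T _ _ Ha Texp Tstrip Hf Hfp S phi1 phi2 PS) as [I1 [I2 [Z1 [Z2 [D1 [D2 E]]]]]].
  { unfold alpha, phi1; lra. } { unfold phi1, phi2; lra. }
  assert (Hphi2 : 0 < Im ((S, phi2) : C) < PI) by (simpl; unfold phi2; lra).
  destruct (strip_point_parts alpha Ha (S, phi2) Hphi2) as [Hz [Hzi _]].
  assert (SA : 0 < sin alpha) by (apply sin_gt_0; lra).
  apply (exp_form_not_univalent H g (strip_point alpha (S, phi2)) HH H0 Hsym Hz).
  - rewrite Hzi, Cmod_cexp. simpl (Re _).
    assert (Nd := strip_point_den alpha Ha (S, phi2) Hphi2).
    assert (Pd : 0 < Cmod (cexp (0%R, alpha) * cexp (S, phi2) - 1) ^ 2) by (apply pow_lt, Cmod_nz, Nd).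
    apply Rlt_div_l; [exact Pd|]. rewrite Rmult_0_l. assert (1 - exp S ^ 2 < 0) by nra. nra.
  - rewrite E.
    assert (Hphi1 : 0 < Im ((0, phi1) : C) < PI) by (simpl; unfold phi1; lra).
    destruct (strip_point_parts alpha Ha (0, phi1) Hphi1) as [Hz1 [Hi1 Hr1]].
    assert (Nd := strip_point_den alpha Ha (0, phi1) Hphi1).
    assert (Pd : 0 < Cmod (cexp (0%R, alpha) * cexp (0%R, phi1) - 1) ^ 2) by (apply pow_lt, Cmod_nz, Nd).
    rewrite Cmod_cexp in Hi1, Hr1. simpl (Re (0, phi1)) in Hi1, Hr1. rewrite exp_0 in Hi1, Hr1.
    (* The path starts on the positive real axis, where [H] is real by symmetry; hence [f] is
       positive there and the final argument is the accumulated change alone. *)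
    assert (Hr1' : 0 < Re (strip_point alpha (0, phi1))).
    { rewrite Hr1. apply Rdiv_lt_0_compat; [|exact Pd]. unfold cexp; simpl. rewrite exp_0.
      assert (D := cos_decreasing_1 alpha phi1). unfold alpha, phi1 in *. lra. }
    set (z1 := strip_point alpha (0, phi1)) in *.
    assert (Im1 : Im z1 = 0) by (rewrite Hi1; unfold Rdiv; ring).
    assert (Ez1 : z1 = RtoC (Re z1)) by (apply C_eq; [reflexivity|exact Im1]).
    assert (ImH : Im (H z1) = 0).
    { assert (Q := Hsym z1 Hz1). rewrite Ez1 in Q at 1. rewrite Cconj_RtoC, <- Ez1 in Q.
      apply (f_equal Im) in Q. change (Im (Cconj (H z1))) with (- Im (H z1)) in Q. lra. }
    assert (Ef : (z1 * cexp (H z1))%C = RtoC (Re z1 * exp (Re (H z1)))).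
    { rewrite Ez1 at 1. unfold cexp. rewrite ImH, cos_0, sin_0. apply C_eq; simpl; ring. }
    rewrite Ef, Im_mult. change (Im (RtoC (Re z1 * exp (Re (H z1))))) with 0. rewrite Rmult_0_l, Rplus_0_r.
    apply Rmult_le_pos; [apply Rmult_le_pos; [lra|apply Rlt_le, exp_pos]|].
    change (0 <= exp (Re (I1 S - I2 phi1)%C) * sin (Im (I1 S - I2 phi1)%C)).
    apply Rmult_le_pos; [apply Rlt_le, exp_pos|].
    assert (Ca := cos_ge_quadratic alpha ltac:(unfold alpha; lra)).
    assert (Cae : 0.995 <= cos alpha) by (unfold alpha in *; lra). clear Ca.
    assert (Cp : cos phi1 <= - (0.995)).
    { assert (Q := cos_ge_quadratic (1 / 100) ltac:(lra)). unfold phi1. rewrite cos_minus, cos_PI, sin_PI. lra. }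
    assert (HB := horizontal_bound alpha kappa Ha I1 S phi1 0.995 ltac:(lra) Z1 ltac:(lra) Cae Cp D1).
    set (A := sin alpha * exp (kappa * alpha)) in *.
    assert (PA : 0 < A) by (apply Rmult_lt_0_compat; [exact SA|apply exp_pos]).
    assert (HkS : kappa * S = PI / 2) by (unfold kappa, S; field).
    destruct (vertical_bounds alpha kappa Ha S ((exp S + exp (- S)) / 2) HkS ltac:(unfold kappa; lra) eq_refl
       ltac:(lra) ltac:(lra) I2 phi1 phi2 Z2 ltac:(unfold phi1, phi2; lra) ltac:(unfold phi1; lra) D2) as [V1 V2].
    fold A in V1, V2.
    assert (G := minorant_gap). fold S alpha kappa phi1 phi2 in G. cbv zeta in G.
    set (gap := vertical_minorant _ _ _ phi1 - vertical_minorant _ _ _ phi2) in *. clearbody gap.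
    assert (AG : A * 0.098 <= A * gap) by (apply Rmult_le_compat_l; lra).
    (* The cost of the horizontal side in units of [A], to be beaten by the vertical gain
       [0.098]. *)
    assert (HH1 : exp (- kappa * phi1) / 0.995 * ((exp S - 1) / (exp S + 1)) <= 0.093).
    { assert (Q1 : (exp S - 1) / (exp S + 1) <= 0.8114) by (apply Rle_div_l; lra).
      assert (Q2 : exp (- kappa * phi1) <= 0.1126).
      { replace (- kappa * phi1) with (- (7 / 10 * PI) + 0.007) by (unfold kappa, phi1; lra).
        rewrite exp_plus, exp_Ropp. assert (Y := exp_7PI_10_ge).
        assert (Y' : / exp (7 / 10 * PI) <= 0.11174).
        { apply Rle_trans with (/ 8.95); [apply Rinv_le_contravar; lra|lra]. }
        assert (Z : exp 0.007 <= 1.0071).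
        { assert (W := exp_ineq1_le (- (0.007))). rewrite exp_Ropp in W.
          assert (W0 : 1 + - (0.007) = 0.993) by lra. rewrite W0 in W.
          apply Rinv_le_contravar in W; [|lra]. rewrite Rinv_inv in W. lra. }
        apply Rle_trans with (0.11174 * 1.0071); [|lra].
        apply Rmult_le_compat; try lra; [apply Rlt_le, Rinv_0_lt_compat, exp_pos|apply Rlt_le, exp_pos]. }
      apply Rle_trans with (0.1126 / 0.995 * 0.8114); [|lra].
      assert (P := exp_pos (- kappa * phi1)).
      apply Rmult_le_compat; [lra|apply Rdiv_le_0_compat; lra|lra|exact Q1]. }
    assert (HB' : Cmod (I1 S) <= A * 0.093).
    { eapply Rle_trans; [exact HB|]. apply (Rmult_le_compat_l A) in HH1; [|lra]. lra. }
    (* The argument is already nonnegative by [0.098 > 0.093]; crude bounds suffice to keep it below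
       [PI]. *)
    assert (HA : A <= 0.2).
    { unfold A. assert (Q := sin_le_id alpha ltac:(unfold alpha; lra)).
      assert (Q2 : exp (kappa * alpha) <= 2).
      { assert (W := exp_ineq1_le (- (kappa * alpha))). rewrite exp_Ropp in W.
        assert (W0 : 1 + - (kappa * alpha) = 0.93) by (unfold kappa, alpha; lra). rewrite W0 in W.
        apply Rinv_le_contravar in W; [|lra]. rewrite Rinv_inv in W. lra. }
      replace 0.2 with (0.1 * 2) by lra. apply Rmult_le_compat; try lra; [apply Rlt_le, exp_pos|unfold alpha in *; lra]. }
    assert (HV2 : Cmod (I2 phi1) <= 1).
    { eapply Rle_trans; [exact V2|].
      assert (A / ((exp S + exp (- S)) / 2 - 2 + cos alpha) <= 0.2) by (apply Rle_div_l; lra).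
      apply Rle_trans with (0.2 * 5); [|lra].
      apply Rmult_le_compat; [apply Rdiv_le_0_compat; lra|unfold phi1, phi2; lra|assumption|unfold phi1, phi2; lra]. }
    assert (M1 := im_le_Cmod (I1 S)). assert (M2 := im_le_Cmod (I2 phi1)).
    assert (M1' := Rle_trans _ _ _ M1 HB'). apply Rabs_le_between in M1'.
    assert (M2' := Rle_trans _ _ _ M2 HV2). apply Rabs_le_between in M2'.
    rewrite Im_minus. apply sin_ge_0; lra.
Qed.

Theorem theorem1p2 :
  Rbar_lt (Finite (7 * PI / 25)) delta1 /\ Rbar_lt delta1 (Finite (5 * PI / 7)).
Proof.
  assert (HPI := PI_RGT_0). unfold delta1.
  destruct (Lub_Rbar_correct (fun delta => 0 < delta /\ good_delta delta)) as [U1 U2].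
  split.
  - apply Rbar_lt_le_trans with (Finite (29 / 100 * PI)); [simpl; lra|].
    apply U1. split; [lra|]. apply good_delta_small. lra.
  - apply Rbar_le_lt_trans with (Finite (7 / 10 * PI)); [|simpl; lra].
    apply U2. intros d [_ Hd]. simpl. apply Rnot_lt_le. intros L.
    apply not_good_7PI_10. apply (good_delta_mono d); [lra|exact Hd].
Qed.
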